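(* Let $q\ge2$ be an integer, $T=T_q$ the homogeneous tree of degree $q+1$ with the canonical flow measure $\mu(x)=q^{\ell(x)}$, and $\mathcal L$ the flow Laplacian. Let $\varepsilon:T\to\mathbb C$ be bounded with $\sum_{y\in\mathfrak s(x)}\varepsilon(y)=0$ for all $x\in T$, let $\nabla_{\varepsilon}f(x)=\frac1q\sum_{y\in\mathfrak s(x)}\varepsilon(y)f(y)$, and let $\mathcal R_\varepsilon=\nabla_{\varepsilon}\mathcal L^{-1/2}$. Then $\mathcal R_\varepsilon$ is bounded on $L^p(\mu)$ for every $p\in(1,\infty)$, and $\mathcal R_\varepsilon$ is of weak type $(1,1)$, i.e. there is $C<\infty$ such that $\mu(\{|\mathcal R_\varepsilon f|>\lambda\})\le C\lambda^{-1}\|f\|_{L^1(\mu)}$ for all $\lambda>0$ and all $f\in L^1(\mu)\cap L^2(\mu)$.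
   Context: $T=T_q$ ($q\ge2$ an integer) is the infinite tree in which every vertex has exactly $q+1$ neighbours, identified with its vertex set, with graph distance $d$. Fix a vertex $o$ and an infinite geodesic ray $\omega_*$ emanating from $o$. For $x\in T$ let $x\wedge\omega_*$ be the vertex of $\omega_*$ closest to $x$; the level of $x$ is $\ell(x)=d(o,x\wedge\omega_* )-d(x,x\wedge\omega_* )$. Each $x$ has a unique neighbour $\mathfrak p(x)$ (predecessor) with $\ell(\mathfrak p(x))=\ell(x)+1$; the other $q$ neighbours, of level $\ell(x)-1$, form the set $\mathfrak s(x)$ of successors. The measure $\mu$ on $T$ is $\mu(\{x\})=\mu(x)=q^{\ell(x)}$. The flow Laplacian is $\mathcal L f(x)=f(x)-\frac{1}{2\sqrt q}\sum_{y\sim x}\frac{\mu(y)^{1/2}}{\mu(x)^{1/2}}f(y)$, where $\sim$ denotes adjacency. It equals $\frac12\nabla^*\nabla$, where $\nabla f(x)=f(x)-f(\mathfrak p(x))$ and $\nabla^*$ is the $L^2(\mu)$-adjoint. It is bounded, nonnegative, self-adjoint and injective on $L^2(\mu)$; $\mathcal L^{-1/2}$ is the (unbounded) operator defined by the Spectral Theorem. Finitely supported functions belong to its domain, and $\mathcal R_\varepsilon$ extends to a bounded operator on $L^2(\mu)$. ''Bounded on $L^p(\mu)$'' means $\|\mathcal R_\varepsilon f\|_{L^p(\mu)}\le C_p\|f\|_{L^p(\mu)}$ for all finitely supported $f$ (hence extension to $L^p(\mu)$). *)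

(* Defs.v *)
From HB Require Import structures.
From mathcomp Require Import all_boot all_order all_algebra.
From mathcomp Require Import all_classical all_reals all_analysis.
From mathcomp Require Import complex.

Set Implicit Arguments.
Unset Strict Implicit.
Unset Printing Implicit Defensive.

Import Order.TTheory GRing.Theory Num.Theory.
Import numFieldNormedType.Exports.
Import HBSimple.

Local Open Scope classical_set_scope.
Local Open Scope ring_scope.
Local Open Scope complex_scope.

(* A graph together with a sequence of vertices; [ray 0] plays the role of
   the base vertex o and [ray] that of the geodesic ray omega_*. *)
Record rayGraph := RayGraph {
  vertex :> Type;
  adj : rel vertex;
  ray : nat -> vertex }.

HB.instance Definition _ (T : rayGraph) := gen_eqMixin (vertex T).
HB.instance Definition _ (T : rayGraph) := gen_choiceMixin (vertex T).
HB.instance Definition _ (T : rayGraph) := isPointed.Build (vertex T) (ray T 0).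
HB.instance Definition _ (T : rayGraph) :=
  @isMeasurable.Build default_measure_display (vertex T)
    discrete_measurable discrete_measurable0
    discrete_measurableC discrete_measurableU.

Section tree.
Variable T : rayGraph.
Implicit Types x y : T.

Definition origin : T := ray T 0.

Definition walk x y (n : nat) : Prop :=
  exists p : seq T, [/\ path (@adj T) x p, last x p = y & size p = n].

Definition dist x y : nat :=
  xget 0%N [set n | walk x y n /\ forall m, walk x y m -> (n <= m)%N].

(* A [ucycle] of size 2 is an edge traversed back and forth, so acyclicity
   only forbids repetition-free cycles of size at least 3. *)
Record homogeneous_tree (q : nat) : Prop := HomogeneousTree {
  adj_sym : symmetric (@adj T);
  adj_irr : irreflexive (@adj T);
  tree_connected : forall x y, exists n, walk x y n;
  tree_acyclic : forall c : seq T, ucycle (@adj T) c -> (size c <= 2)%N;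
  tree_degree : forall x, ([set y | adj x y] #= `I_q.+1)%card }.

Definition geodesic_ray : Prop :=
  forall m n, (m <= n)%N -> dist (ray T m) (ray T n) = (n - m)%N.

Definition confluent x : T :=
  xget origin [set z | range (ray T) z /\
                       forall n, (dist x z <= dist x (ray T n))%N].

Definition level x : int :=
  (dist origin (confluent x))%:Z - (dist x (confluent x))%:Z.

Definition successors x : set T := [set y | adj x y /\ level y = level x - 1].

End tree.

Section flow_measure.
Variables (R : realType) (q : nat) (T : rayGraph).

Definition mass (x : T) : R := q%:R ^ level x.

Definition flow_measure (A : set T) : \bar R := (\esum_(x in A) (mass x)%:E)%E.

Lemma mass_ge0 (x : T) : (0 <= (mass x)%:E)%E.
Proof. by rewrite lee_fin /mass exprz_ge0. Qed.

Let flow_measure0 : flow_measure set0 = 0%E.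
Proof. exact: esum_set0. Qed.

Let flow_measure_ge0 (A : set T) : (0 <= flow_measure A)%E.
Proof. by apply: esum_ge0 => x _; exact: mass_ge0. Qed.

Let flow_measure_sigma_additive : semi_sigma_additive flow_measure.
Proof.
move=> F _ tF _; rewrite /flow_measure esum_bigcupT//; last exact: mass_ge0.
rewrite -nneseries_esumT; last first.
  by move=> n; apply: esum_ge0 => x _; exact: mass_ge0.
by apply: is_cvg_nneseries => n _ _; apply: esum_ge0 => x _; exact: mass_ge0.
Qed.

HB.instance Definition _ := isMeasure.Build _ T R flow_measure
  flow_measure0 flow_measure_ge0 flow_measure_sigma_additive.

End flow_measure.

Section operators.
Variables (R : realType) (q : nat) (T : rayGraph).
Local Notation C := R[i].
Local Notation mu := (@flow_measure R q T).
Implicit Types (f g u : T -> C) (E : set R -> (T -> C) -> (T -> C)).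

Definition modulus (z : C) : R := Normc.normc z.

Definition LpNorm (p : R) f : \bar R :=
  Lnorm mu p%:E (fun x => (modulus (f x))%:E).

(* The sigma-algebra on T is discrete and mu charges every vertex, so L^p(mu)
   is literally the space of functions with finite norm. *)
Definition inLp (p : R) f : Prop := (LpNorm p f < +oo)%E.

Definition inner f g : C :=
  (Rintegral mu setT (fun x => complex.Re (f x * conjc (g x))))
  +i* (Rintegral mu setT (fun x => complex.Im (f x * conjc (g x)))).

Definition finitely_supported f : Prop := finite_set [set x | f x != 0].

Definition L2_cvg (f_ : nat -> T -> C) f : Prop :=
  (LpNorm 2 (fun x => f_ n x - f x) @[n --> \oo] --> 0%E).

Definition flow_laplacian f : T -> C := fun x =>
  f x - (2 * Num.sqrt q%:R)^-1%:C *
        \sum_(y \in [set y | adj x y])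
           (Num.sqrt (mass R q y) / Num.sqrt (mass R q x))%:C * f y.

Definition grad_eps (eps : T -> C) f : T -> C := fun x =>
  q%:R^-1 * \sum_(y \in successors x) eps y * f y.

Definition linear_on_L2 (A : (T -> C) -> (T -> C)) : Prop :=
  forall (a : C) f g, inLp 2 f -> inLp 2 g ->
    A (fun x => a * f x + g x) = (fun x => a * A f x + A g x).

Definition bounded_on_L2 (A : (T -> C) -> (T -> C)) : Prop :=
  exists M : R, forall f, inLp 2 f -> (LpNorm 2 (A f) <= M%:E * LpNorm 2 f)%E.

(* Projection-valued measures on the Borel sets of the real line acting on
   L^2(mu). *)
Record projection_valued_measure E : Prop := ProjectionValuedMeasure {
  pvm_L2 : forall B f, measurable B -> inLp 2 f -> inLp 2 (E B f);
  pvm_linear : forall B, measurable B -> linear_on_L2 (E B);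
  pvm_selfadjoint : forall B f g, measurable B -> inLp 2 f -> inLp 2 g ->
    inner (E B f) g = inner f (E B g);
  pvm_setI : forall A B f, measurable A -> measurable B -> inLp 2 f ->
    E (A `&` B) f = E A (E B f);
  pvm_setT : forall f, inLp 2 f -> E setT f = f;
  pvm_sigma_additive : forall (F : nat -> set R) f,
    (forall k, measurable (F k)) -> trivIset setT F -> inLp 2 f ->
    L2_cvg (fun n x => \sum_(k < n) E (F k) f x) (E (\bigcup_k F k) f) }.

Definition spectral_mass E f (B : set R) : \bar R := (LpNorm 2 (E B f) ^+ 2)%E.

Definition spectral_sum E (s : {sfun R >-> R}) f : T -> C := fun x =>
  \sum_(c \in range s) c%:C * E (s @^-1` [set c]) f x.

(* [f] is in the domain of the operator "integral of phi against dE" and [u]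
   is its image: the isometry from L^2(spectral_mass E f) to L^2(mu) that
   sends a simple function s to [spectral_sum E s f] sends phi to u. *)
Definition spectral_integral E (phi : R -> R) f u : Prop :=
  exists s : nat -> {sfun R >-> R},
    ((\int[spectral_mass E f]_t ((s n t - phi t) ^+ 2)%:E)%E @[n --> \oo]
       --> 0%E)
    /\ L2_cvg (fun n => spectral_sum E (s n) f) u.

Definition spectral_resolution (A : (T -> C) -> (T -> C)) E : Prop :=
  projection_valued_measure E /\
  forall f, inLp 2 f -> spectral_integral E idfun f (A f).

(* When E is the spectral resolution of the flow Laplacian, this says that f
   is in the domain of its power -1/2, with image u.  The value 0 of the
   integrand on ]-oo, 0] is immaterial: the Laplacian is nonnegative and
   injective, so E ]-oo, 0] = 0. *)
Definition inv_sqrt E f u : Prop :=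
  spectral_integral E (fun t => (Num.sqrt t)^-1) f u.

(* [S] is the bounded operator on L^2(mu) extending
   grad_eps \o (flow_laplacian)^(-1/2) from the finitely supported functions;
   it is unique as these are dense in L^2(mu). *)
Record riesz_transform E (eps : T -> C) (S : (T -> C) -> (T -> C)) : Prop :=
  RieszTransform {
    riesz_linear : linear_on_L2 S;
    riesz_bounded : bounded_on_L2 S;
    riesz_finitely_supported : forall f, finitely_supported f ->
      exists u, inv_sqrt E f u /\ S f = grad_eps eps u }.

End operators.

(* Main.v *)
Require Import Defs.
From HB Require Import structures.
From mathcomp Require Import all_boot all_order all_algebra finmap.
From mathcomp Require Import all_classical all_reals all_analysis.
From mathcomp Require Import complex.
From mathcomp Require Import measurable_realfun.
From mathcomp Require Import ring lra zify.

Set Implicit Arguments.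
Unset Strict Implicit.
Unset Printing Implicit Defensive.

Import Order.TTheory GRing.Theory Num.Theory.
Import numFieldNormedType.Exports.
Import HBSimple.

Local Open Scope classical_set_scope.
Local Open Scope ring_scope.
Local Open Scope complex_scope.

(** The Riesz transform is an explicit series of averages over successors.

    Let A be the mean over the successors ([smean]) and V the composition with
    the predecessor.  Then A is the adjoint of V on L^2(mu), A V = 1, and the
    flow Laplacian L satisfies 2 (1 - L) = V + A.

    The operator as a series.  With t = 2 sin^2 phi, the Fourier series of the
    square wave becomes the expansion of t^(-1/2) on ]0, 2] along the
    polynomials [cheb n], with coefficients proportional to 1 / (2 n + 1)
    ([cheb_invsqrt_cvg]).  As a polynomial in 1 - t, [cheb n] is
    U_n + U_(n-1) with U_n the Chebyshev polynomials of the second kind, and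
    A V = 1 makes U_n (1 - L) the sum of the V^k A^(n-k) ([updown],
    [chebop_laplacian]).  The weighted gradient kills the range of V, because
    eps has mean zero over the successors of each vertex; what remains of
    U_n (1 - L) f is [branch n f], the mean of eps A^n f
    ([smean_eps_updown]).  Hence the Riesz transform is the limit of the sums
    [psum] of the a_n [branch n], with a_n positive, decreasing and of order
    1 / n.

    Identification with the spectral definition.  Since 1 - L is a
    contraction, the spectral measures of L live on [0, 2]
    ([spectral_mass_out]).  Simple functions of a fine step approximation of
    t give operators that converge strongly to the polynomials in L, and a
    diagonal choice of steps turns the L^2 convergence of the Chebyshev series
    into a sequence of simple functions converging to t^(-1/2)
    ([chebop_sum_inv_sqrt]).  The point 0 carries no mass because the partial
    sums blow up there.  On finitely supported functions the series converges
    in L^2 by orthogonality: distinct powers of the predecessor map move a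
    vertex to distinct levels ([fint_udsum_delta], [udsum_cvg]).

    Boundedness for p > 1.  In [branch n f] one may subtract A^(n+1) f at the
    predecessor from A^n f.  By the strong convexity of the p-th power these
    differences are what the p-norm loses when A is applied, so that they are
    summable in n ([fgap_telescope]); Hoelder's inequality in n pairs them with
    the coefficients ([psum_Lp]).

    Weak type (1,1).  Balls are replaced by trapezoids, the sets of descendants
    of a vertex over a range of generations comparable to their distance to
    that vertex.  These can be split into smaller ones, which gives a
    Calderon-Zygmund decomposition by a stopping argument ([CZ_rec]).  The part
    of mean zero on a stopped trapezoid acts, away from an enlarged trapezoid,
    only at the ancestors of its root, where the sum telescopes since the
    coefficients decrease ([psum_above], [cutoff_telescope], [CZ_stop]).  The
    resulting bounds for [psum] do not depend on the number of terms
    ([weak_psum]) and pass to the limit by Fatou's lemma. *)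

(** * Levels and predecessors in the tree *)

HB.lock Definition predecessor (T : rayGraph) (x : T) : T :=
  xget x [set y | adj x y /\ level y = level x + 1].

HB.lock Definition children (T : rayGraph) (x : T) : seq T :=
  fset_set (successors x).

Arguments predecessor {T} x.
Arguments children {T} x.
Section tree_geometry.
Variables (T : rayGraph) (q : nat).
Hypothesis hT : homogeneous_tree T q.
Implicit Types x y z r : T.

Local Notation adjT := (@adj T).
Local Notation d := (@dist T).

Lemma walk0 x : walk x x 0.
Proof. by exists [::]. Qed.

Lemma walk_adj x y : adj x y -> walk x y 1.
Proof. by move=> xy; exists [:: y]; rewrite /= xy. Qed.

Lemma walk_cat x y z m n : walk x y m -> walk y z n -> walk x z (m + n).
Proof.
move=> [p [pp <- <-]] [p' [pp' <- <-]]; exists (p ++ p').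
by rewrite cat_path pp pp' last_cat size_cat.
Qed.

Lemma path_rev x p : path adjT x p ->
  path adjT (last x p) (rev (belast x p)) /\
  last (last x p) (rev (belast x p)) = x.
Proof.
move=> pp; rewrite rev_path; split.
  by rewrite (@eq_path _ _ adjT)// => y z; rewrite (adj_sym hT).
by case: p pp => [//|y p] _; rewrite /= rev_cons last_rcons.
Qed.

Lemma walk_sym x y n : walk x y n -> walk y x n.
Proof.
move=> [p [pp <- <-]]; exists (rev (belast x p)).
by have [? ?] := path_rev pp; rewrite size_rev size_belast.
Qed.

Lemma dist_spec x y : walk x y (d x y) /\ forall m, walk x y m -> (d x y <= m)%N.
Proof.
rewrite /dist; case: xgetP => [n -> //|/= H]; exfalso.
have ex : exists n, `[< walk x y n >].
  by have [n] := tree_connected hT x y; exists n; apply/asboolP.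
case: (ex_minnP ex) => n /asboolP wn nmin.
by apply: (H n); split=> // m wm; apply/nmin/asboolP.
Qed.

Lemma dist_walk x y : walk x y (d x y). Proof. by case: (dist_spec x y). Qed.

Lemma dist_min x y m : walk x y m -> (d x y <= m)%N.
Proof. by case: (dist_spec x y) => _; exact. Qed.

Lemma dist_sym x y : d x y = d y x.
Proof.
by apply/eqP; rewrite eqn_leq; apply/andP; split; apply: dist_min;
  apply: walk_sym; exact: dist_walk.
Qed.

Lemma distxx x : d x x = 0%N.
Proof. by apply/eqP; rewrite -leqn0; exact: dist_min (walk0 x). Qed.

Lemma dist0_eq x y : d x y = 0%N -> x = y.
Proof.
by move=> d0; have := dist_walk x y; rewrite d0 => -[[|a p] []].
Qed.

Lemma dist_triangle x y z : (d x z <= d x y + d y z)%N.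
Proof. by apply: dist_min; apply: walk_cat; exact: dist_walk. Qed.

Lemma dist_adj x y : adj x y -> (d x y <= 1)%N.
Proof. by move=> /walk_adj/dist_min. Qed.

Lemma dist1_adj x y : d x y = 1%N -> adj x y.
Proof.
move=> d1; have := dist_walk x y; rewrite d1 => -[[|a [|b p]] []] //=.
by rewrite andbT => + <-.
Qed.

Lemma dist_adj_le x y r : adj x y -> (d y r <= (d x r).+1)%N.
Proof.
move=> xy; apply: (leq_trans (dist_triangle y x r)).
by rewrite -add1n leq_add2r dist_adj// (adj_sym hT).
Qed.

(** A walk between two distinct neighbours of x that misses x closes up, after
    removal of its loops, to a cycle through x. *)
Lemma neighbours_separated x y y' p : adj x y -> adj x y' -> y != y' ->
  path adjT y p -> last y p = y' -> x \notin y :: p -> False.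
Proof.
move=> xy xy' yy' pp lp xp.
case: (shortenP pp) lp xp => p' pp' up' sp' lp' xp.
have xp' : x \notin y :: p'.
  apply: contra xp; rewrite !inE => /orP[->//|xp']; apply/orP; right.
  exact: sp'.
have /(tree_acyclic hT) : ucycle adjT (x :: y :: p').
  rewrite /ucycle; apply/andP; split; last by rewrite /= xp'.
  by rewrite /cycle /= rcons_path xy pp' lp' (adj_sym hT).
case: p' lp' {pp' up' sp' xp'} => [/= yy0|//]; by rewrite yy0 eqxx in yy'.
Qed.

(** A geodesic from y to r through x would make x closer to r than y. *)
Lemma geodesic_avoids x y r : y != x -> (d y r <= d x r)%N ->
  exists p, [/\ path adjT y p, last y p = r & x \notin y :: p].
Proof.
move=> yx dyx; have [p [pp lp sp]] := dist_walk y r.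
exists p; split=> //; rewrite inE eq_sym (negbTE yx)/=; apply/negP => xp.
case/splitPr: xp pp lp sp => p1 p2.
rewrite cat_path last_cat /= => /and3P[_ _ pp] lp sp.
have : (d x r <= size p2)%N by apply: dist_min; exists p2.
move: sp dyx; rewrite size_cat /= => <-; lia.
Qed.

Lemma adj_neq x y : adj x y -> y != x.
Proof. by apply: contraTneq => ->; rewrite (adj_irr hT). Qed.

(** Two such neighbours would be joined through r by a walk that avoids x. *)
Lemma closer_unique x y y' r : adj x y -> adj x y' ->
  (d y r <= d x r)%N -> (d y' r <= d x r)%N -> y = y'.
Proof.
move=> xy xy' dy dy'; apply/eqP/negPn/negP => yy'.
have [p [pp lp xp]] := geodesic_avoids (adj_neq xy) dy.
have [p' [pp' lp' xp']] := geodesic_avoids (adj_neq xy') dy'.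
have [rp rl] := path_rev pp'.
apply: (@neighbours_separated x y y' (p ++ rev (belast y' p'))) => //.
- by rewrite cat_path pp lp -lp'.
- by rewrite last_cat lp -lp'.
- rewrite -cat_cons mem_cat negb_or xp mem_rev; apply: contra xp'.
  by rewrite lastI mem_rcons inE => ->; rewrite orbT.
Qed.

Lemma closer_exists x r : x != r -> exists2 y, adj x y & (d y r).+1 = d x r.
Proof.
move=> xr; have [[|y p] [/= pp lp sp]] := dist_walk x r.
  by rewrite lp eqxx in xr.
move/andP: pp => [xy pp]; exists y => //.
apply/eqP; rewrite eqn_leq -{1}sp ltnS; apply/andP; split.
  by apply: dist_min; exists p.
by apply: dist_adj_le; rewrite (adj_sym hT).
Qed.

Lemma closer_dist x y r : adj x y -> (d y r <= d x r)%N -> (d y r).+1 = d x r.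
Proof.
move=> xy dy; have [xr|xr] := eqVneq x r.
  move: dy; rewrite -{2}xr distxx leqn0 => /eqP/dist0_eq yr.
  by have := adj_neq xy; rewrite yr xr eqxx.
have [z xz dz] := closer_exists xr.
by rewrite (@closer_unique x y z r)// -dz.
Qed.

Lemma farther_dist x y r : adj x y -> (d x r < d y r)%N -> d y r = (d x r).+1.
Proof. by move=> xy dxy; apply/eqP; rewrite eqn_leq dxy dist_adj_le. Qed.

Hypothesis hray : geodesic_ray T.
Local Notation w := (@ray T).

Lemma ray_adj n : adj (w n) (w n.+1).
Proof. by apply: dist1_adj; rewrite hray// subSnn. Qed.

(** Beyond the confluent the ray moves away from x at each step: turning
    towards x would force it back to the previous vertex, by [closer_unique]. *)
Lemma level_eventually x : exists N, forall n, (N <= n)%N ->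
  (d x (w n))%:Z = n%:Z - level x.
Proof.
have [N [cN Nmin]] : exists N, confluent x = w N /\
    forall n, (d x (w N) <= d x (w n))%N.
  rewrite /confluent; case: xgetP => [z -> [[N _ <-] Nmin]|H]; first by exists N.
  exfalso; have ex : exists m, `[< exists n, d x (w n) = m >].
    by exists (d x (w 0)); apply/asboolP; exists 0%N.
  case: (ex_minnP ex) => m /asboolP[N NE] mmin.
  apply: (H (w N)); split; first by exists N.
  by move=> n; rewrite NE; apply: mmin; apply/asboolP; exists n.
have step n : d x (w (N + n).+1) = (d x (w (N + n))).+1.
  elim: n => [|n IH].
    rewrite addn0 [LHS]dist_sym [in RHS]dist_sym; case: (leqP (d (w N.+1) x) (d (w N) x)) => h.
      have := closer_dist (ray_adj N) h; have := Nmin N.+1.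
      by rewrite (dist_sym x) (dist_sym x (w N.+1)); lia.
    exact: farther_dist (ray_adj N) h.
  rewrite addnS; set m := (N + n)%N in IH *.
  rewrite [LHS]dist_sym [in RHS]dist_sym.
  case: (leqP (d (w m.+2) x) (d (w m.+1) x)) => h; last exact: farther_dist (ray_adj _) h.
  have /(congr1 (d (w m))) : w m = w m.+2.
    apply: (@closer_unique (w m.+1) _ _ x) => //; last 1 first.
    - by rewrite (dist_sym (w m)) (dist_sym (w m.+1)) IH.
    - by rewrite (adj_sym hT) ray_adj.
    - exact: ray_adj.
  by rewrite distxx hray//; lia.
have far n : d x (w (N + n)) = (d x (w N) + n)%N.
  by elim: n => [|n IH]; rewrite ?addn0// addnS step IH addnS.
exists N => n Nn; rewrite /level cN /origin hray// subn0 -(subnKC Nn) far.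
lia.
Qed.

Lemma level_good2 x y : exists N, forall n, (N <= n)%N ->
  (d x (w n))%:Z = n%:Z - level x /\ (d y (w n))%:Z = n%:Z - level y.
Proof.
have [N hN] := level_eventually x; have [M hM] := level_eventually y.
by exists (maxn N M) => n; rewrite geq_max => /andP[? ?]; split; auto.
Qed.

Lemma adj_level x y : adj x y -> level y = level x + 1 \/ level y = level x - 1.
Proof.
move=> xy; have [N /(_ N (leqnn _))[dx dy]] := level_good2 x y.
case: (leqP (d y (w N)) (d x (w N))) => h.
- by left; have := closer_dist xy h; lia.
- by right; have := farther_dist xy h; lia.
Qed.

(** For large n this holds by [level_eventually]; in general it implies that
    w n is an ancestor of x. *)
Definition good n x := (d x (w n))%:Z = n%:Z - level x.

(** By [adj_level] there are two candidates for the level of y, and the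
    triangle inequality through w n excludes the lower one. *)
Lemma closer_level n x y : good n x -> adj x y ->
  (d y (w n)).+1 = d x (w n) -> level y = level x + 1.
Proof.
move=> gx xy dy; have [N H] := level_good2 x y.
have [dx' dy'] := H (maxn N n) (leq_maxl _ _).
have := dist_triangle y (w n) (w (maxn N n)).
rewrite (hray (leq_maxr _ _)) => tri.
have := adj_level xy; rewrite /good in gx; have := leq_maxr N n; lia.
Qed.

Lemma predecessor_spec x :
  adj x (predecessor x) /\ level (predecessor x) = level x + 1.
Proof.
rewrite unlock; case: xgetP => [//y -> //|H]; exfalso.
have [N hN] := level_eventually x.
pose n := maxn N (absz (level x + 1)).
have gx : good n x by apply: hN; exact: leq_maxl.
have xn : x != w n.
  apply/eqP => xn; move: gx; rewrite /good xn distxx -xn.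
  by have := leq_maxr N (absz (level x + 1)); rewrite -/n; lia.
have [y xy dy] := closer_exists xn.
by apply: (H y); split=> //; exact: closer_level gx xy dy.
Qed.

Lemma level_predecessor x : level (predecessor x) = level x + 1.
Proof. by case: (predecessor_spec x). Qed.

Lemma predecessor_unique x y : adj x y -> level y = level x + 1 ->
  y = predecessor x.
Proof.
move=> xy ly; have [xp lp] := predecessor_spec x.
have [N hN] := level_good2 x y; have [M hM] := level_eventually (predecessor x).
pose n := maxn N M.
have [dx dy] := hN n (leq_maxl _ _); have dp := hM n (leq_maxr _ _).
by apply: (@closer_unique x y (predecessor x) (w n)) => //; lia.
Qed.

Lemma adj_predecessor x y : adj x y <-> y = predecessor x \/ x = predecessor y.
Proof.
split=> [xy|[->|->]].
- case: (adj_level xy) => ly; first by left; exact: predecessor_unique.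
  by right; apply: predecessor_unique; [rewrite (adj_sym hT)|lia].
- by case: (predecessor_spec x).
- by rewrite (adj_sym hT); case: (predecessor_spec y).
Qed.

Lemma successorsE x : successors x = [set y | predecessor y = x].
Proof.
apply/seteqP; split=> y /= => [[xy ly]|<-].
  by apply/esym/predecessor_unique; [rewrite (adj_sym hT)|lia].
have [yp lp] := predecessor_spec y; split; [by rewrite (adj_sym hT)|lia].
Qed.

Lemma good_predecessor n x : good n x -> (0 < d x (w n))%N ->
  good n (predecessor x) /\ (d (predecessor x) (w n)).+1 = d x (w n).
Proof.
move=> gx dx; have xn : x != w n by apply: contraTneq dx => ->; rewrite distxx.
have [y xy dy] := closer_exists xn.
have ly := closer_level gx xy dy.
rewrite -(predecessor_unique xy ly); split; last exact: dy.
move: gx; rewrite /good ly -dy => gx.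
by move: (level x) gx => l gx; lia.
Qed.

Lemma iter_predecessor_ray n x : good n x ->
  iter (d x (w n)) predecessor x = w n.
Proof.
move: {2}(d x (w n)) (erefl (d x (w n))) => k; elim: k x => [|k IH] x dk gx.
  by rewrite dk /=; exact: dist0_eq.
have [gp dp] := good_predecessor gx (leq_trans (ltn0Sn k) (eq_leq (esym dk))).
have dk' : d (predecessor x) (w n) = k by lia.
by rewrite dk iterSr -dk'; exact: IH.
Qed.

(** Two vertices have a common ancestor on the ray: this is how finitely many
    vertices are enclosed in a single trapezoid. *)
Lemma ray_ancestor x : exists N, forall n, (N <= n)%N ->
  exists2 k, k%:Z = n%:Z - level x & iter k predecessor x = w n.
Proof.
have [N hN] := level_eventually x; exists N => n Nn.
by exists (d x (w n)); [exact: hN|apply: iter_predecessor_ray; exact: hN].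
Qed.

Lemma level_ray n : level (w n) = n%:Z.
Proof.
have [N hN] := level_eventually (w n).
by have := hN _ (leq_maxl N n); rewrite hray ?leq_maxr//; have := leq_maxr N n; lia.
Qed.

Lemma adj_finite x : finite_set [set y | adj x y].
Proof. by apply/finite_setP; exists q.+1; exact: tree_degree hT x. Qed.

Lemma successors_finite x : finite_set (successors x).
Proof. by apply: sub_finite_set (adj_finite x) => y []. Qed.

Lemma adj_setE x : [set y | adj x y] = predecessor x |` successors x.
Proof.
rewrite successorsE; apply/seteqP; split=> y /= => [/adj_predecessor[->|<-]|].
- by left.
- by right.
- by move=> [->|<-]; apply/adj_predecessor; [left|right].
Qed.

Lemma children_uniq x : uniq (children x).
Proof. by rewrite unlock fset_uniq. Qed.

Lemma mem_children x y : (y \in children x) = (predecessor y == x).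
Proof.
rewrite unlock in_fset_set ?successorsE; last first.
  by rewrite -successorsE; exact: successors_finite.
by apply/idP/eqP; rewrite inE.
Qed.

Lemma predecessor_notin x : predecessor x \notin children x.
Proof.
rewrite mem_children; apply/eqP => /(congr1 (@level T)).
by rewrite !level_predecessor; lia.
Qed.

Lemma size_children x : size (children x) = q.
Proof.
have := predecessor_notin x; rewrite children.unlock => pn.
have := card_fset_set (tree_degree hT x); rewrite adj_setE.
rewrite fset_setU1; last exact: successors_finite.
by rewrite cardfsU1 pn add1n => -[].
Qed.

Lemma sum_successors (V : nmodType) x (F : T -> V) :
  \sum_(y \in successors x) F y = \sum_(y <- children x) F y.
Proof. by rewrite children.unlock fsbig_finite//; exact: successors_finite. Qed.

Lemma sum_adj (V : nmodType) x (F : T -> V) :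
  \sum_(y \in [set y | adj x y]) F y =
  F (predecessor x) + \sum_(y <- children x) F y.
Proof.
rewrite fsbig_finite; last exact: adj_finite.
rewrite adj_setE fset_setU1; last exact: successors_finite.
by have := predecessor_notin x; rewrite children.unlock => pn; rewrite big_fsetU1.
Qed.

End tree_geometry.

(** * Sums against the flow measure *)

Section extended_sums.
Local Open Scope ereal_scope.

Lemma le_esumZl (R : realType) (I : choiceType) (D : set I) (c : R)
    (a : I -> \bar R) : (0 <= c)%R -> (forall i, D i -> 0 <= a i) ->
  \esum_(i in D) (c%:E * a i) <= c%:E * \esum_(i in D) a i.
Proof.
move=> c0 a0; apply: ge_ereal_sup => _ [X [fX XD] <-].
have aX i : i \in fset_set X -> 0 <= a i.
  by rewrite in_fset_set// inE => /XD; exact: a0.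
rewrite fsbig_finite//= big_seq -ge0_sume_distrr// -big_seq.
rewrite lee_wpmul2l ?lee_fin// -fsbig_finite//.
by apply: esum_ge; exists X.
Qed.

(** The reverse of [le_esumZl] is the same inequality for the inverse scalar. *)
Lemma esumZl (R : realType) (I : choiceType) (D : set I) (c : R)
    (a : I -> \bar R) : (0 <= c)%R -> (forall i, D i -> 0 <= a i) ->
  \esum_(i in D) (c%:E * a i) = c%:E * \esum_(i in D) a i.
Proof.
move=> c0 a0; apply/eqP; rewrite eq_le le_esumZl//=.
have [->|cn0] := eqVneq c 0%R; first by rewrite mul0e esum_ge0// => i _; rewrite mul0e.
have ca i : D i -> 0 <= c%:E * a i by move=> Di; rewrite mule_ge0 ?lee_fin ?a0.
rewrite -lee_pdivlMl ?lt0r ?cn0//.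
apply: le_trans (le_esumZl _ ca); last by rewrite invr_ge0.
by apply: le_esum => i _; rewrite muleA -EFinM mulVf// mul1e.
Qed.

End extended_sums.

Section flow_sums.
Local Open Scope ereal_scope.
Import HBNNSimple.
Variables (R : realType) (q : nat) (T : rayGraph).
Local Notation mu := (@flow_measure R q T).
Implicit Types (F G : T -> R) (A : set T).

Definition fint F : \bar R := \int[mu]_x (F x)%:E.

Lemma flow_measure1 x : mu [set x] = (mass R q x)%:E.
Proof. by rewrite /flow_measure esum_set1// mass_ge0. Qed.

Lemma massr_ge0 (x : T) : (0 <= mass R q x)%R.
Proof. by rewrite -lee_fin mass_ge0. Qed.

(** One inequality bounds the integral of a simple function by regrouping its
    values, the other one integrates over finite sets of vertices. *)
Lemma fint_esum F : (forall x, 0 <= F x)%R ->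
  fint F = \esum_(x in setT) (mass R q x * F x)%:E.
Proof.
move=> F0.
apply/eqP; rewrite eq_le; apply/andP; split.
- rewrite /fint ge0_integralTE; last by move=> x; rewrite lee_fin.
  apply: ge_ereal_sup => _ [h hF <-]; rewrite sintegralE fsbig_finite//=.
  have h0 x : (0 <= h x)%R by exact: fun_ge0.
  have /le_trans -> // : \sum_(r <- fset_set (range h)) (r%:E * mu (h @^-1` [set r])) <=
     \esum_(x in [set: T]) \sum_(r <- fset_set (range h))
       (if h x == r then (mass R q x * h x)%:E else 0).
    rewrite esum_sum; last first.
      by move=> x r _ _; case: ifP => // _; rewrite lee_fin mulr_ge0 ?massr_ge0.
    apply: lee_sum => r _; have [r0|r0] := leP 0%R r; last first.
      suff -> : h @^-1` [set r] = set0.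
        by rewrite measure0 mule0 esum_ge0// => x _; case: ifP => // _;
          rewrite lee_fin mulr_ge0 ?massr_ge0.
      by rewrite -subset0 => x /= hx; move: r0; rewrite -hx ltNge h0.
    rewrite /flow_measure -esumZl//; last by move=> *; exact: mass_ge0.
    rewrite esum_mkcond; apply: le_esum => x _.
    have [hr|hr] := eqVneq (h x) r.
      by rewrite mem_set// hr -EFinM mulrC.
    by rewrite memNset//= => hx; rewrite hx eqxx in hr.
  apply: le_esum => x _; rewrite (bigD1_seq (h x) _ (fset_uniq _))/=.
    rewrite eqxx big1 ?adde0 => [|r]; last by rewrite eq_sym => /negbTE ->.
    by rewrite lee_fin ler_wpM2l ?massr_ge0// -lee_fin hF.
  by rewrite in_fset_set// inE.
- apply: ge_ereal_sup => _ [X [fX _] <-].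
  rewrite fsbig_finite//=.
  have -> : \sum_(x <- fset_set X) (mass R q x * F x)%:E =
      \int[mu]_(x in \bigcup_(y in X) [set y]) (F x)%:E.
    rewrite -[in RHS](fset_setK fX) bigcup_fset ge0_integral_bigsetU//=; last 2 first.
    - by move=> i j _ _ [x [/= -> ->]].
    - by move=> x _; rewrite lee_fin.
    apply: eq_bigr => y _; rewrite (eq_integral (cst (F y)%:E)).
      by rewrite integral_cst// [X in _ * X]flow_measure1 -EFinM mulrC.
    by move=> x; rewrite inE /= => ->.
  by apply: ge0_subset_integral => //= x _; rewrite lee_fin.
Qed.

Lemma eq_fint F G : F =1 G -> fint F = fint G.
Proof. by move=> FG; rewrite /fint; under eq_integral do rewrite FG. Qed.

Lemma fint_ge0 F : (forall x, 0 <= F x)%R -> 0 <= fint F.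
Proof. by move=> F0; apply: integral_ge0 => x _; rewrite lee_fin. Qed.

Lemma le_fint F G : (forall x, 0 <= F x)%R -> (forall x, F x <= G x)%R ->
  fint F <= fint G.
Proof.
move=> F0 FG; apply: ge0_le_integral => //= x _; rewrite lee_fin//.
Qed.

Lemma fint0 : fint (fun=> 0%R) = 0.
Proof. exact: integral0. Qed.

Lemma fintD F G : (forall x, 0 <= F x)%R -> (forall x, 0 <= G x)%R ->
  fint (fun x => F x + G x)%R = fint F + fint G.
Proof.
move=> F0 G0; rewrite /fint; under eq_integral do rewrite EFinD.
by rewrite ge0_integralD//= => x _; rewrite lee_fin.
Qed.

Lemma fintZ (c : R) F : (0 <= c)%R -> (forall x, 0 <= F x)%R ->
  fint (fun x => c * F x)%R = c%:E * fint F.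
Proof.
move=> c0 F0; rewrite /fint; under eq_integral do rewrite EFinM.
by rewrite ge0_integralZl_EFin//= => x _; rewrite lee_fin.
Qed.

Lemma fint_sum (I : Type) (s : seq I) (F : I -> T -> R) :
  (forall i x, 0 <= F i x)%R ->
  fint (fun x => \sum_(i <- s) F i x)%R = \sum_(i <- s) fint (F i).
Proof.
move=> F0; elim: s => [|i s IH].
  by rewrite big_nil -[RHS]fint0; apply: eq_fint => x; rewrite big_nil.
rewrite big_cons -IH -fintD//; last by move=> x; rewrite sumr_ge0.
by apply: eq_fint => x; rewrite big_cons.
Qed.

Lemma fint_fin F (s : seq T) : (forall x, 0 <= F x)%R -> uniq s ->
  (\sum_(x <- s) mass R q x * F x)%R%:E <= fint F.
Proof.
move=> F0 us; rewrite fint_esum//; apply: esum_ge; exists [set` s].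
  by split; [exact: finite_seq|].
by rewrite -fsbig_seq// sumEFin.
Qed.

Lemma fint_le F (c : \bar R) : (forall x, 0 <= F x)%R ->
  (forall s : seq T, uniq s -> (\sum_(x <- s) mass R q x * F x)%R%:E <= c) ->
  fint F <= c.
Proof.
move=> F0 H; rewrite fint_esum//; apply: ge_ereal_sup => _ [X [fX _] <-].
by rewrite fsbig_finite//= sumEFin; apply: H; exact: fset_uniq.
Qed.

Lemma sum_mass_le F (s t : seq T) : (forall x, 0 <= F x)%R -> uniq s -> uniq t ->
  (forall x, x \in t -> F x != 0 -> x \in s)%R ->
  (\sum_(x <- t) mass R q x * F x <= \sum_(x <- s) mass R q x * F x)%R.
Proof.
move=> F0 us ut Fs.
have pos x : (0 <= mass R q x * F x)%R by rewrite mulr_ge0// massr_ge0.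
rewrite (bigID (mem s))/= [X in (_ + X)%R]big1_seq ?addr0; last first.
  move=> x /andP[xs xt]; case: (eqVneq (F x) 0%R) => [->|Fx]; first by rewrite mulr0.
  by rewrite (Fs x) in xs.
rewrite -big_filter; set u := [seq x <- t | _].
have uu : uniq u by rewrite filter_uniq.
have us' : {subset u <= s} by move=> x; rewrite mem_filter => /andP[].
have [v pv] : exists v, perm_eq s (u ++ v).
  exists [seq x <- s | x \notin u]; rewrite uniq_perm//.
    rewrite cat_uniq uu filter_uniq//= andbT; apply/hasPn => x.
    by rewrite mem_filter => /andP[].
  move=> x; rewrite mem_cat mem_filter; case: (boolP (x \in u)) => //= xu.
  exact: us'.
by rewrite (perm_big _ pv) big_cat/= lerDl sumr_ge0.
Qed.

Lemma fint_seq F (s : seq T) : (forall x, 0 <= F x)%R -> uniq s ->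
  (forall x, x \notin s -> F x = 0%R) ->
  fint F = (\sum_(x <- s) mass R q x * F x)%R%:E.
Proof.
move=> F0 us Fs; apply/eqP; rewrite eq_le fint_fin// andbT.
apply: fint_le => // t ut; rewrite lee_fin sum_mass_le// => x _.
by apply: contraR => /Fs ->.
Qed.

Lemma fint1 F x : (forall y, 0 <= F y)%R -> (forall y, y != x -> F y = 0%R) ->
  fint F = (mass R q x * F x)%:E.
Proof.
move=> F0 Fx; rewrite (@fint_seq F [:: x])//= ?big_seq1//.
by move=> y; rewrite inE => /Fx.
Qed.

Lemma fint_point F x : (forall y, 0 <= F y)%R -> (mass R q x * F x)%:E <= fint F.
Proof. by move=> F0; have := @fint_fin F [:: x] F0 isT; rewrite big_seq1. Qed.

Lemma flow_measure_fint (A : set T) : mu A = fint \1_A.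
Proof. by rewrite /fint integral_indic//= setIT. Qed.

End flow_sums.
Arguments fint {R} q {T} F.

(** * Convexity of powers *)

Section power_inequalities.
Variable R : realType.
Implicit Types (x y c p r s t u : R).

(** Young's inequality for the product of x ^ t and 1. *)
Lemma powR_bernoulli_le x t : 0 <= x -> 0 <= t <= 1 -> x `^ t <= 1 + t * (x - 1).
Proof.
move=> x0 /andP[t0 t1le].
have [->|tn0] := eqVneq t 0; first by rewrite powRr0 mul0r addr0.
have [->|tn1] := eqVneq t 1; first by rewrite powRr1//; lra.
have t0' : 0 < t by rewrite lt0r tn0.
have t1' : 0 < 1 - t by rewrite subr_gt0 lt_neqAle tn1.
have := @conjugate_powR R (x `^ t) 1 t^-1 (1 - t)^-1 (powR_ge0 _ _) ler01.
have t1 : t + (1 - t) = 1 by lra.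
rewrite !invr_gt0 !invrK => /(_ t0' t1' t1).
rewrite mulr1 -powRrM divff// powRr1// powR1 => /le_trans; apply.
by lra.
Qed.

(** The previous inequality at 1 + r (x - 1) with the exponent 1 / r. *)
Lemma powR_bernoulli_ge x r : 0 <= x -> 1 <= r -> 1 + r * (x - 1) <= x `^ r.
Proof.
move=> x0 r1; have r0 : 0 < r by lra.
have [z0|z0] := ltP (1 + r * (x - 1)) 0.
  exact: le_trans (ltW z0) (powR_ge0 _ _).
have ri : 0 <= r^-1 <= 1 by rewrite invr_ge0 ltW//= invf_le1.
have h : (1 + r * (x - 1)) `^ r^-1 <= x.
  apply: le_trans (powR_bernoulli_le z0 ri) _.
  have : r^-1 * r = 1 by rewrite mulVf ?gt_eqF.
  by move=> e; rewrite le_eqVlt; apply/orP; left; apply/eqP;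
    rewrite [1 + _ - 1]addrAC subrr add0r mulrA e; ring.
have := @ge0_ler_powR R r (ltW r0) _ _ _ _ h; rewrite !nnegrE powR_ge0 x0 => /(_ isT isT).
by rewrite -powRrM mulVf ?gt_eqF// powRr1.
Qed.

Lemma powR_split x r s : 0 < x -> x `^ (r + s) = x `^ r * x `^ s.
Proof. by move=> x0; rewrite powRD// (gt_eqF x0) implybT. Qed.

(** Bernoulli's inequality at y / c, multiplied by c ^ p. *)
Lemma powR_tangent y c p : 0 <= y -> 0 <= c -> 1 <= p ->
  c `^ p + p * c `^ (p - 1) * (y - c) <= y `^ p.
Proof.
move=> y0 c0 p1; have [->|cn0] := eqVneq c 0.
  have [->|pn1] := eqVneq p 1; first by rewrite !powRr1//; rewrite subrr powRr0; lra.
  rewrite !powR0 ?subr_eq0//; last by rewrite gt_eqF//; lra.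
  by rewrite mulr0 mul0r addr0 powR_ge0.
have c0' : 0 < c by rewrite lt0r cn0.
have h := powR_bernoulli_ge (divr_ge0 y0 c0) p1.
have -> : y `^ p = (y / c) `^ p * c `^ p by rewrite -powRM ?divr_ge0// divfK.
apply: le_trans (ler_wpM2r (powR_ge0 _ _) h).
have -> : c `^ p = c * c `^ (p - 1).
  by rewrite -[X in X * _]powRr1// -powR_split// addrC subrK.
by rewrite le_eqVlt; apply/orP; left; apply/eqP; field.
Qed.

(** Jensen's inequality for a finite positive measure, from the tangent line
    at the mean. *)
Lemma powR_jensen (I : Type) (l : seq I) (w y : I -> R) p : 1 <= p ->
  (forall i, 0 <= w i) -> (forall i, 0 <= y i) ->
  (\sum_(i <- l) w i * y i) `^ p <=
  (\sum_(i <- l) w i) `^ (p - 1) * \sum_(i <- l) w i * y i `^ p.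
Proof.
move=> p1 w0 y0; set W := \sum_(i <- l) w i; set Y := \sum_(i <- l) _.
have W0 : 0 <= W by exact: sumr_ge0.
have Y0 : 0 <= Y by apply: sumr_ge0 => i _; exact: mulr_ge0.
have [W00|Wn0] := eqVneq W 0.
  suff -> : Y = 0.
    rewrite powR0; last by rewrite gt_eqF//; lra.
    by rewrite mulr_ge0 ?powR_ge0// sumr_ge0// => i _; rewrite mulr_ge0 ?powR_ge0.
  rewrite /Y; have : all (fun i => w i == 0) l.
    elim: l @W @Y W0 Y0 W00 => //= i l IH; rewrite !big_cons => _ _ e.
    have Wl : 0 <= \sum_(j <- l) w j by exact: sumr_ge0.
    have := w0 i => wi; have wi0 : w i = 0 by lra.
    rewrite wi0 eqxx IH// ?sumr_ge0//; last by lra.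
    by move=> j _; exact: mulr_ge0.
  elim: l @W @Y {W0 Y0 W00} => [|i l IH]; rewrite ?big_nil//= big_cons => /andP[/eqP -> h].
  by rewrite mul0r add0r IH.
have Wp : 0 < W by rewrite lt0r Wn0.
have c0 : 0 <= Y / W by rewrite divr_ge0.
have : \sum_(i <- l) w i * ((Y / W) `^ p + p * (Y / W) `^ (p - 1) * (y i - Y / W)) <=
       \sum_(i <- l) w i * y i `^ p.
  by apply: ler_sum => i _; rewrite ler_wpM2l// powR_tangent.
have -> : \sum_(i <- l) w i * ((Y / W) `^ p + p * (Y / W) `^ (p - 1) * (y i - Y / W)) =
   W * (Y / W) `^ p + p * (Y / W) `^ (p - 1) * (Y - W * (Y / W)).
  set c := Y / W; set k := p * _.
  rewrite (eq_bigr (fun i => (c `^ p - k * c) * w i + k * (w i * y i))); last first.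
    by move=> i _; ring.
  by rewrite big_split/= -!mulr_sumr -/W -/Y; ring.
rewrite [W * (Y / W)]mulrCA divff// mulr1 subrr mulr0 addr0 => h.
apply: le_trans (ler_wpM2l (powR_ge0 W (p - 1)) h).
rewrite mulrA -[X in _ * X * _]powRr1// -powR_split// subrK -powRM//.
by rewrite mulrCA divff// mulr1.
Qed.

Lemma powR_jensen_avg (I : Type) (l : seq I) (y : I -> R) p : 1 <= p ->
  (0 < size l)%N -> (forall i, 0 <= y i) ->
  ((size l)%:R^-1 * \sum_(i <- l) y i) `^ p <=
  (size l)%:R^-1 * \sum_(i <- l) y i `^ p.
Proof.
move=> p1 l0 y0; have := @powR_jensen I l (fun=> (size l)%:R^-1) y p p1.
rewrite -!mulr_sumr => /(_ (fun=> _) y0); rewrite big_const_seq count_predT.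
rewrite iter_addr_0 -[_^-1 *+ _]mulr_natr mulVf ?pnatr_eq0 -?lt0n// powR1 mul1r; apply.
by rewrite invr_ge0.
Qed.

(** The constant of [powR_strongly_convex]. *)
Definition cvxk p : R := if 2 <= p then p / 2 else (p - 1) ^+ 2 / 2.

Lemma cvxk_gt0 p : 1 < p -> 0 < cvxk p.
Proof.
move=> p1; rewrite /cvxk; case: ifP => _; first by lra.
by rewrite divr_gt0// exprn_gt0// subr_gt0.
Qed.

(** Strong convexity of the power p at 1, without derivatives: for p >= 2
    apply Bernoulli's inequality to u ^ 2, and for p < 2 write u ^ p as
    u ^ 2 / u ^ (2 - p) and bound the denominator by Bernoulli's inequality. *)
Lemma powR_strongly_convex u p : 1 < p -> 0 <= u <= 2 ->
  1 + p * (u - 1) + cvxk p * (u - 1) ^+ 2 <= u `^ p.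
Proof.
move=> p1 /andP[u0 u2]; rewrite /cvxk; case: ifPn => p2.
  have p21 : 1 <= p / 2 by lra.
  have := powR_bernoulli_ge (sqr_ge0 u) p21.
  have e : 2 * (p / 2) = p by lra.
  rewrite -[in X in X -> _](powR_mulrn 2 u0) -powRrM e (powR_mulrn 2 u0); apply: le_trans.
  by rewrite le_eqVlt; apply/orP; left; apply/eqP; field.
have [->|un0] := eqVneq u 0.
  apply: le_trans (powR_ge0 _ _); rewrite -ltNge in p2; nra.
have u0' : 0 < u by rewrite lt0r un0.
rewrite -ltNge in p2.
have t01 : 0 <= 2 - p <= 1 by lra.
have := powR_bernoulli_le u0 t01; set d := 1 + _ => hd.
have d0 : 0 < d by rewrite /d; nra.
have e : u `^ p * u `^ (2 - p) = u ^+ 2.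
  by rewrite -powR_split// addrC subrK powR_mulrn.
have h : u ^+ 2 <= u `^ p * d by rewrite -e ler_wpM2l// powR_ge0.
rewrite -(ler_pM2r d0); apply: le_trans h.
have d2 : d <= 2 by rewrite /d; nra.
have -> : u ^+ 2 = (1 + p * (u - 1)) * d + (p - 1) ^+ 2 * (u - 1) ^+ 2.
  by rewrite /d; ring.
have : 0 <= (p - 1) ^+ 2 * (u - 1) ^+ 2 by rewrite mulr_ge0 ?sqr_ge0.
set K := _ * _ ^+ 2 => K0; rewrite mulrDl lerD2l.
have -> : (p - 1) ^+ 2 / 2 * (u - 1) ^+ 2 * d = K * (d / 2) by rewrite /K; ring.
by rewrite ler_piMr//; lra.
Qed.

(** Comparable, for p > 1, to the second order deviation of the p-th power
    from convexity between y and c. *)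
Definition cvx_gap p y c := (y - c) ^+ 2 * ((y + c) / 2) `^ (p - 2).

Lemma cvx_gap_ge0 p y c : 0 <= cvx_gap p y c.
Proof. by rewrite mulr_ge0 ?sqr_ge0 ?powR_ge0. Qed.

(** Strong convexity at y / m and c / m, where m is the midpoint: the linear
    terms cancel. *)
Lemma powR_midpoint y c p : 1 < p -> 0 <= y -> 0 <= c ->
  2 * ((y + c) / 2) `^ p + cvxk p / 2 * cvx_gap p y c <= y `^ p + c `^ p.
Proof.
move=> p1 y0 c0; rewrite /cvx_gap; set m := (y + c) / 2.
have [m0|mn0] := eqVneq m 0.
  have [-> ->] : y = 0 /\ c = 0 by move: m0; rewrite /m; lra.
  by rewrite m0 subrr expr0n/= powR0 ?gt_eqF//; lra.
have m0 : 0 < m by rewrite lt0r mn0 /m; lra.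
have yu : 0 <= y / m <= 2.
  by rewrite (divr_ge0 y0 (ltW m0))/= ler_pdivrMr// /m; lra.
have cu : 0 <= c / m <= 2.
  by rewrite (divr_ge0 c0 (ltW m0))/= ler_pdivrMr// /m; lra.
have hy := powR_strongly_convex p1 yu; have hc := powR_strongly_convex p1 cu.
have -> : y `^ p = (y / m) `^ p * m `^ p.
  by rewrite -powRM ?(divr_ge0 _ (ltW m0)) ?(ltW m0)// divfK.
have -> : c `^ p = (c / m) `^ p * m `^ p.
  by rewrite -powRM ?(divr_ge0 _ (ltW m0)) ?(ltW m0)// divfK.
rewrite -mulrDl; apply: le_trans (ler_wpM2r (powR_ge0 _ _) (lerD hy hc)).
have -> : m `^ p = m ^+ 2 * m `^ (p - 2).
  by rewrite -[m ^+ 2]powR_mulrn ?ltW// -powR_split// addrC subrK.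
have yE : y = 2 * m - c by rewrite /m; lra.
rewrite yE le_eqVlt; apply/orP; left; apply/eqP; field.
by rewrite gt_eqF.
Qed.

(** Cauchy-Schwarz, with the gaps as weights, bounds the square of the sum by
    the sum of the gaps times that of the a ^ 2 m ^ (2 - p), where m is the
    midpoint of y and c; Young's inequality with exponents 2 / p and
    2 / (2 - p) separates the two, and Jensen's inequality raises the last sum
    to the power p / (2 - p). *)
Lemma gap_lt2 (N : nat) (a y c : nat -> R) p A : 1 < p < 2 ->
  (forall n, 0 <= a n) -> (forall n, 0 <= y n) -> (forall n, 0 <= c n) ->
  \sum_(n < N) a n ^+ 2 <= A ->
  (\sum_(n < N) a n * `|y n - c n|) `^ p <=
  \sum_(n < N) cvx_gap p (y n) (c n) +
  A `^ (p / (2 - p) - 1) * \sum_(n < N) a n ^+ 2 * ((y n + c n) / 2) `^ p.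
Proof.
move=> /andP[p1 p2] a0 y0 c0 hA.
pose m n := (y n + c n) / 2; pose b n := `|y n - c n|.
have m0 n : 0 <= m n by rewrite /m divr_ge0 ?addr_ge0.
have mb n : m n = 0 -> b n = 0.
  move=> mn; have := y0 n; have := c0 n; move: mn; rewrite /m /b => mn cn yn.
  by have -> : y n - c n = 0; [lra|rewrite normr0].
set B := \sum_(n < N) cvx_gap p (y n) (c n).
pose D := \sum_(n < N) a n ^+ 2 * m n `^ (2 - p).
have B0 : 0 <= B by rewrite sumr_ge0// => n _; exact: cvx_gap_ge0.
have D0 : 0 <= D by rewrite sumr_ge0// => n _; rewrite mulr_ge0 ?powR_ge0 ?sqr_ge0.
set X := \sum_(n < N) a n * _.
have X0 : 0 <= X by rewrite sumr_ge0// => n _; rewrite mulr_ge0.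
have CS : X ^+ 2 <= B * D.
  have := @powR_jensen _ (index_enum 'I_N) (fun n => cvx_gap p (y n) (c n))
    (fun n => a n * b n / cvx_gap p (y n) (c n)) 2 (ltW (ltr1n R 2)).
  have bn0 n : cvx_gap p (y n) (c n) = 0 -> b n = 0.
    move=> /eqP; rewrite mulf_eq0 => /orP[|].
      by rewrite sqrf_eq0 => /eqP yc; rewrite /b yc normr0.
    by rewrite powR_eq0 => /andP[/eqP/mb].
  move=> /(_ (fun=> cvx_gap_ge0 _ _ _) (fun=> divr_ge0 (mulr_ge0 (a0 _) (normr_ge0 _)) (cvx_gap_ge0 _ _ _))).
  rewrite (eq_bigr (fun n : 'I_N => a n * b n)); last first.
    move=> n _; have [g0|gn0] := eqVneq (cvx_gap p (y n) (c n)) 0.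
      by rewrite g0 mul0r bn0// mulr0.
    by rewrite mulrC divfK.
  rewrite powR_mulrn// -/X => /le_trans; apply.
  have -> : 2 - 1 = 1 :> R by lra.
  rewrite powRr1// -/B ler_wpM2l//; apply: ler_sum => n _.
  rewrite powR_mulrn; last first.
    by apply: divr_ge0; [apply: mulr_ge0 => //; exact: normr_ge0|exact: cvx_gap_ge0].
  have [g0|gn0] := eqVneq (cvx_gap p (y n) (c n)) 0.
    by rewrite g0 mul0r mulr_ge0 ?sqr_ge0 ?powR_ge0.
  have mn0 : m n != 0.
    apply: contra_neq gn0 => mn; rewrite /cvx_gap -/(m n).
    by move/mb: mn => /eqP; rewrite normr_eq0 => /eqP ->; rewrite expr0n mul0r.
  have mp : 0 < m n by rewrite lt0r mn0 m0.
  rewrite le_eqVlt; apply/orP; left; apply/eqP.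
  have e1 : m n `^ (2 - p) * m n `^ (p - 2) = 1.
    by rewrite -powR_split// (_ : 2 - p + (p - 2) = 0) ?powRr0//; lra.
  have e2 : cvx_gap p (y n) (c n) = b n ^+ 2 * m n `^ (p - 2).
    by rewrite /cvx_gap /b real_normK ?num_real.
  have e3 : cvx_gap p (y n) (c n) * m n `^ (2 - p) = b n ^+ 2.
    by rewrite e2 -mulrA [m n `^ _ * _]mulrC e1 mulr1.
  by rewrite !exprMn -e3; field.
have p0 : 0 < p by lra.
have tp : 0 < 2 - p by lra.
have -> : X `^ p = (X ^+ 2) `^ (p / 2).
  by rewrite -powR_mulrn// -powRrM (_ : 2 * (p / 2) = p)//; lra.
have hX : (X ^+ 2) `^ (p / 2) <= (B * D) `^ (p / 2).
  by apply: ge0_ler_powR; rewrite ?nnegrE ?sqr_ge0 ?mulr_ge0//; lra.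
apply: le_trans hX _; rewrite powRM//.
have := @conjugate_powR R (B `^ (p / 2)) (D `^ (p / 2)) (2 / p) (2 / (2 - p)) (powR_ge0 _ _) (powR_ge0 _ _).
have c1 : (2 / p)^-1 + (2 / (2 - p))^-1 = 1 by field; rewrite !gt_eqF.
have q1 : 0 < 2 / p by rewrite divr_gt0.
have q2 : 0 < 2 / (2 - p) by rewrite divr_gt0.
move=> /(_ q1 q2 c1); rewrite -!powRrM.
have -> : p / 2 * (2 / p) = 1 by field; rewrite gt_eqF.
have -> : p / 2 * (2 / (2 - p)) = p / (2 - p) by field; rewrite gt_eqF.
rewrite powRr1// => /le_trans; apply; apply: lerD.
  by rewrite ler_pdivrMr// ler_peMr// ler_pdivlMr//; lra.
have r1 : 1 <= p / (2 - p) by rewrite ler_pdivlMr//; lra.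
have /le_trans -> // : D `^ (p / (2 - p)) / (2 / (2 - p)) <= D `^ (p / (2 - p)).
  by rewrite ler_pdivrMr// ler_peMr ?powR_ge0// ler_pdivlMr//; lra.
have := @powR_jensen _ (index_enum 'I_N) (fun n => a n ^+ 2)
  (fun n => m n `^ (2 - p)) _ r1 (fun=> sqr_ge0 _) (fun=> powR_ge0 _ _).
move=> /le_trans; apply.
rewrite [X in _ * X <= _](eq_bigr (fun n : 'I_N => a n ^+ 2 * m n `^ p)); last first.
  move=> n _; rewrite -powRrM (_ : (2 - p) * (p / (2 - p)) = p)//.
  by field; rewrite gt_eqF.
rewrite ler_wpM2r//; first by apply: sumr_ge0 => n _; rewrite mulr_ge0 ?sqr_ge0 ?powR_ge0.
apply: ge0_ler_powR => //; rewrite ?nnegrE ?sumr_ge0//.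
- by lra.
- by move=> n _; exact: sqr_ge0.
- by apply: le_trans hA; apply: sumr_ge0 => n _; exact: sqr_ge0.
Qed.

(** Hoelder's inequality with the exponents p and p / (p - 1): for p >= 2 the
    p-th power of the distance is at most 2 ^ (p - 2) times the gap. *)
Lemma gap_ge2 (N : nat) (a y c : nat -> R) p A : 2 <= p ->
  (forall n, 0 < a n) -> (forall n, 0 <= y n) -> (forall n, 0 <= c n) ->
  \sum_(n < N) a n `^ (p / (p - 1)) <= A ->
  (\sum_(n < N) a n * `|y n - c n|) `^ p <=
  2 `^ (p - 2) * A `^ (p - 1) * \sum_(n < N) cvx_gap p (y n) (c n).
Proof.
move=> p2 a0 y0 c0 hA; have p1 : 1 <= p by lra.
have p10 : 0 < p - 1 by lra.
set s := p / (p - 1) in hA *.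
have := @powR_jensen _ (index_enum 'I_N) (fun n => a n `^ s)
   (fun n => a n `^ (1 - s) * `|y n - c n|) p p1 (fun=> powR_ge0 _ _)
   (fun=> mulr_ge0 (powR_ge0 _ _) (normr_ge0 _)).
rewrite (eq_bigr (fun n : 'I_N => a n * `|y n - c n|)); last first.
  by move=> n _; rewrite mulrA -powR_split// addrC subrK powRr1// ltW.
move=> /le_trans; apply.
rewrite [X in _ * X <= _](eq_bigr (fun n : 'I_N => `|y n - c n| `^ p)); last first.
  move=> n _; rewrite powRM ?powR_ge0// mulrA -powRrM -powR_split//.
  rewrite (_ : s + (1 - s) * p = 0) ?powRr0 ?mul1r// /s; field.
  by rewrite gt_eqF.
rewrite [2 `^ _ * _]mulrC -mulrA; apply: ler_pM.
- exact: powR_ge0.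
- by apply: sumr_ge0 => n _; exact: powR_ge0.
- apply: ge0_ler_powR => //; rewrite ?nnegrE ?(ltW p10) ?sumr_ge0//.
    by move=> n _; exact: powR_ge0.
  by apply: le_trans hA; apply: sumr_ge0 => n _; exact: powR_ge0.
rewrite mulr_sumr; apply: ler_sum => n _; rewrite /cvx_gap mulrCA.
rewrite -powRM ?divr_ge0 ?addr_ge0//.
have [yc|ycn] := eqVneq (y n) (c n).
  by rewrite yc subrr normr0 powR0 ?expr0n ?mul0r// gt_eqF//; lra.
have b0 : 0 < `|y n - c n| by rewrite normr_gt0 subr_eq0.
have -> : `|y n - c n| `^ p = (y n - c n) ^+ 2 * `|y n - c n| `^ (p - 2).
  rewrite -[X in _ = X * _]real_normK ?num_real// -powR_mulrn// -powR_split//.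
  by congr (_ `^ _); lra.
rewrite ler_wpM2l ?sqr_ge0//; apply: ge0_ler_powR; rewrite ?nnegrE//; first by lra.
  by rewrite mulrCA divff// mulr1 addr_ge0.
rewrite mulrCA divff// mulr1 ler_norml; have := y0 n; have := c0 n; lra.
Qed.

(** Comparison with the telescoping sum of 1 / n ^ (s - 1). *)
Lemma sum_invpow_bounded s : 1 < s <= 2 ->
  exists A, forall N, \sum_(n < N) (n.+1%:R : R) `^ (- s) <= A.
Proof.
move=> /andP[s1 s2]; pose r := s - 1.
have r01 : 0 <= r <= 1 by rewrite /r; lra.
have r0 : 0 < r by rewrite /r; lra.
have pos n : (0 : R) < n.+1%:R by rewrite ltr0n.
have step n : r * (n.+2%:R : R) `^ (- s) <= (n.+1%:R : R) `^ (- r) - (n.+2%:R : R) `^ (- r).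
  have x0 : (0 : R) <= n.+1%:R / n.+2%:R by rewrite divr_ge0.
  have := powR_bernoulli_le x0 r01.
  have -> : (n.+1%:R / n.+2%:R : R) - 1 = - n.+2%:R^-1.
    by rewrite [n.+2%:R]mulrS; field; rewrite -mulrS gt_eqF.
  rewrite powRM ?invr_ge0// -powR_inv1// -powRrM mulN1r => h.
  have k0 : 0 < (n.+1%:R : R) `^ (- r) by exact: powR_gt0.
  have := ler_wpM2r (ltW k0) h.
  rewrite mulrAC -powR_split// subrr powRr0 mul1r => h2.
  have k1 : (n.+2%:R : R) `^ (- r) <= (n.+1%:R : R) `^ (- r).
    rewrite !powRN lef_pV2 ?posrE ?powR_gt0//.
    by apply: ge0_ler_powR; rewrite ?nnegrE ?ler_nat// ltW.
  have -> : (n.+2%:R : R) `^ (- s) = (n.+2%:R : R)^-1 * (n.+2%:R : R) `^ (- r).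
    by rewrite -powR_inv1// -powR_split// /r; congr (_ `^ _); lra.
  have i0 : 0 <= (n.+2%:R : R)^-1 by rewrite invr_ge0.
  have : r * (n.+2%:R : R)^-1 * (n.+2%:R : R) `^ (- r) <= r * (n.+2%:R : R)^-1 * (n.+1%:R : R) `^ (- r).
    by rewrite ler_wpM2l// mulr_ge0// ltW.
  rewrite powR_inv1// in h2; move: h2; set K1 := _ `^ (- r); set K2 := _ `^ (- r); set i := _^-1 => h2 h3. lra.
exists (1 + r^-1) => N.
suff : \sum_(n < N.+1) (n.+1%:R : R) `^ (- s) <= 1 + r^-1 - r^-1 * (N.+1%:R : R) `^ (- r).
  rewrite big_ord_recr/= => h.
  have := powR_ge0 (N.+1%:R : R) (- s).
  have : 0 <= r^-1 * (N.+1%:R : R) `^ (- r) by rewrite mulr_ge0 ?powR_ge0 ?invr_ge0 ?ltW.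
  lra.
elim: N => [|N IH].
  by rewrite big_ord1 powR1/=; lra.
rewrite big_ord_recr/=; have := step N.
rewrite -(ler_pM2l (_ : 0 < r^-1)) ?invr_gt0// mulrA mulVf ?gt_eqF// mul1r.
lra.
Qed.

End power_inequalities.

(** * Means over successors and L^p bounds *)

Section flow_operators.
Variables (R : realType) (T : rayGraph) (q : nat).
Implicit Types (f g h F G : T -> R) (x y : T).

Local Notation par := (@predecessor T).

(** The mean over the successors, the adjoint of the composition with the
    predecessor. *)
Definition smean f x := q%:R^-1 * \sum_(y <- children x) f y.

Lemma eq_smean f g x : (forall y, y \in children x -> f y = g y) ->
  smean f x = smean g x.
Proof. by move=> fg; rewrite /smean; congr (_ * _); apply: eq_big_seq. Qed.

Lemma smeanD f g x : smean (fun y => f y + g y) x = smean f x + smean g x.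
Proof. by rewrite /smean big_split mulrDr. Qed.

Lemma smeanZ c f x : smean (fun y => c * f y) x = c * smean f x.
Proof. by rewrite /smean -mulr_sumr mulrCA. Qed.

Lemma smeanN f x : smean (fun y => - f y) x = - smean f x.
Proof. by rewrite /smean sumrN mulrN. Qed.

Lemma smean_sum (I : Type) (s : seq I) (f : I -> T -> R) x :
  smean (fun y => \sum_(i <- s) f i y) x = \sum_(i <- s) smean (f i) x.
Proof. by rewrite /smean exchange_big mulr_sumr. Qed.

Lemma smean_ge0 f x : (forall y, 0 <= f y) -> 0 <= smean f x.
Proof. by move=> f0; rewrite mulr_ge0 ?invr_ge0// sumr_ge0. Qed.

Lemma le_smean f g x : (forall y, f y <= g y) -> smean f x <= smean g x.
Proof. by move=> fg; rewrite ler_wpM2l ?invr_ge0// ler_sum. Qed.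

Lemma norm_smean f x : `|smean f x| <= smean (fun y => `|f y|) x.
Proof.
by rewrite normrM ger0_norm ?invr_ge0// ler_wpM2l ?invr_ge0// ler_norm_sum.
Qed.

Hypothesis hT : homogeneous_tree T q.
Hypothesis hray : geodesic_ray T.
Hypothesis q0 : (0 < q)%N.

Lemma qR0 : (0 : R) < q%:R. Proof. by rewrite ltr0n. Qed.

Lemma child_par x y : y \in children x -> par y = x.
Proof. by rewrite (mem_children hT hray) => /eqP. Qed.

Lemma smean_par g h x : smean (fun y => g (par y) * h y) x = g x * smean h x.
Proof. by rewrite -smeanZ; apply: eq_smean => y /child_par ->. Qed.

Lemma smean_cst c x : smean (fun=> c) x = c.
Proof.
rewrite /smean big_const_seq count_predT (size_children hT hray) iter_addr_0.
by rewrite -[c *+ _]mulr_natl mulrA mulVf ?mul1r// gt_eqF// qR0.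
Qed.

Lemma smean_parK g x : smean (g \o par) x = g x.
Proof.
rewrite -[RHS]mulr1 -[1 in RHS](smean_cst 1 x) -smean_par.
by apply: eq_smean => y _; rewrite mulr1.
Qed.

Lemma smean_jensen p f x : 1 <= p -> (forall y, 0 <= f y) ->
  smean f x `^ p <= smean (fun y => f y `^ p) x.
Proof.
move=> p1 f0; rewrite /smean -(size_children hT hray x).
by apply: powR_jensen_avg => //; rewrite (size_children hT hray).
Qed.

Lemma iter_smean_ge0 n f x : (forall y, 0 <= f y) -> 0 <= iter n smean f x.
Proof. by move=> f0; elim: n x => //= n IH x; exact: smean_ge0. Qed.

Lemma mass_gt0 x : 0 < mass R q x.
Proof. by rewrite /mass exprz_gt0// qR0. Qed.

Lemma mass_par x : mass R q (par x) = q%:R * mass R q x.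
Proof.
by rewrite /mass (level_predecessor hT hray) exprzDr ?unitfE ?gt_eqF ?qR0// expr1z mulrC.
Qed.

Lemma sum_flatten_children F (s : seq T) :
  \sum_(y <- flatten [seq children x | x <- s]) mass R q y * F y =
  \sum_(x <- s) mass R q x * smean F x.
Proof.
rewrite big_flatten big_map; apply: eq_bigr => x _.
rewrite /smean mulrA mulr_sumr; apply: eq_big_seq => y /child_par <-.
by rewrite mass_par; field; rewrite gt_eqF// qR0.
Qed.

Lemma flatten_children_uniq (s : seq T) : uniq s ->
  uniq (flatten [seq children x | x <- s]).
Proof.
elim: s => //= x s IH /andP[xs us]; rewrite cat_uniq children_uniq IH// andbT/=.
apply/hasPn => y /flatten_mapP[z zs /child_par yz].
by apply: contra xs => /child_par <-; rewrite yz.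
Qed.

(** The mass of a vertex is q times that of each of its successors. *)
Lemma fint_smean F : (forall x, 0 <= F x) -> fint q (smean F) = fint q F.
Proof.
move=> F0; apply/eqP; rewrite eq_le; apply/andP; split.
  apply: fint_le => [x|s us]; first exact: smean_ge0.
  by rewrite -sum_flatten_children fint_fin// flatten_children_uniq.
apply: fint_le => // t ut; set s := undup (map par t).
have us : uniq s by exact: undup_uniq.
apply: le_trans (fint_fin q (fun x => smean_ge0 x F0) us).
rewrite lee_fin -sum_flatten_children sum_mass_le//.
  exact: flatten_children_uniq.
move=> y yt _; apply/flatten_mapP; exists (par y).
  by rewrite mem_undup map_f.
by rewrite (mem_children hT hray).
Qed.

(** Invariance under A applied to F o par, since A V = 1. *)
Lemma fint_par F : (forall x, 0 <= F x) -> fint q (F \o par) = fint q F.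
Proof.
move=> F0; rewrite -fint_smean//; last by move=> x /=.
by apply: eq_fint => x; exact: smean_parK.
Qed.

(** The midpoint inequality between each f y and the mean c at x, averaged over
    the successors y of x; Jensen's inequality bounds the mean of the p-th
    powers of the midpoints below by c ^ p. *)
Lemma smean_gap p f x : 1 < p -> (forall y, 0 <= f y) ->
  smean f x `^ p + cvxk p / 2 * smean (fun y => cvx_gap p (f y) (smean f (par y))) x <=
  smean (fun y => f y `^ p) x.
Proof.
move=> p1 f0; set c := smean f x.
have c0 : 0 <= c by exact: smean_ge0.
have : 2 * smean (fun y => ((f y + c) / 2) `^ p) x +
    cvxk p / 2 * smean (fun y => cvx_gap p (f y) c) x <=
    smean (fun y => f y `^ p) x + c `^ p.
  rewrite -!smeanZ -smeanD -[X in _ <= _ + X](smean_cst (c `^ p) x) -smeanD.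
  by apply: le_smean => y; exact: powR_midpoint.
have -> : smean (fun y => cvx_gap p (f y) c) x =
          smean (fun y => cvx_gap p (f y) (smean f (par y))) x.
  by apply: eq_smean => y /child_par ->.
have : c `^ p <= smean (fun y => ((f y + c) / 2) `^ p) x.
  have e : smean (fun y => (f y + c) / 2) x = c.
    rewrite (@eq_smean _ (fun y => 2^-1 * (f y + c))); last by move=> *; exact: mulrC.
    by rewrite smeanZ smeanD smean_cst -/c; lra.
  rewrite -{1}e.
  by apply: smean_jensen => [|y]; [exact: ltW|rewrite divr_ge0 ?addr_ge0].
lra.
Qed.

Definition fgap p f n y :=
  cvx_gap p (iter n smean f y) (iter n.+1 smean f (par y)).

(** The mean over the successors decreases the L^p norm by at least the
    convexity gap, hence all the gaps together are controlled by f. *)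
Lemma fgap_telescope p f N : 1 < p -> (forall y, 0 <= f y) ->
  ((cvxk p / 2)%:E * \sum_(n < N) fint q (fgap p f n) +
   fint q (fun y => iter N smean f y `^ p)%R <= fint q (fun y => f y `^ p)%R)%E.
Proof.
move=> p1 f0; have k0 : 0 <= cvxk p / 2 by rewrite divr_ge0// ltW// cvxk_gt0.
have gap0 n y : 0 <= fgap p f n y by exact: cvx_gap_ge0.
elim: N => [|N]; first by rewrite big_ord0 mule0 add0e.
apply: le_trans; rewrite big_ord_recr/= ge0_muleDr; last 2 first.
- by apply: sume_ge0 => n _; exact: fint_ge0.
- exact: fint_ge0.
rewrite -addeA leeD2l//.
rewrite -[leRHS]fint_smean//; last by move=> y; exact: powR_ge0.
rewrite -[fint q (fgap _ _ _)]fint_smean// -fintZ//; last first.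
  by move=> y; exact: smean_ge0.
rewrite -fintD => [||y]; last exact: powR_ge0.
  apply: le_fint => y.
    by rewrite addr_ge0 ?powR_ge0// mulr_ge0// smean_ge0.
  by rewrite addrC; apply: smean_gap => // z; exact: iter_smean_ge0.
by move=> y; rewrite mulr_ge0// smean_ge0.
Qed.

Lemma fgap_sum_le p f N : 1 < p -> (forall y, 0 <= f y) ->
  (\sum_(n < N) fint q (fgap p f n) <= (2 / cvxk p)%:E * fint q (fun y => f y `^ p)%R)%E.
Proof.
move=> p1 f0; have k0 := cvxk_gt0 p1.
have h : ((cvxk p / 2)%:E * \sum_(n < N) fint q (fgap p f n) <=
   fint q (fun y => f y `^ p)%R)%E.
  apply: le_trans (fgap_telescope N p1 f0); rewrite leeDl// fint_ge0// => y.
  exact: powR_ge0.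
have -> : (2 / cvxk p) = (cvxk p / 2)^-1 by rewrite invf_div.
by rewrite lee_pdivlMl ?divr_gt0.
Qed.

Lemma iter_smean_le p f N : 1 < p -> (forall y, 0 <= f y) ->
  (fint q (fun y => iter N smean f y `^ p)%R <= fint q (fun y => f y `^ p)%R)%E.
Proof.
move=> p1 f0; apply: le_trans (fgap_telescope N p1 f0); rewrite leeDr//.
rewrite mule_ge0 ?lee_fin ?divr_ge0 ?(ltW (cvxk_gt0 p1))//.
by apply: sume_ge0 => n _; apply: fint_ge0 => y; exact: cvx_gap_ge0.
Qed.

Variables (eps : T -> R) (M : R).
Hypothesis epsM : forall x, `|eps x| <= M.
Hypothesis eps0 : forall x, smean eps x = 0.

(** The weighted gradient of A^n f. *)
Definition branch n f := smean (fun y => eps y * iter n smean f y).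

Definition psum (a : nat -> R) N f x := \sum_(n < N) a n * branch n f x.

Lemma M_ge0 : 0 <= M.
Proof. exact: le_trans (normr_ge0 _) (epsM (origin T)). Qed.

(** As eps has mean zero over the successors of x, a function of the
    predecessor may be subtracted from the integrand. *)
Lemma norm_branch n f x : `|branch n f x| <=
  M * smean (fun y => `|iter n smean f y - iter n.+1 smean f (par y)|) x.
Proof.
have -> : branch n f x = smean (fun y => eps y *
    (iter n smean f y - iter n.+1 smean f (par y))) x.
  rewrite (@eq_smean _ (fun y => eps y * iter n smean f y +
     - (iter n.+1 smean f (par y) * eps y))); last by move=> y _; ring.
  by rewrite smeanD smeanN smean_par eps0 mulr0 subr0.
apply: le_trans (norm_smean _ _) _; rewrite -smeanZ; apply: le_smean => y.
by rewrite normrM ler_wpM2r.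
Qed.

Lemma norm_psum a N f x : (forall n, 0 <= a n) -> `|psum a N f x| <=
  M * smean (fun y => \sum_(n < N) a n *
    `|iter n smean f y - iter n.+1 smean f (par y)|) x.
Proof.
move=> a0; apply: le_trans (ler_norm_sum _ _ _) _.
rewrite smean_sum mulr_sumr; apply: ler_sum => n _.
rewrite smeanZ [X in _ <= X]mulrCA normrM (ger0_norm (a0 n)) ler_wpM2l//.
exact: norm_branch.
Qed.

Lemma psum_le_gap p a N f : 1 < p -> (forall n, 0 <= a n) ->
  (fint q (fun x => `|psum a N f x| `^ p)%R <= (M `^ p)%:E *
    fint q (fun y => (\sum_(n < N) a n *
      `|iter n smean f y - iter n.+1 smean f (par y)|) `^ p)%R)%E.
Proof.
move=> p1 a0; have p0 : 0 <= p by lra.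
rewrite -[X in (_ <= _ * X)%E]fint_smean; last by move=> y; exact: powR_ge0.
rewrite -fintZ ?powR_ge0//; last by move=> y; apply: smean_ge0 => z; exact: powR_ge0.
apply: le_fint => x; first exact: powR_ge0.
pose Y y := \sum_(n < N) a n * `|iter n smean f y - iter n.+1 smean f (par y)|.
have Y0 y : 0 <= Y y by apply: sumr_ge0 => n _; exact: mulr_ge0.
apply: (@le_trans _ _ ((M * smean Y x) `^ p)).
  apply: ge0_ler_powR => //; rewrite ?nnegrE//; last exact: norm_psum.
  by rewrite mulr_ge0 ?M_ge0// smean_ge0.
rewrite powRM ?M_ge0 ?smean_ge0// ler_wpM2l ?powR_ge0//.
by apply: smean_jensen => //; exact: ltW.
Qed.

(** The gaps are summable by [fgap_sum_le]. For p < 2 they are paired with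
    square summable coefficients ([gap_lt2]), for p >= 2 with coefficients
    summable to the power conjugate to p ([gap_ge2]). *)
Lemma psum_Lp_nneg p a K : 1 < p -> 0 < K ->
  (forall n, 0 < a n <= K / n.+1%:R) ->
  exists2 C, 0 <= C & forall N f, (forall x, 0 <= f x) ->
    (fint q (fun x => `|psum a N f x| `^ p)%R <= C%:E * fint q (fun x => f x `^ p)%R)%E.
Proof.
move=> p1 K0 aK; have a0 n : 0 <= a n by have /andP[/ltW] := aK n.
have sumA s : 1 < s <= 2 -> exists2 A, 0 <= A & forall N, \sum_(n < N) a n `^ s <= A.
  move=> s12; have [A hA] := @sum_invpow_bounded R s s12.
  have A0 : 0 <= A by have := hA 0%N; rewrite big_ord0.
  exists (K `^ s * A) => [|N]; first by rewrite mulr_ge0// powR_ge0.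
  apply: (@le_trans _ _ (\sum_(n < N) K `^ s * n.+1%:R `^ (- s))).
    apply: ler_sum => n _; have /andP[an aKn] := aK n.
    have -> : K `^ s * n.+1%:R `^ (- s) = (K / n.+1%:R) `^ s.
      by rewrite powRM ?invr_ge0 ?(ltW K0)// -powR_inv1// -powRrM mulN1r.
    apply: ge0_ler_powR; rewrite ?nnegrE ?a0// ?divr_ge0 ?(ltW K0)//; lra.
  by rewrite -mulr_sumr ler_wpM2l// powR_ge0.
pose m f n y := (iter n smean f y + iter n.+1 smean f (par y)) / 2.
have k0 := cvxk_gt0 p1.
have fp0 f (x : T) : 0 <= f x `^ p by exact: powR_ge0.
suff [C C0 hC] : exists2 C, 0 <= C & forall N f, (forall x, 0 <= f x) ->
    (fint q (fun y => (\sum_(n < N) a n *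
      `|iter n smean f y - iter n.+1 smean f (par y)|) `^ p)%R <=
      C%:E * fint q (fun x => f x `^ p)%R)%E.
  exists (M `^ p * C); first by rewrite mulr_ge0 ?powR_ge0.
  move=> N f f0; apply: le_trans (psum_le_gap N f p1 a0) _.
  by rewrite EFinM -muleA lee_wpmul2l ?lee_fin ?powR_ge0// hC.
case: (leP 2 p) => p2.
  have pp : 0 < p - 1 by lra.
  have [|A A0 hA] := sumA (p / (p - 1)).
    by rewrite ltr_pdivlMr// ler_pdivrMr//; apply/andP; split; lra.
  exists (2 `^ (p - 2) * A `^ (p - 1) * (2 / cvxk p)).
    by rewrite !mulr_ge0 ?powR_ge0 ?invr_ge0// ltW.
  move=> N f f0; rewrite EFinM -muleA.
  apply: (@le_trans _ _ ((2 `^ (p - 2) * A `^ (p - 1))%:E *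
     \sum_(n < N) fint q (fgap p f n))%E); last first.
    by rewrite lee_wpmul2l ?lee_fin ?mulr_ge0 ?powR_ge0// fgap_sum_le.
  rewrite -fint_sum; last by move=> n y; exact: cvx_gap_ge0.
  rewrite -fintZ ?mulr_ge0 ?powR_ge0//; last first.
    by move=> y; apply: sumr_ge0 => n _; exact: cvx_gap_ge0.
  apply: le_fint => y; first exact: powR_ge0.
  apply: (@gap_ge2 R N a (fun n => iter n smean f y) (fun n => iter n.+1 smean f (par y))) => //.
  - by move=> n; have /andP[] := aK n.
  - by move=> n; exact: iter_smean_ge0.
  - by move=> n; exact: iter_smean_ge0.
have [|A A0 hA] := sumA 2; first by lra.
set c := A `^ (p / (2 - p) - 1).
have c0 : 0 <= c by exact: powR_ge0.
exists (2 / cvxk p + c * A).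
  by rewrite addr_ge0 ?mulr_ge0// invr_ge0 ltW.
move=> N f f0.
have m0 n y : 0 <= m f n y by rewrite divr_ge0 ?addr_ge0 ?iter_smean_ge0.
have mp n y : 0 <= a n ^+ 2 * m f n y `^ p by rewrite mulr_ge0 ?sqr_ge0 ?powR_ge0.
have mle n : (fint q (fun y => m f n y `^ p)%R <= fint q (fun x => f x `^ p)%R)%E.
  have h y : m f n y `^ p <= 2^-1 * iter n smean f y `^ p + 2^-1 * iter n.+1 smean f (par y) `^ p.
    have := powR_midpoint p1 (iter_smean_ge0 n y f0) (iter_smean_ge0 n.+1 (par y) f0).
    have : 0 <= cvxk p / 2 * cvx_gap p (iter n smean f y) (iter n.+1 smean f (par y)).
      by rewrite mulr_ge0 ?cvx_gap_ge0 ?divr_ge0// ltW.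
    by rewrite /m; lra.
  apply: (le_trans (@le_fint _ q _ (fun y => m f n y `^ p) _ (fun=> powR_ge0 _ _) h)).
  rewrite fintD; last 2 first.
  - by move=> y; rewrite mulr_ge0 ?powR_ge0.
  - by move=> y; rewrite mulr_ge0 ?powR_ge0.
  rewrite (@fintZ _ _ _ _ (fun y => iter n smean f y `^ p))//.
  rewrite (@fintZ _ _ _ _ (fun y => iter n.+1 smean f (par y) `^ p))//.
  rewrite (@fint_par (fun y => iter n.+1 smean f y `^ p)); last by move=> y; exact: powR_ge0.
  apply: (@le_trans _ _ ((2^-1)%:E * fint q (fun x => f x `^ p)%R + (2^-1)%:E * fint q (fun x => f x `^ p)%R)%E).
    have h0 : (0 <= (2^-1)%:E :> \bar R)%E by rewrite lee_fin.
    exact: (leeD (lee_wpmul2l h0 (iter_smean_le n p1 f0))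
                 (lee_wpmul2l h0 (iter_smean_le n.+1 p1 f0))).
  rewrite -ge0_muleDl ?lee_fin// -EFinD.
  by rewrite (_ : 2^-1 + 2^-1 = 1) ?mul1e//; lra.
apply: (@le_trans _ _ (fint q (fun y => \sum_(n < N) fgap p f n y +
    c * \sum_(n < N) a n ^+ 2 * m f n y `^ p)%R)).
  apply: le_fint => y; first exact: powR_ge0.
  apply: (@gap_lt2 R N a (fun n => iter n smean f y) (fun n => iter n.+1 smean f (par y))) => //.
  - by rewrite p1.
  - by move=> n; exact: iter_smean_ge0.
  - by move=> n; exact: iter_smean_ge0.
  - by rewrite (eq_bigr (fun n : 'I_N => a n `^ 2)) ?hA// => n _; rewrite powR_mulrn.
rewrite fintD; last 2 first.
- by move=> y; apply: sumr_ge0 => n _; exact: cvx_gap_ge0.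
- by move=> y; rewrite mulr_ge0// sumr_ge0.
have k20 : 0 <= 2 / cvxk p by rewrite divr_ge0// ltW.
have cA0 : 0 <= c * A by rewrite mulr_ge0.
rewrite [X in (_ <= X * _)%E]EFinD ge0_muleDl ?lee_fin//; apply: leeD.
  by rewrite fint_sum ?fgap_sum_le// => n y; exact: cvx_gap_ge0.
rewrite fintZ//; last by move=> y; exact: sumr_ge0.
rewrite EFinM -muleA lee_wpmul2l ?lee_fin// fint_sum//.
apply: (@le_trans _ _ (\sum_(n < N) (a n ^+ 2)%:E * fint q (fun x => f x `^ p)%R)%E).
  apply: lee_sum => n _.
  rewrite (@fintZ _ _ _ (a n ^+ 2) (fun y => m f n y `^ p)) ?sqr_ge0//.
  by apply: lee_wpmul2l; [rewrite lee_fin sqr_ge0|exact: mle].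
rewrite -ge0_sume_distrl; last by move=> n _; rewrite lee_fin sqr_ge0.
rewrite lee_wpmul2r ?fint_ge0// sumEFin lee_fin.
by rewrite (eq_bigr (fun n : 'I_N => a n `^ 2)) ?hA// => n _; rewrite powR_mulrn.
Qed.

End flow_operators.

(** * Calderon-Zygmund decomposition on trapezoids *)

Section weak_type.
Variables (R : realType) (T : rayGraph) (q : nat).
Implicit Types (f g F : T -> R) (x y z : T).

Local Notation par := (@predecessor T).
Local Notation smean := (@smean R T q).

Hypothesis hT : homogeneous_tree T q.
Hypothesis hray : geodesic_ray T.
Hypothesis q0 : (0 < q)%N.

Lemma level_iter k x : level (iter k par x) = level x + k%:Z.
Proof.
elim: k => [|k IH] /=; first by rewrite addr0.
by rewrite (level_predecessor hT hray) IH; lia.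
Qed.

Lemma mass_iter k x : mass R q (iter k par x) = q%:R ^+ k * mass R q x.
Proof.
elim: k => [|k IH] /=; first by rewrite mul1r.
by rewrite (mass_par R hT hray q0) IH exprS mulrA.
Qed.

(** The n-th power of A only sees the descendants at distance n. *)
Lemma iter_smean_local n f g x : (forall z, iter n par z = x -> f z = g z) ->
  iter n smean f x = iter n smean g x.
Proof.
elim: n x => [|n IH] x fg; first exact: fg.
apply: eq_smean => y /(child_par hT hray) yx; apply: IH => z zy.
by apply: fg; rewrite /= zy.
Qed.

Lemma iter_smean0 n x : iter n smean (fun=> 0) x = 0.
Proof.
elim: n x => //= n IH x; rewrite (@eq_smean _ _ _ _ (fun=> 0 * 0)).
  by rewrite smeanZ mul0r.
by move=> y _; rewrite IH mul0r.
Qed.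

Lemma iter_smeanB n f g x :
  iter n smean (fun y => f y - g y) x = iter n smean f x - iter n smean g x.
Proof.
elim: n x => //= n IH x; rewrite -smeanN -smeanD.
by apply: eq_smean => y _; exact: IH.
Qed.

Lemma iter_smeanZ n c f x :
  iter n smean (fun y => c * f y) x = c * iter n smean f x.
Proof.
elim: n x => //= n IH x; rewrite -smeanZ.
by apply: eq_smean => y _; exact: IH.
Qed.

Lemma iter_smean_cst n c x : iter n smean (fun=> c) x = c.
Proof.
elim: n x => //= n IH x; rewrite -[RHS](smean_cst hT hray q0 c x).
by apply: eq_smean => y _; exact: IH.
Qed.

Lemma norm_iter_smean n f x :
  `|iter n smean f x| <= iter n smean (fun y => `|f y|) x.
Proof.
elim: n x => //= n IH x; apply: le_trans (norm_smean _ _ _) _.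
exact: le_smean.
Qed.

Lemma fint_iter_smean n F : (forall x, 0 <= F x) ->
  fint q (iter n smean F) = fint q F.
Proof.
move=> F0; elim: n => //= n <-; apply: (fint_smean hT hray q0) => x.
exact: iter_smean_ge0.
Qed.

Variables (eps : T -> R) (M : R).
Hypothesis epsM : forall x, `|eps x| <= M.
Hypothesis eps0 : forall x, smean eps x = 0.

Local Notation branch := (@branch R T q eps).
Local Notation psum := (@psum R T q eps).

Lemma branchB n f g x : branch n (fun y => f y - g y) x = branch n f x - branch n g x.
Proof.
rewrite /branch -smeanN -smeanD; apply: eq_smean => y _.
by rewrite iter_smeanB mulrBr.
Qed.

Lemma psumB a N f g x : psum a N (fun y => f y - g y) x = psum a N f x - psum a N g x.
Proof. by rewrite -sumrB; apply: eq_bigr => n _; rewrite branchB mulrBr. Qed.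

Lemma branch_local n f g x : (forall z, iter n.+1 par z = x -> f z = g z) ->
  branch n f x = branch n g x.
Proof.
move=> fg; apply: eq_smean => y /(child_par hT hray) yx; congr (_ * _).
by apply: iter_smean_local => z zy; apply: fg; rewrite /= zy.
Qed.

Lemma psum_local a N f g x :
  (forall n z, (n <= N)%N -> iter n par z = x -> f z = g z) ->
  psum a N f x = psum a N g x.
Proof.
move=> fg; apply: eq_bigr => n _; congr (_ * _).
by apply: branch_local => z; apply: fg.
Qed.

(** Splitting into the positive and the negative part. *)
Lemma psum_Lp p a K : 1 < p -> 0 < K -> (forall n, 0 < a n <= K / n.+1%:R) ->
  exists2 C, 0 <= C & forall N f,
    (fint q (fun x => `|psum a N f x| `^ p)%R <=
      C%:E * fint q (fun x => `|f x| `^ p)%R)%E.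
Proof.
move=> p1 K0 aK; have p0 : 0 <= p by lra.
have [C C0 hC] := psum_Lp_nneg hT hray q0 epsM eps0 p1 K0 aK.
exists (2 `^ p * (C + C)); first by rewrite mulr_ge0 ?powR_ge0 ?addr_ge0.
move=> N f; pose fp x := Num.max (f x) 0; pose fn x := Num.max (- f x) 0.
have fp0 x : 0 <= fp x by rewrite /fp le_max lexx orbT.
have fn0 x : 0 <= fn x by rewrite /fn le_max lexx orbT.
have fE : f = (fun x => fp x - fn x).
  apply/funext => x; rewrite /fp /fn; case: (leP (f x) 0) => h.
    by rewrite max_l ?oppr_ge0//; lra.
  by rewrite max_r ?oppr_le0 ?(ltW h)//; lra.
have fpf x : fp x `^ p <= `|f x| `^ p.
  by apply: ge0_ler_powR; rewrite ?nnegrE// /fp ge_max ler_norm/=.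
have fnf x : fn x `^ p <= `|f x| `^ p.
  by apply: ge0_ler_powR; rewrite ?nnegrE// /fn ge_max -normrN ler_norm/=.
have pw (t : R) : 0 <= t `^ p by exact: powR_ge0.
have h x : `|psum a N f x| `^ p <=
    2 `^ p * (`|psum a N fp x| `^ p + `|psum a N fn x| `^ p).
  rewrite {1}fE psumB; set u := psum a N fp x; set v := psum a N fn x.
  apply: (@le_trans _ _ ((2 * Num.max `|u| `|v|) `^ p)).
    apply: ge0_ler_powR; rewrite ?nnegrE ?mulr_ge0 ?le_max ?normr_ge0//.
    apply: le_trans (ler_normB _ _) _; rewrite mulr2n mulrDl mul1r lerD//.
      by rewrite le_max lexx.
    by rewrite le_max lexx orbT.
  rewrite powRM ?le_max ?normr_ge0// ler_wpM2l//.
  by case: (leP `|u| `|v|) => _; rewrite ?lerDl ?lerDr.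
apply: (le_trans (@le_fint _ q _ (fun x => `|psum a N f x| `^ p) _ (fun=> powR_ge0 _ _) h)).
rewrite fintZ// fintD// EFinM -muleA lee_wpmul2l ?lee_fin//.
rewrite EFinD ge0_muleDl ?lee_fin//; apply: leeD.
  apply: (le_trans (hC N fp fp0)); apply: lee_wpmul2l; first by rewrite lee_fin.
  by apply: le_fint fpf => x; exact: pw.
apply: (le_trans (hC N fn fn0)); apply: lee_wpmul2l; first by rewrite lee_fin.
by apply: le_fint fnf => x; exact: pw.
Qed.

(** These sets play the role of balls: h is the distance from the root, L the
    number of generations. *)
Definition trapezoid (x0 : T) (h L : nat) : set T :=
  [set y | exists2 k, (h <= k < h + L)%N & iter k par y = x0].

Definition supported (B : set T) f := forall y, ~ B y -> f y = 0.

(** Each generation of descendants contributes the iterated mean at the root,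
    since A preserves the integral. *)
Lemma fint_trapezoid x0 h L F : (forall x, 0 <= F x) ->
  supported (trapezoid x0 h L) F ->
  fint q F = (mass R q x0 * \sum_(j < L) iter (h + j) smean F x0)%:E.
Proof.
move=> F0 sF; pose Fj j y := if iter (h + j) par y == x0 then F y else 0.
have Fj0 j y : 0 <= Fj j y by rewrite /Fj; case: ifP.
have FE : F =1 (fun y => \sum_(j < L) Fj j y).
  move=> y; have [[k /andP[hk kL] ky]|ny] := pselect (trapezoid x0 h L y); last first.
    rewrite sF// big1// => j _; rewrite /Fj; case: eqP => // jy; exfalso; apply: ny.
    by exists (h + j)%N => //; rewrite leq_addr ltn_add2l ltn_ord.
  have kL' : (k - h < L)%N by rewrite ltn_subLR.
  rewrite (bigD1 (Ordinal kL'))//= /Fj subnKC// ky eqxx big1 ?addr0// => j jk.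
  case: eqP => // jy; exfalso; move: jk => /eqP; apply; apply/val_inj => /=.
  have := level_iter k y; have := level_iter (h + j) y; rewrite ky jy; lia.
rewrite (eq_fint q FE) fint_sum; last by move=> j y.
rewrite mulr_sumr -sumEFin; apply: eq_bigr => j _.
rewrite -(fint_iter_smean (h + j)) ?(@fint1 _ _ _ _ x0)//=; last 2 first.
- by move=> y; exact: iter_smean_ge0.
- move=> y yx; rewrite -[RHS](iter_smean0 (h + j) y); apply: iter_smean_local => z zy.
  by rewrite /Fj zy (negbTE yx).
congr (_ * _)%:E; apply: iter_smean_local => z zx.
rewrite [in RHS]FE (bigD1 j)//= big1 ?addr0// => i ij; rewrite /Fj; case: eqP => // iz.
exfalso; move: ij => /eqP; apply; apply/val_inj => /=.
have := level_iter (h + i) z; have := level_iter (h + j) z; rewrite zx iz; lia.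
Qed.

Lemma iter_smean_trapezoid x0 h L j : (h <= j < h + L)%N ->
  iter j smean \1_(trapezoid x0 h L) x0 = 1.
Proof.
move=> hj; rewrite -[RHS](iter_smean_cst j 1 x0); apply: iter_smean_local => z zx.
by rewrite indicE mem_set//; exists j.
Qed.

Lemma fint_indic_trapezoid x0 h L :
  fint q (\1_(trapezoid x0 h L) : T -> R) = (mass R q x0 * L%:R)%:E.
Proof.
rewrite (@fint_trapezoid x0 h L).
- rewrite (eq_bigr (fun=> 1)) ?sumr_const ?card_ord// => j _.
  by rewrite iter_smean_trapezoid// leq_addr ltn_add2l ltn_ord.
- by move=> x; rewrite indicE.
- by move=> y ny; rewrite indicE memNset.
Qed.

Lemma iter_smean_out x0 h L n x f : supported (trapezoid x0 h L) f ->
  (forall k, (h <= k < h + L)%N -> forall z, iter n par z = x -> iter k par z = x0 -> False) ->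
  iter n smean f x = 0.
Proof.
move=> sf H; rewrite -[RHS](iter_smean0 n x); apply: iter_smean_local => z zx.
by apply: sf => -[k hk kz]; exact: (H k hk z).
Qed.

(** Seen from a strict ancestor, only one successor of each ancestor carries
    the function, so that only the means over the generations matter. *)
Lemma iter_smean_above x0 h L f i k : supported (trapezoid x0 h L) f ->
  iter (i + k) smean f (iter i par x0) = q%:R ^- i * iter k smean f x0.
Proof.
move=> sf; elim: i => [|i IH]; first by rewrite expr0 invr1 mul1r.
rewrite addSn [LHS]/= {1}/smean.
have ic : iter i par x0 \in children (iter i.+1 par x0).
  by rewrite (mem_children hT hray) /= eqxx.
rewrite (bigD1_seq _ ic (children_uniq _))/= IH big1_seq ?addr0.
  by rewrite exprS invfM mulrA.
move=> y /andP[yi /(child_par hT hray) yc]; apply: (iter_smean_out sf) => m _ z zy zx.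
move/eqP: yi; apply.
have := level_iter (i + k) z; have := level_iter m z; rewrite zx zy.
have := congr1 (@level T) yc; rewrite !(level_predecessor hT hray) level_iter => h1 h2 h3.
rewrite -zy -zx -iterD; congr (iter _ _ _); lia.
Qed.

(** Only the successor of the ancestor that lies on the path to x0 counts. *)
Lemma branch_above x0 h L f i n : supported (trapezoid x0 h L) f ->
  branch n f (iter i.+1 par x0) =
  if (i <= n)%N then q%:R ^- i.+1 * (eps (iter i par x0) * iter (n - i) smean f x0)
  else 0.
Proof.
move=> sf; rewrite /branch {1}/smean.
have ic : iter i par x0 \in children (iter i.+1 par x0).
  by rewrite (mem_children hT hray) /= eqxx.
rewrite (bigD1_seq _ ic (children_uniq _))/= big1_seq ?addr0.
  case: ifPn => ni.
    rewrite -{1}(subnKC ni) (iter_smean_above _ _ sf) exprS invfM; ring.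
  rewrite (iter_smean_out sf) ?mulr0// => m _ z zy zx.
  have := level_iter n z; have := level_iter m z; rewrite zx zy level_iter.
  by move: ni; rewrite -ltnNge; lia.
move=> y /andP[yi /(child_par hT hray) yc].
rewrite (iter_smean_out sf) ?mulr0// => m _ z zy zx.
have := level_iter n z; have := level_iter m z; rewrite zx zy.
have := congr1 (@level T) yc; rewrite !(level_predecessor hT hray) level_iter => h1 h2 h3.
move/eqP: yi; apply; rewrite -zy -zx -iterD; congr (iter _ _ _); lia.
Qed.

(** A vertex outside the enlarged trapezoid and the line of ancestors of x0 has
    no descendant in the support of f. *)
Lemma branch_out x0 h L f n x : supported (trapezoid x0 h L) f ->
  ~ trapezoid x0 0 (h + L) x -> (forall i, x <> iter i.+1 par x0) ->
  branch n f x = 0.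
Proof.
move=> sf nx ni; rewrite /branch -[RHS](mul0r (smean (fun=> 0) x)) -smeanZ.
apply: eq_smean => y /(child_par hT hray) yx.
rewrite (iter_smean_out sf) ?mulr0 ?mul0r// => k /andP[_ kL] z zy zx.
have [nk|kn] := ltnP n k.
  apply: nx; exists (k - n.+1)%N; first by rewrite /=; lia.
  by rewrite -yx -zy -zx -iterS -iterD subnK.
apply: (ni (n - k)%N); rewrite -yx -zy -zx -iterS -iterD.
by rewrite addSn subnK.
Qed.

Variables (a : nat -> R) (K : R).
Hypothesis a0 : forall n, 0 <= a n.
Hypothesis a_dec : forall m n, (m <= n)%N -> a n <= a m.
Hypothesis aK : forall n, a n <= K / n.+1%:R.

(** Cutting off the coefficients, rather than the sum, keeps them decreasing. *)
Definition cutoff N n := if (n < N)%N then a n else 0.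

Lemma cutoff_ge0 N n : 0 <= cutoff N n.
Proof. by rewrite /cutoff; case: ifP. Qed.

Lemma cutoff_dec N m n : (m <= n)%N -> cutoff N n <= cutoff N m.
Proof.
move=> mn; rewrite /cutoff; case: (ltnP n N) => nN.
  by rewrite (leq_ltn_trans mn nN) a_dec.
by case: ifP.
Qed.

Lemma cutoff_le N n : cutoff N n <= K / n.+1%:R.
Proof.
by rewrite /cutoff; case: ifP => // _; apply: le_trans (aK n).
Qed.

(** The sum over n is reindexed by the generation j of the trapezoid: the term
    seen from the (i+1)-st ancestor is n = i + (h + j). *)
Lemma psum_above x0 h L f i N : supported (trapezoid x0 h L) f ->
  psum a N f (iter i.+1 par x0) = q%:R ^- i.+1 * eps (iter i par x0) *
    \sum_(j < L) cutoff N (i + (h + j)) * iter (h + j) smean f x0.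
Proof.
move=> sf; pose A k := iter k smean f x0.
have A0 k : ~~ (h <= k < h + L)%N -> A k = 0.
  move=> hk; apply: (iter_smean_out sf) => m hm z zk zm.
  have := level_iter k z; have := level_iter m z; rewrite zk zm => e1 e2.
  by move: hk; rewrite (_ : k = m) ?hm//; lia.
pose m := (N + (h + L))%N.
transitivity (\sum_(n < i + m) cutoff N n * branch n f (iter i.+1 par x0)).
  rewrite (_ : (i + m = N + (i + (h + L)))%N); last by rewrite /m; lia.
  rewrite big_split_ord/= [X in _ = _ + X]big1 ?addr0; last first.
    by move=> n _; rewrite /cutoff ltnNge leq_addr mul0r.
  by apply: eq_bigr => n _; rewrite /cutoff ltn_ord.
rewrite big_split_ord/= big1 ?add0r; last first.
  by move=> n _; rewrite (branch_above _ _ sf) leqNgt ltn_ord mulr0.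
transitivity (\sum_(n < m) (q%:R ^- i.+1 * eps (iter i par x0)) *
    (cutoff N (i + n) * A n)).
  apply: eq_bigr => n _; rewrite (branch_above _ _ sf) leq_addr addKn /A; ring.
rewrite -mulr_sumr; congr (_ * _).
rewrite (_ : m = (h + (L + N))%N); last by rewrite /m; lia.
rewrite big_split_ord/= big1 ?add0r; last first.
  by move=> n _; rewrite A0 ?mulr0//; have := ltn_ord n; lia.
rewrite big_split_ord/= [X in _ + X]big1 ?addr0// => n _.
by rewrite A0 ?mulr0//=; lia.
Qed.

(** The sum over N + L consecutive indices is split in two ways. *)
Lemma cutoff_telescope N h L :
  \sum_(i < N) (cutoff N (i + h) - cutoff N (i + h + L)) <= \sum_(j < L) cutoff N (h + j).
Proof.
rewrite sumrB; pose u i := cutoff N (i + h).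
have : \sum_(i < N + L) u i = \sum_(i < N) u i + \sum_(i < L) u (N + i)%N.
  by rewrite big_split_ord.
have : \sum_(i < N + L) u i = \sum_(i < L) u i + \sum_(i < N) u (L + i)%N.
  by rewrite addnC big_split_ord.
have -> : \sum_(i < N) u (L + i)%N = \sum_(i < N) cutoff N (i + h + L).
  by apply: eq_bigr => i _; rewrite /u; congr cutoff; lia.
have -> : \sum_(i < L) u i = \sum_(j < L) cutoff N (h + j).
  by apply: eq_bigr => i _; rewrite /u addnC.
have : 0 <= \sum_(i < L) u (N + i)%N by apply: sumr_ge0 => i _; exact: cutoff_ge0.
rewrite /u; lra.
Qed.

(** A Calderon-Zygmund decomposition of f at height lam, localized to B: the
    bounded part g, a function om that is at least 1 on an exceptional set, and
    a majorant v of the image of the remaining part off that set. *)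
Definition CZdec N (lam : R) (B : set T) f := exists g om v : T -> R,
  [/\ [/\ forall x, 0 <= om x, forall x, 0 <= v x & supported B g],
      forall x, `|g x| <= q%:R * lam,
      (fint q (fun x => `|g x|)%R <= fint q (fun x => `|f x|)%R)%E,
      (fint q om <= (4 / lam)%:E * fint q (fun x => `|f x|)%R)%E /\
      (fint q v <= (2 * M * K)%:E * fint q (fun x => `|f x|)%R)%E
    & forall x, om x < 1 -> `|psum a N (fun y => f y - g y) x| <= v x].

Lemma fint_above x0 N F : (forall x, 0 <= F x) ->
  (forall x, (forall i, (i < N)%N -> x <> iter i.+1 par x0) -> F x = 0) ->
  fint q F = (mass R q x0 * \sum_(i < N) q%:R ^+ i.+1 * F (iter i.+1 par x0))%:E.
Proof.
move=> F0 FN; rewrite (@fint_seq _ _ _ _ [seq iter i.+1 par x0 | i <- iota 0 N])//.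
- rewrite big_map -[N in iota 0 N]subn0 -/(index_iota 0 N) big_mkord mulr_sumr.
  by congr EFin; apply: eq_bigr => i _; rewrite mass_iter; ring.
- rewrite map_inj_in_uniq ?iota_uniq// => i j _ _ /(congr1 (@level T)).
  by rewrite !level_iter; lia.
- move=> x /mapP nx; apply: FN => i iN xi; apply: nx; exists i => //.
  by rewrite mem_iota.
Qed.

(** The stopping case: the mean of f over the trapezoid is comparable to lam,
    so that g may be taken constant. The difference f - g has mean zero, hence
    at the i-th ancestor of the root the coefficients may be replaced by their
    oscillation over L consecutive indices. The sum over i telescopes to at
    most L a_h, which is bounded by K as L <= h + 1. The exceptional set is
    the enlarged trapezoid of measure (h + L) mass, at most 4 L mass. *)
Lemma CZ_stop N (lam : R) x0 h L f : 0 < lam -> 0 < K -> (0 < L)%N ->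
  (L <= h.+1)%N -> (h + L <= 4 * L)%N -> supported (trapezoid x0 h L) f ->
  ((lam * (mass R q x0 * L%:R))%:E <= fint q (fun x => `|f x|)%R)%E ->
  (fint q (fun x => `|f x|)%R <= (q%:R * lam * (mass R q x0 * L%:R))%:E)%E ->
  CZdec N lam (trapezoid x0 h L) f.
Proof.
move=> lam0 K0 L0 Lh hL sf; set Q := trapezoid x0 h L.
have m0 : 0 < mass R q x0 by exact: mass_gt0.
have LR0 : (0 : R) < L%:R by rewrite ltr0n.
set W := \sum_(j < L) iter (h + j) smean (fun y => `|f y|) x0.
have fW : fint q (fun x => `|f x|) = (mass R q x0 * W)%:E.
  by apply: fint_trapezoid => // y ny; rewrite sf ?normr0.
rewrite fW !lee_fin mulrCA ler_pM2l// => hW1.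
rewrite mulrCA ler_pM2l// => hW2.
pose A j := iter (h + j) smean f x0.
have AW : \sum_(j < L) `|A j| <= W by apply: ler_sum => j _; exact: norm_iter_smean.
pose c := (\sum_(j < L) A j) / L%:R.
have cW : `|c| * L%:R <= W.
  rewrite /c normrM [ `|L%:R^-1|]ger0_norm ?invr_ge0 ?(ltW LR0)// divfK ?gt_eqF//.
  exact: le_trans (ler_norm_sum _ _ _) AW.
pose g x := c * \1_Q x.
pose b x := f x - g x.
have sg : supported Q g by move=> y ny; rewrite /g indicE memNset// mulr0.
have sb : supported Q b by move=> y ny; rewrite /b sf// sg// subr0.
pose S x := psum a N b x.
pose Qs := trapezoid x0 0 (h + L).
pose v x := if x \in Qs then 0 else `|S x|.
have v0 x : 0 <= v x by rewrite /v; case: ifP.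
have M0 : 0 <= M by exact: M_ge0 epsM.
have W0 : 0 <= W by apply: le_trans AW; exact: sumr_ge0.
exists g, (\1_Qs), v; split.
- by split=> // x; rewrite indicE.
- move=> x; apply: (@le_trans _ _ `|c|).
    by rewrite /g normrM indicE; case: (x \in Q); rewrite ?normr1 ?normr0 ?mulr1 ?mulr0.
  by rewrite -(ler_pM2r LR0); exact: le_trans cW hW2.
- rewrite (@eq_fint _ _ _ _ (fun x => `|c| * \1_Q x)); last first.
    by move=> x; rewrite /g normrM [ `|\1_Q x|]ger0_norm// indicE.
  rewrite fintZ//.
  rewrite fint_indic_trapezoid -EFinM fW lee_fin mulrCA ler_pM2l//.
- split.
    rewrite fint_indic_trapezoid fW -EFinM lee_fin mulrCA ler_pM2l//.
    rewrite mulrAC ler_pdivlMr//.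
    have : (h + L)%:R <= 4 * L%:R :> R by rewrite -natrM ler_nat.
    by move=> hL'; nra.
  rewrite (@fint_above x0 N)//; last first.
    move=> x nx; rewrite /v; case: ifPn => //; rewrite notin_setE => nQ.
    apply/eqP; rewrite normr_eq0; apply/eqP.
    have [[i xi]|ni] := pselect (exists i, x = iter i.+1 par x0); last first.
      rewrite /S /psum big1// => n _; rewrite (branch_out n sb nQ) ?mulr0// => i xi.
      by apply: ni; exists i.
    have iN : (N <= i)%N by rewrite leqNgt; apply/negP => /nx.
    rewrite xi /S (psum_above _ _ sb) big1 ?mulr0// => j _.
    by rewrite /cutoff ltnNge (leq_trans iN) ?leq_addr// mul0r.
  rewrite fW -EFinM lee_fin mulrCA ler_pM2l//.
  have hv i : q%:R ^+ i.+1 * v (iter i.+1 par x0) <=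
      2 * M * W * (cutoff N (i + h) - cutoff N (i + h + L)).
    have qi : 0 < q%:R ^+ i.+1 :> R by rewrite exprn_gt0// qR0.
    apply: (@le_trans _ _ (q%:R ^+ i.+1 * `|S (iter i.+1 par x0)|)).
      by rewrite ler_wpM2l ?(ltW qi)// /v; case: ifP.
    rewrite /S (psum_above _ _ sb) !normrM [ `|q%:R ^- _|]gtr0_norm ?invr_gt0//.
    rewrite -!mulrA mulVKf ?gt_eqF//.
    set D := cutoff N (i + h) - _.
    have D0 : 0 <= D by rewrite subr_ge0 cutoff_dec// leq_addr.
    rewrite [2 * _]mulrCA; apply: ler_pM => //.
    have bE j : iter (h + j) smean b x0 = A j - c * iter (h + j) smean \1_Q x0.
      by rewrite iter_smeanB /g iter_smeanZ.
    have bE' (j : 'I_L) : iter (h + j) smean b x0 = A j - c.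
      by rewrite bE iter_smean_trapezoid ?mulr1// leq_addr ltn_add2l ltn_ord.
    (* The means of b over the generations add up to zero, so that a constant
       may be subtracted from the coefficients. *)
    have -> : \sum_(j < L) cutoff N (i + (h + j)) * iter (h + j) smean b x0 =
       \sum_(j < L) (cutoff N (i + (h + j)) - cutoff N (i + h + L)) * (A j - c).
      under [RHS]eq_bigr => j _ do rewrite mulrBl.
      rewrite sumrB -[X in _ - X]mulr_sumr sumrB sumr_const card_ord.
      rewrite -[c *+ L]mulr_natr /c divfK ?gt_eqF// subrr mulr0 subr0.
      by apply: eq_bigr => j _; rewrite bE'.
    apply: le_trans (ler_norm_sum _ _ _) _.
    apply: (@le_trans _ _ (\sum_(j < L) D * (`|A j| + `|c|))).
      apply: ler_sum => j _; rewrite normrM; apply: ler_pM => //.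
        have h1 : cutoff N (i + h + L) <= cutoff N (i + (h + j)).
          by apply: cutoff_dec; rewrite addnA leq_add2l ltnW.
        by rewrite ger0_norm ?subr_ge0// lerD2r cutoff_dec// addnA leq_addr.
      exact: ler_normB.
    rewrite -mulr_sumr big_split/= sumr_const card_ord -[ `|c| *+ L]mulr_natr.
    rewrite [2 * _]mulrC [W * D]mulrC -mulrA ler_wpM2l//; lra.
  apply: (@le_trans _ _ (\sum_(i < N) 2 * M * W * (cutoff N (i + h) - cutoff N (i + h + L)))).
    by apply: ler_sum => i _; exact: hv.
  rewrite -mulr_sumr [leRHS]mulrAC ler_wpM2l ?mulr_ge0//.
  apply: le_trans (cutoff_telescope N h L) _.
  apply: (@le_trans _ _ (\sum_(j < L) K / h.+1%:R)).
    apply: ler_sum => j _; apply: le_trans (cutoff_le N h).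
    by apply: cutoff_dec; exact: leq_addr.
  rewrite sumr_const card_ord -[_ *+ L]mulr_natr mulrAC ler_pdivrMr ?ltr0n//.
  by rewrite ler_pM2l// ler_nat.
- move=> x; rewrite indicE /v => h1.
  have -> : x \in Qs = false by apply/negbTE; move: h1; case: (x \in Qs); rewrite ?ltxx.
  by [].
Qed.

End weak_type.

(** * Weak type of the partial sums *)

Section weak_type_recursion.
Variables (R : realType) (T : rayGraph) (q : nat).
Implicit Types (f g F : T -> R) (x y z : T) (B : set T).

Local Notation par := (@predecessor T).
Local Notation smean := (@smean R T q).

Hypothesis hT : homogeneous_tree T q.
Hypothesis hray : geodesic_ray T.
Hypothesis q2 : (2 <= q)%N.

Variables (eps : T -> R) (M : R).
Hypothesis epsM : forall x, `|eps x| <= M.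
Hypothesis eps0 : forall x, smean eps x = 0.

Variables (a : nat -> R) (K : R).
Hypothesis K0 : 0 < K.
Hypothesis a0 : forall n, 0 < a n.
Hypothesis a_dec : forall m n, (m <= n)%N -> a n <= a m.
Hypothesis aK : forall n, a n <= K / n.+1%:R.

Local Notation psum := (@psum R T q eps a).
Local Notation CZdec := (@CZdec R T q eps M a K).

Let q0 : (0 < q)%N. Proof. exact: ltnW. Qed.
Let a0' n : 0 <= a n. Proof. exact: ltW. Qed.
Let M0 : 0 <= M. Proof. exact: M_ge0 epsM. Qed.

Definition restr B f x := \1_B x * f x.

Lemma restr_in B f x : B x -> restr B f x = f x.
Proof. by move=> Bx; rewrite /restr indicE mem_set// mul1r. Qed.

Lemma restr_out B f x : ~ B x -> restr B f x = 0.
Proof. by move=> Bx; rewrite /restr indicE memNset// mul0r. Qed.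

Lemma restr_id B f : supported B f -> restr B f = f.
Proof.
move=> sf; apply/funext => x; have [Bx|nB] := pselect (B x); first exact: restr_in.
by rewrite restr_out// sf.
Qed.

Lemma norm_restr_le B f x : `|restr B f x| <= `|f x|.
Proof.
have [Bx|nB] := pselect (B x); first by rewrite restr_in.
by rewrite restr_out// normr0.
Qed.

Lemma CZdec0 N (lam : R) : 0 < lam -> CZdec N lam set0 (fun=> 0).
Proof.
move=> lam0; exists (fun=> 0), (fun=> 0), (fun=> 0).
have f0 : (0 <= fint q (fun x : T => `|0 : R|%R))%E by exact: fint_ge0.
split=> //.
- by move=> x; rewrite normr0 mulr_ge0// ltW.
- by rewrite fint0; split; apply: mule_ge0 => //; rewrite lee_fin ?divr_ge0 ?mulr_ge0// ltW.
- by move=> x _; rewrite psumB subrr normr0.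
Qed.

Lemma fint_disjointD B1 B2 f1 f2 : B1 `&` B2 = set0 ->
  supported B1 f1 -> supported B2 f2 ->
  fint q (fun x => `|f1 x + f2 x|) =
  (fint q (fun x => `|f1 x|)%R + fint q (fun x => `|f2 x|)%R)%E.
Proof.
move=> B12 s1 s2; rewrite -fintD//; apply: eq_fint => x.
have [Bx|nB] := pselect (B1 x); last by rewrite (s1 x)// normr0 !add0r.
rewrite (s2 x) ?normr0 ?addr0// => B2x.
by have : (B1 `&` B2) x by []; rewrite B12.
Qed.

Lemma CZdecU N (lam : R) B1 B2 f1 f2 : 0 < lam -> B1 `&` B2 = set0 ->
  supported B1 f1 -> supported B2 f2 ->
  CZdec N lam B1 f1 -> CZdec N lam B2 f2 ->
  CZdec N lam (B1 `|` B2) (fun x => f1 x + f2 x).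
Proof.
move=> lam0 B12 s1 s2.
move=> [g1 [om1 [v1 [[om10 v10 sg1] g1l g1f [om1f v1f] S1]]]].
move=> [g2 [om2 [v2 [[om20 v20 sg2] g2l g2f [om2f v2f] S2]]]].
have cst c (F F1 F2 : T -> R) : 0 <= c -> (forall x, 0 <= F1 x) -> (forall x, 0 <= F2 x) ->
    F = (fun x => F1 x + F2 x) ->
    (fint q F1 <= c%:E * fint q (fun x => `|f1 x|)%R)%E ->
    (fint q F2 <= c%:E * fint q (fun x => `|f2 x|)%R)%E ->
    (fint q F <= c%:E * fint q (fun x => `|f1 x + f2 x|)%R)%E.
  move=> c0 F10 F20 -> h1 h2; rewrite fintD// (fint_disjointD B12)//.
  by rewrite ge0_muleDr ?fint_ge0//; exact: leeD.
exists (fun x => g1 x + g2 x), (fun x => om1 x + om2 x), (fun x => v1 x + v2 x).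
split.
- split=> x; rewrite ?addr_ge0// => nB; rewrite sg1 ?sg2 ?addr0// => Bx; apply: nB;
    first [by left|by right].
- move=> x; have [Bx|nB] := pselect (B1 x); last by rewrite (sg1 x)// add0r.
  rewrite (sg2 x) ?addr0// => B2x.
  by have : (B1 `&` B2) x by []; rewrite B12.
- rewrite -[leRHS]mul1e; apply: (cst 1 _ (fun x => `|g1 x|) (fun x => `|g2 x|)) => //.
  + apply/funext => x; have [Bx|nB] := pselect (B1 x).
      rewrite (sg2 x) ?normr0 ?addr0// => B2x.
      by have : (B1 `&` B2) x by []; rewrite B12.
    by rewrite (sg1 x)// normr0 !add0r.
  + by rewrite mul1e.
  + by rewrite mul1e.
- split.
    by apply: (cst _ _ om1 om2) => //; rewrite divr_ge0// ltW.
  by apply: (cst _ _ v1 v2) => //; rewrite !mulr_ge0// ltW.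
- move=> x om12; have [l1 l2] : om1 x < 1 /\ om2 x < 1.
    by have := om10 x; have := om20 x; split; lra.
  have -> : (fun y => f1 y + f2 y - (g1 y + g2 y)) =
      (fun y => (f1 y - g1 y) - (- (f2 y - g2 y))).
    by apply/funext => y; ring.
  rewrite psumB; apply: le_trans (ler_normB _ _) _; apply: lerD; first exact: S1.
  have -> : (fun y => - (f2 y - g2 y)) = (fun y => (g2 y - g2 y) - (f2 y - g2 y)).
    by apply/funext => y; ring.
  by rewrite psumB psumB subrr sub0r normrN; exact: S2.
Qed.

(** Decompositions on disjoint sets add up. *)
Lemma CZdec_seq N (lam : R) (I : eqType) (l : seq I) (B : I -> set T) f : 0 < lam ->
  uniq l -> {in l &, forall i j, i != j -> B i `&` B j = set0} ->
  (forall i, i \in l -> CZdec N lam (B i) (restr (B i) f)) ->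
  CZdec N lam [set y | exists2 i, i \in l & B i y]
    (restr [set y | exists2 i, i \in l & B i y] f).
Proof.
move=> lam0; elim: l => [_ _ _|i l IH /= /andP[il ul] tB H].
  rewrite (_ : [set y | _] = set0); last by rewrite -subset0 => y [].
  rewrite (_ : restr _ _ = (fun=> 0)); first exact: CZdec0.
  by apply/funext => x; rewrite restr_out.
have {}IH := IH ul _ _.
set U := [set y | exists2 i, i \in l & B i y] in IH *.
have -> : [set y | exists2 j, j \in i :: l & B j y] = B i `|` U.
  apply/seteqP; split=> y /=.
    by move=> [j]; rewrite inE => /orP[/eqP ->|jl Bj]; [left|right; exists j].
  move=> [Bi|[j jl Bj]]; first by exists i; rewrite ?mem_head.
  by exists j; rewrite ?inE ?jl ?orbT.
have BU : B i `&` U = set0.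
  rewrite -subset0 => y [Bi [j jl Bj]].
  have ij : i != j by apply: contraNneq il => ->.
  have : (B i `&` B j) y by [].
  by rewrite tB// ?inE ?eqxx ?jl ?orbT.
have -> : restr (B i `|` U) f = (fun x => restr (B i) f x + restr U f x).
  apply/funext => x; have [Bx|nB] := pselect (B i x).
    have nU : ~ U x by move=> Ux; have : (B i `&` U) x by []; rewrite BU.
    by rewrite (restr_in f Bx) (restr_out f nU) addr0 restr_in//; left.
  have [Ux|nU] := pselect (U x).
    by rewrite (restr_out f nB) (restr_in f Ux) add0r restr_in//; right.
  by rewrite (restr_out f nB) (restr_out f nU) addr0 restr_out// => -[].
apply: (CZdecU lam0 BU).
- by move=> y; exact: restr_out.
- by move=> y; exact: restr_out.
- by apply: H; rewrite mem_head.
- apply: IH.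
  + by move=> j k jl kl; apply: tB; rewrite inE ?jl ?kl orbT.
  + by move=> j jl; apply: H; rewrite inE jl orbT.
Qed.

Lemma trapezoid_root x0 h L : trapezoid x0 h.+1 L =
  [set z | exists2 y, y \in children x0 & trapezoid y h L z].
Proof.
apply/seteqP; split=> z /=.
  move=> [[|k] hk kz]; first by rewrite ltn0 in hk.
  exists (iter k par z); first by rewrite (mem_children hT hray) -kz.
  by exists k.
move=> [y /(child_par hT hray) yx [k hk kz]]; exists k.+1 => //.
by rewrite /= kz.
Qed.

Lemma trapezoid_time x0 h L L' : trapezoid x0 h (L + L') =
  trapezoid x0 h L `|` trapezoid x0 (h + L) L'.
Proof.
apply/seteqP; split=> z /=.
  move=> [k hk kz]; have [kL|kL] := ltnP k (h + L); [left|right]; exists k => //; lia.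
by move=> [[k hk kz]|[k hk kz]]; exists k => //; lia.
Qed.

(** The alternative of the stopping argument for a piece of a trapezoid whose
    mean is at most lam: its own mean is at most q lam; stop if it exceeds
    lam, otherwise go on. *)
Lemma CZ_child N (lam : R) x0 h L f : 0 < lam -> (0 < L)%N ->
  (L <= h.+1)%N -> (h + L <= 4 * L)%N -> supported (trapezoid x0 h L) f ->
  (fint q (fun x => `|f x|)%R <= (q%:R * lam * (mass R q x0 * L%:R))%:E)%E ->
  ((fint q (fun x => `|f x|)%R <= (lam * (mass R q x0 * L%:R))%:E)%E ->
     CZdec N lam (trapezoid x0 h L) f) ->
  CZdec N lam (trapezoid x0 h L) f.
Proof.
move=> lam0 L0 Lh hL sf fq H.
have [/H//|/ltW fl] := leP (fint q (fun x => `|f x|)) (lam * (mass R q x0 * L%:R))%:E.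
exact: (CZ_stop hT hray q0 epsM a0' a_dec aK N lam0 K0 L0 Lh hL sf fl fq).
Qed.

(** A trapezoid with a single vertex is left undecomposed. *)
Lemma CZ_single N (lam : R) x0 f : 0 < lam -> supported (trapezoid x0 0 1) f ->
  (fint q (fun x => `|f x|)%R <= (lam * mass R q x0)%:E)%E ->
  CZdec N lam (trapezoid x0 0 1) f.
Proof.
move=> lam0 sf hf; have m0 : 0 < mass R q x0 by exact: mass_gt0.
have fx : `|f x0| <= lam.
  have := le_trans (fint_point q x0 (fun y => normr_ge0 (f y))) hf.
  by rewrite lee_fin mulrC ler_pM2r.
have f0 : (0 <= fint q (fun x => `|f x|%R))%E by exact: fint_ge0.
exists f, (fun=> 0), (fun=> 0); split=> //.
- move=> x; have [->|xx] := eqVneq x x0.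
    by apply: le_trans fx _; rewrite ler_peMl ?ler1n// ltW.
  rewrite sf ?normr0 ?mulr_ge0 ?(ltW lam0)// => -[[|k]]//= _ e.
  by rewrite e eqxx in xx.
- by rewrite fint0; split; apply: mule_ge0 => //; rewrite lee_fin ?divr_ge0 ?mulr_ge0// ltW.
- move=> x _; rewrite psumB subrr normr0//.
Qed.

Lemma fint_restr_le B f : (fint q (fun x => `|restr B f x|)%R <= fint q (fun x => `|f x|)%R)%E.
Proof. by apply: le_fint => x; [exact: normr_ge0|exact: norm_restr_le]. Qed.

(** Cutting along the successors of the root multiplies the mean by at most q. *)
Lemma CZ_root N (lam : R) x0 h L f : 0 < lam -> (0 < L)%N ->
  (L <= h.+1)%N -> (h + L <= 4 * L)%N -> supported (trapezoid x0 h.+1 L) f ->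
  (fint q (fun x => `|f x|)%R <= (lam * (mass R q x0 * L%:R))%:E)%E ->
  (forall y g, supported (trapezoid y h L) g ->
     (fint q (fun x => `|g x|)%R <= (lam * (mass R q y * L%:R))%:E)%E ->
     CZdec N lam (trapezoid y h L) g) ->
  CZdec N lam (trapezoid x0 h.+1 L) f.
Proof.
move=> lam0 L0 Lh hL sf hf H; rewrite -(restr_id sf) trapezoid_root.
apply: CZdec_seq => //; first exact: children_uniq.
  move=> y y' /(child_par hT hray) yx /(child_par hT hray) yx' yy'.
  rewrite -subset0 => z [[k _ kz] [k' _ kz']].
  have := level_iter hT hray q0 k z; have := level_iter hT hray q0 k' z.
  have := congr1 (@level T) yx; have := congr1 (@level T) yx'.
  rewrite !(level_predecessor hT hray) kz kz' => e1 e2 e3 e4.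
  move/eqP: yy'; apply; rewrite -kz -kz'; congr (iter _ _ _).
  clear -e1 e2 e3 e4; lia.
move=> y yx; have sr : supported (trapezoid y h L) (restr (trapezoid y h L) f).
  by move=> z; exact: restr_out.
apply: (CZ_child lam0 L0 Lh hL sr _ (H y _ sr)).
apply: le_trans (fint_restr_le _ _) (le_trans hf _).
rewrite -(child_par hT hray yx) (mass_par R hT hray q0) lee_fin.
by rewrite le_eqVlt; apply/orP; left; apply/eqP; ring.
Qed.

(** Cutting the generations into halves multiplies the mean by at most 2 <= q. *)
Lemma CZ_time N (lam : R) x0 h L f : 0 < lam -> (0 < L)%N ->
  (L <= h.+1)%N -> (h + L + L <= 4 * L)%N -> supported (trapezoid x0 h (L + L)) f ->
  (fint q (fun x => `|f x|)%R <= (lam * (mass R q x0 * (L + L)%:R))%:E)%E ->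
  (forall h' g, (h' = h \/ h' = h + L)%N -> supported (trapezoid x0 h' L) g ->
     (fint q (fun x => `|g x|)%R <= (lam * (mass R q x0 * L%:R))%:E)%E ->
     CZdec N lam (trapezoid x0 h' L) g) ->
  CZdec N lam (trapezoid x0 h (L + L)) f.
Proof.
move=> lam0 L0 Lh hL sf hf H.
have m0 : 0 < mass R q x0 by exact: mass_gt0.
pose Bb (i : bool) := trapezoid x0 (if i then h else h + L)%N L.
have BE : trapezoid x0 h (L + L) =
    [set y | exists2 i, i \in [:: true; false] & Bb i y].
  rewrite trapezoid_time; apply/seteqP; split=> y /=.
    by move=> [y1|y2]; [exists true|exists false].
  by move=> [[] _]; [left|right].
rewrite -(restr_id sf) BE; apply: CZdec_seq => //.
  have tr : Bb true `&` Bb false = set0.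
    rewrite -subset0 => z [[k hk kz] [k' hk' kz']].
    have := level_iter hT hray q0 k z; have := level_iter hT hray q0 k' z.
    rewrite kz kz' => e1 e2.
    by move: hk hk' => /=; clear -e1 e2; lia.
  by move=> [] [] _ _ // _; rewrite setIC.
move=> i _; have sr : supported (Bb i) (restr (Bb i) f).
  by move=> z; exact: restr_out.
apply: (CZ_child lam0 L0 _ _ sr).
- by clear -Lh; case: i; lia.
- by clear -hL; case: i; lia.
- apply: le_trans (fint_restr_le _ _) (le_trans hf _); rewrite lee_fin.
  rewrite natrD -mulrA [q%:R * _]mulrC -mulrA ler_pM2l// -mulrA ler_pM2l//.
  have : (2 : R) <= q%:R by rewrite (ler_nat _ 2).
  have : (0 : R) < L%:R by rewrite ltr0n.
  by nra.
- by apply: H => //; case: (i); [left|right].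
Qed.

(** Trapezoids of height 2 ^ j are cut along the root until h = 2 ^ j, and then
    into two of half that height, for which h is 2 or 3 times the height.
    Either way the shape conditions of [CZ_stop] persist. *)
Lemma CZ_rec N (lam : R) j h x0 f : 0 < lam -> (2 ^ j <= h <= 3 * 2 ^ j)%N ->
  supported (trapezoid x0 h (2 ^ j)) f ->
  (fint q (fun x => `|f x|)%R <= (lam * (mass R q x0 * (2 ^ j)%:R))%:E)%E ->
  CZdec N lam (trapezoid x0 h (2 ^ j)) f.
Proof.
move=> lam0; elim: j h x0 f => [|j IHj] h x0 f.
  rewrite expn0 => /andP[h1 h3]; case: h h1 h3 => // h _.
  elim: h x0 f => [|h IHh] x0 f h3 sf hf.
    apply: CZ_root => // y g sg hg; apply: CZ_single => //.
    by move: hg; rewrite mulr1.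
  apply: CZ_root => //; first by clear -h3; lia.
  by move=> y g; apply: IHh; exact: ltnW.
have L0 : (0 < 2 ^ j)%N by rewrite expn_gt0.
rewrite expnS mul2n -addnn; move: (2 ^ j)%N L0 IHj => L L0 IHj /andP[].
elim: h x0 f => [|h IHh] x0 f h1 h3 sf hf.
  by exfalso; clear -L0 h1; lia.
have [e|hL] := eqVneq h.+1 (L + L)%N.
  apply: CZ_time => //; [by clear -e; lia|by clear -e; lia|].
  move=> h' g hh' sg hg; apply: IHj => //.
  by clear -hh' e; lia.
apply: CZ_root => //.
- by clear -L0; lia.
- by clear -h3; lia.
- by move=> y g; apply: IHh; clear -h1 h3 hL; lia.
Qed.

(** The level set splits into three: where g contributes lam / 2, by
    Chebyshev's inequality and the L^2 bound; the exceptional set; and where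
    the majorant v of the remaining part is at least lam / 2. *)
Lemma weak_trapezoid : exists2 C, 0 < C & forall N (lam : R) j x0 f, 0 < lam ->
  supported (trapezoid x0 (2 ^ j) (2 ^ j)) f ->
  (fint q (fun x => `|f x|)%R <= (lam * (mass R q x0 * (2 ^ j)%:R))%:E)%E ->
  (fint q (\1_[set x | lam < `|psum N f x|]%R : T -> R) <=
    (C / lam)%:E * fint q (fun x => `|f x|)%R)%E.
Proof.
have a0K n : 0 < a n <= K / n.+1%:R by rewrite a0 aK.
have two1 : 1 < 2 :> R by rewrite ltr1n.
have [C2 C20 hC2] := psum_Lp hT hray q0 epsM eps0 two1 K0 a0K.
have KM0 : 0 <= 2 * (2 * M * K) by rewrite !mulr_ge0// ltW.
have Cq0 : 0 <= 4 * C2 * q%:R by rewrite !mulr_ge0.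
exists (4 * C2 * q%:R + 4 + 2 * (2 * M * K)).
  by rewrite ltr_wpDr// ltr_wpDl.
move=> N lam j x0 f lam0 sf hf; have lamN := gt_eqF lam0.
have hj : (2 ^ j <= 2 ^ j <= 3 * 2 ^ j)%N by rewrite leqnn leq_pmull.
have [g [om [v [[om0 v0 sg] gl gf [omf vf] Sb]]]] := CZ_rec N lam0 hj sf hf.
have pt x : (\1_[set x | lam < `|psum N f x|] x : R) <=
    4 / lam ^+ 2 * `|psum N g x| `^ 2 + (om x + 2 / lam * v x).
  rewrite powR_mulrn// indicE; have [/set_mem/= hx|_] := boolP (x \in _); last first.
    by rewrite !addr_ge0 ?mulr_ge0 ?invr_ge0 ?exprn_ge0 ?(ltW lam0).
  have t1 : 0 <= 4 / lam ^+ 2 * `|psum N g x| ^+ 2.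
    by rewrite mulr_ge0 ?exprn_ge0// divr_ge0// exprn_ge0// ltW.
  have t3 : 0 <= 2 / lam * v x by rewrite mulr_ge0// divr_ge0// ltW.
  have t2 := om0 x.
  have [om1|om1] := leP 1 (om x); first by rewrite /=; lra.
  have := Sb x om1 => Sv.
  have [vl|vl] := leP (lam / 2) (v x).
    suff : 1 <= 2 / lam * v x by rewrite /=; lra.
    by rewrite mulrAC ler_pdivlMr// mul1r; lra.
  have gl2 : lam / 2 < `|psum N g x|.
    move: Sv; rewrite psumB => Sv.
    have := ler_normD (psum N f x - psum N g x) (psum N g x); rewrite subrK.
    by lra.
  suff : 1 <= 4 / lam ^+ 2 * `|psum N g x| ^+ 2 by rewrite /=; lra.
  rewrite mulrAC ler_pdivlMr ?exprn_gt0// mul1r.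
  by nra.
have ind0 (x : T) : 0 <= \1_[set x | lam < `|psum N f x|] x :> R by rewrite indicE.
apply: (le_trans (le_fint q ind0 pt)).
have c1 : 0 <= 4 / lam ^+ 2 by rewrite divr_ge0// exprn_ge0// ltW.
have c2 : 0 <= 2 / lam by rewrite divr_ge0// ltW.
have p1 (x : T) : 0 <= `|psum N g x| `^ 2 by exact: powR_ge0.
rewrite fintD; last 2 first.
- by move=> x; rewrite mulr_ge0.
- by move=> x; apply: addr_ge0 => //; exact: mulr_ge0.
rewrite fintZ// fintD//; last by move=> x; exact: mulr_ge0.
rewrite fintZ//.
set I := fint q (fun x => `|f x|).
have I0 : (0 <= I)%E by exact: fint_ge0.
have -> : (4 * C2 * q%:R + 4 + 2 * (2 * M * K)) / lam =
    4 / lam ^+ 2 * (C2 * (q%:R * lam)) + (4 / lam + 2 / lam * (2 * M * K)).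
  by field; rewrite lamN.
have d1 : 0 <= 4 / lam by rewrite divr_ge0// ltW.
have d2 : 0 <= 2 * M * K by rewrite !mulr_ge0// ltW.
have d3 : 0 <= q%:R * lam by rewrite mulr_ge0// ltW.
have d4 : 0 <= 2 / lam * (2 * M * K) by exact: mulr_ge0.
have d5 : 0 <= 4 / lam + 2 / lam * (2 * M * K) by exact: addr_ge0.
have d6 : 0 <= 4 / lam ^+ 2 * (C2 * (q%:R * lam)) by apply: mulr_ge0 => //; exact: mulr_ge0.
rewrite EFinD ge0_muleDl ?lee_fin//.
rewrite [X in (_ <= _ + X * _)%E]EFinD ge0_muleDl ?lee_fin//.
apply: leeD; last first.
  apply: leeD => //; rewrite [X in (_ <= X * _)%E]EFinM -muleA; apply: lee_wpmul2l => //.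
rewrite [X in (_ <= X * _)%E]EFinM -muleA; apply: lee_wpmul2l; first by rewrite lee_fin.
apply: le_trans (hC2 N g) _; rewrite [X in (_ <= X * _)%E]EFinM -muleA; apply: lee_wpmul2l.
  by rewrite lee_fin.
apply: (@le_trans _ _ ((q%:R * lam)%:E * fint q (fun x => `|g x|)%R)%E); last first.
  by apply: lee_wpmul2l => //; rewrite lee_fin.
rewrite -fintZ//; apply: le_fint => x; first exact: powR_ge0.
by rewrite powR_mulrn// expr2 ler_wpM2r.
Qed.

(** The value at a vertex only depends on finitely many generations below it,
    hence any function may be cut off to a large trapezoid whose root is on the
    ray, large enough for the mean over it to be at most lam. *)
Lemma weak_psum : exists2 C, 0 < C & forall N (lam : R) f, 0 < lam ->
  (fint q (\1_[set x | lam < `|psum N f x|]%R : T -> R) <=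
    (C / lam)%:E * fint q (fun x => `|f x|)%R)%E.
Proof.
have [C C0 hC] := weak_trapezoid; exists C => // N lam f lam0.
have Cl : 0 < C / lam by rewrite divr_gt0.
have I0 : (0 <= fint q (fun x => `|f x|)%R)%E by exact: fint_ge0.
have [fin|inf] := ltP (fint q (fun x => `|f x|)) +oo%E; last first.
  by move: inf; rewrite leye_eq => /eqP ->; rewrite gt0_muley ?lte_fin// leey.
apply: fint_le => [x|s us]; first by rewrite indicE.
have [If hIf] : exists I, fint q (fun x => `|f x|) = I%:E.
  by exists (fine (fint q (fun x => `|f x|))); rewrite fineK// ge0_fin_numE.
have [j hj] : exists j, [/\ (1 <= j)%N, If <= lam * (2 ^ j)%:R &
   forall x n z, x \in s -> (n <= N)%N -> iter n par z = x ->
     trapezoid (ray T (2 ^ j + 2 ^ j.-1)) (2 ^ j) (2 ^ j) z].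
  have [J hJ] : exists J, forall x, x \in s ->
      [/\ (absz (level x) <= J)%N & forall n, (J <= n)%N ->
        exists2 k, k%:Z = n%:Z - level x & iter k par x = ray T n].
    elim: s {us} => [|x s [J hJ]]; first by exists 0%N.
    have [m hm] := ray_ancestor hT hray x.
    exists (maxn J (maxn m (absz (level x)))) => y; rewrite inE => /orP[/eqP ->|/hJ[y1 y2]].
      rewrite !leq_max leqnn !orbT; split=> // n.
      by rewrite !geq_max => /and3P[_ mn _]; exact: hm.
    rewrite leq_max y1; split=> // n; rewrite geq_max => /andP[Jn _]; exact: y2.
  (* The height makes the mean at most lam; the level of the root, 3/2 times the
     height, puts the N generations below s into the trapezoid. *)
  pose D := Num.bound (If / lam).
  exists (J + N + D).+2; split=> //.
    rewrite mulrC -ler_pdivrMr//; apply: (@le_trans _ _ D%:R).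
      have : 0 <= If / lam by rewrite divr_ge0 ?(ltW lam0)// -lee_fin -hIf.
      by move=> /archi_boundP/ltW.
    rewrite ler_nat; apply: leq_trans (ltnW (ltn_expl _ _)) => //.
    by clear; lia.
  move=> x n z xs nN zx; have [xJ /(_ (2 ^ (J + N + D).+2 + 2 ^ (J + N + D).+1)%N)] := hJ x xs.
  have e : (J + N < 2 ^ (J + N + D).+1)%N.
    by apply: leq_trans (ltnW (ltn_expl _ _)) => //; clear; lia.
  rewrite -[X in trapezoid (ray T (_ + 2 ^ X))]/(J + N + D).+1.
  rewrite expnS mul2n -addnn; move: (2 ^ (J + N + D).+1)%N e => P e.
  have -> : (J <= P + P + P)%N by clear -e; lia.
  move=> /(_ isT)[k kE kx]; exists (k + n)%N; last by rewrite iterD zx.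
  by clear -kE e xJ nN; lia.
move: hj => [j1 jI jt].
set x0 := ray T _ in jt; set B := trapezoid _ _ _ in jt.
have mx0 : 1 <= mass R q x0.
  rewrite /mass /x0 (level_ray hT hray) -exprnP exprn_ege1// ler1n//.
have sB : supported B (restr B f) by move=> z; exact: restr_out.
have fB : (fint q (fun x => `|restr B f x|)%R <= (lam * (mass R q x0 * (2 ^ j)%:R))%:E)%E.
  apply: le_trans (fint_restr_le _ _) _; rewrite hIf lee_fin; apply: le_trans jI _.
  by rewrite ler_pM2l// ler_peMl.
apply: (@le_trans _ _ ((C / lam)%:E * fint q (fun x => `|restr B f x|)%R)%E); last first.
  by apply: lee_wpmul2l; [rewrite lee_fin ltW|exact: fint_restr_le].
apply: le_trans (hC N lam j x0 _ lam0 sB fB).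
apply: le_trans (fint_fin q _ us); last by move=> x; rewrite indicE.
rewrite lee_fin le_eqVlt; apply/orP; left; apply/eqP/eq_big_seq => x xs.
have e : psum N f x = psum N (restr B f) x.
  apply: (psum_local hT hray) => n z nN zx; rewrite restr_in//.
  exact: (jt x n z).
congr (_ * _); rewrite !indicE; congr (nat_of_bool _)%:R.
by apply/idP/idP => /set_mem/= h; apply/mem_set; rewrite /= ?e// -?e.
Qed.

End weak_type_recursion.

(** * Chebyshev expansion of the inverse square root *)

Section chebyshev.
Variable R : realType.
Implicit Types (t x phi : R).

(** [cheb n (2 * sin phi ^ 2)] is sin ((2 n + 1) phi) / sin phi. *)
Fixpoint cheb (n : nat) t : R :=
  match n with
  | 0 => 1
  | m.+1 => match m with
            | 0 => 3 - 2 * t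
            | k.+1 => 2 * (1 - t) * cheb m t - cheb k t
            end
  end.

Lemma chebSS n t : cheb n.+2 t = 2 * (1 - t) * cheb n.+1 t - cheb n t.
Proof. by []. Qed.

Definition odc (n : nat) : R := 2 * n%:R + 1.

Lemma odc_gt0 n : 0 < odc n.
Proof. by rewrite ltr_wpDl. Qed.

Lemma cheb_sin n phi : cheb n (2 * sin phi ^+ 2) * sin phi = sin (odc n * phi).
Proof.
have c2 : 1 - 2 * sin phi ^+ 2 = cos (2 * phi).
  rewrite (_ : 2 * phi = phi + phi); last by rewrite mulr2n mulrDl mul1r.
  by rewrite cosD -!expr2 cos2sin2; ring.
suff [] : cheb n (2 * sin phi ^+ 2) * sin phi = sin (odc n * phi) /\
  cheb n.+1 (2 * sin phi ^+ 2) * sin phi = sin (odc n.+1 * phi) by [].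
elim: n => [|n [IH1 IH2]].
  split; first by rewrite /odc mulr0 add0r !mul1r.
  rewrite (_ : odc 1 * phi = 2 * phi + phi); last by rewrite /odc; ring.
  rewrite sinD -c2 (_ : 2 * phi = phi + phi); last by rewrite mulr2n mulrDl mul1r.
  rewrite sinD /=; have := cos2Dsin2 phi; set s := sin phi; set c := cos phi => e.
  have -> : (s * c + c * s) * c = 2 * s * c ^+ 2 by ring.
  have -> : c ^+ 2 = 1 - s ^+ 2 by rewrite -e; ring.
  by ring.
split=> //; rewrite chebSS mulrBl -(mulrA (2 * _)) IH1 IH2 c2.
have e1 : odc n.+2 * phi = odc n.+1 * phi + 2 * phi.
  by rewrite /odc [n.+2%:R]mulrS; ring.
have e2 : odc n * phi = odc n.+1 * phi - 2 * phi.
  by rewrite /odc [n.+1%:R]mulrS; ring.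
by rewrite e1 e2 !sinD sinN cosN; ring.
Qed.

Lemma cheb0 n : cheb n 0 = odc n.
Proof.
suff [] : cheb n 0 = odc n /\ cheb n.+1 0 = odc n.+1 by [].
elim: n => [|n [IH1 IH2]]; first by rewrite /odc /=; split; ring.
by split=> //; rewrite chebSS IH1 IH2 /odc [n.+2%:R]mulrS [n.+1%:R]mulrS; ring.
Qed.

(** Partial sum of the Fourier series of a square wave. *)
Definition sqwave N phi := \sum_(n < N) 2 / odc n * sin (odc n * phi).

Definition dsqwave N phi := \sum_(n < N) 2 * cos (odc n * phi).

Lemma is_derive_lin (k x : R) : is_derive x 1 (fun y => k * y) k.
Proof.
have -> : (fun y => k * y) = k \*: (@id R) by [].
by apply: is_derive_eq; rewrite /GRing.scale/= mulr1.
Qed.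

Lemma is_derive_sinlin (k x : R) : is_derive x 1 (fun y => sin (k * y)) (k * cos (k * x)).
Proof.
rewrite mulrC.
exact: (is_derive1_comp (is_derive_sin (k * x)) (is_derive_lin k x)).
Qed.

Lemma is_derive_coslin (k x : R) : is_derive x 1 (fun y => cos (k * y)) (- (k * sin (k * x))).
Proof.
rewrite mulrC -mulNr.
exact: (is_derive1_comp (is_derive_cos (k * x)) (is_derive_lin k x)).
Qed.

Lemma is_derive_sqwave N x : is_derive x 1 (sqwave N) (dsqwave N x).
Proof.
elim: N => [|N IH].
  have -> : sqwave 0 = cst 0 by apply/funext => y; rewrite /sqwave big_ord0.
  by rewrite /dsqwave big_ord0; exact: is_derive_cst.
have -> : sqwave N.+1 = sqwave N + (2 / odc N \*: (fun y => sin (odc N * y))).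
  by apply/funext => y; rewrite /sqwave big_ord_recr.
rewrite /dsqwave big_ord_recr/=; apply: is_deriveD.
have h := is_derive_sinlin (odc N) x.
apply: is_derive_eq; rewrite /GRing.scale/=; field.
by rewrite gt_eqF ?odc_gt0.
Qed.

Lemma dsqwave_sin N x : sin x * dsqwave N x = sin (2 * N%:R * x).
Proof.
elim: N => [|N IH]; first by rewrite /dsqwave big_ord0 !mulr0 mul0r sin0.
rewrite /dsqwave big_ord_recr/= mulrDr -/(dsqwave N x) IH.
have -> : 2 * N%:R * x = odc N * x - x by rewrite /odc; ring.
have -> : 2 * N.+1%:R * x = odc N * x + x by rewrite /odc -natr1; ring.
by rewrite !sinD sinN cosN; ring.
Qed.

(** The correction makes the derivative of order 1 / N on compact subsets of
    ]0, pi[, as one integration by parts of the Dirichlet kernel would. *)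
Definition corr N x := sqwave N x + (2 * N%:R)^-1 * (cos (2 * N%:R * x) * (sin x)^-1).

Lemma is_derive_corr N x : (0 < N)%N -> sin x != 0 -> is_derive x 1 (corr N)
  (- (2 * N%:R)^-1 * (cos (2 * N%:R * x) * cos x / sin x ^+ 2)).
Proof.
move=> N0 sx; have k0 : 2 * N%:R != 0 :> R by rewrite mulf_neq0 ?pnatr_eq0 -?lt0n.
have h1 := is_derive_sqwave N x.
have h2 := is_derive_coslin (2 * N%:R) x.
have h3 : is_derive x 1 (fun y : R => (sin y)^-1) (- sin x ^- 2 *: cos x).
  exact: is_deriveV.
have -> : corr N = sqwave N + ((2 * N%:R)^-1 \*: ((fun y => cos (2 * N%:R * y)) * (fun y : R => (sin y)^-1))).
  by [].
apply: is_derive_eq; rewrite /GRing.scale/=.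
have -> : dsqwave N x = sin (2 * N%:R * x) / sin x.
  by rewrite -dsqwave_sin mulrAC divff// mul1r.
have NR : N%:R != 0 :> R by rewrite pnatr_eq0 -lt0n.
by field; rewrite sx NR.
Qed.

(** The mean value theorem for [corr N], whose distance to [sqwave N] is also
    of order 1 / N. *)
Lemma sqwave_dist phi : 0 < phi <= pi / 2 ->
  exists C, forall N, (0 < N)%N ->
    `|sqwave N phi - sqwave N (pi / 2)| <= C / N%:R.
Proof.
move=> /andP[p0 p1]; have pi0 := @pi_gt0 R.
have s0 : 0 < sin phi by apply: sin_gt0_pi; rewrite p0/=; lra.
have sx x : phi <= x <= pi / 2 -> sin phi <= sin x.
  move=> /andP[x0 x1]; have [->//|px] := eqVneq phi x.
  rewrite ltW// ltr_sin ?in_itv/= ?lt_neqAle ?px//; apply/andP; split; lra.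
exists (2^-1 * (sin phi ^- 2 * (pi / 2 - phi)) + (sin phi)^-1) => N N0.
have NR : 0 < N%:R :> R by rewrite ltr0n.
have [->|pn] := eqVneq phi (pi / 2).
  rewrite !subrr normr0 !mulr0 add0r sin_pihalf invr1 mul1r invr_ge0.
  exact: ltW.
have plt : phi < pi / 2 by rewrite lt_neqAle pn.
pose dc x := - (2 * N%:R)^-1 * (cos (2 * N%:R * x) * cos x / sin x ^+ 2).
have dG x : x \in `[phi, pi / 2] -> is_derive x 1 (corr N) (dc x).
  rewrite in_itv => hx; apply: is_derive_corr => //.
  by rewrite gt_eqF// (lt_le_trans s0)// sx.
have d1 x : x \in `]phi, pi / 2[ -> is_derive x 1 (corr N) (dc x).
  by rewrite in_itv/= => /andP[x1 x2]; apply: dG; rewrite in_itv/= !ltW.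
have d2 : {within `[phi, pi / 2], continuous (corr N)}.
  by apply: derivable_within_continuous => x /dG[].
have [x xI e] := MVT plt d1 d2.
have xI' : phi <= x <= pi / 2 by move: xI; rewrite in_itv/= => /andP[/ltW -> /ltW ->].
have hc y : phi <= y <= pi / 2 ->
    `|sqwave N y - corr N y| <= (2 * N%:R)^-1 * (sin phi)^-1.
  move=> hy; rewrite /corr opprD addrA subrr add0r normrN normrM.
  have k0 : 0 <= (2 * N%:R)^-1 :> R by rewrite invr_ge0 mulr_ge0// ltW.
  rewrite (ger0_norm k0) ler_wpM2l// normrM -[leRHS]mul1r; apply: ler_pM => //.
    exact: cos_max.
  have sy := lt_le_trans s0 (sx y hy).
  by rewrite gtr0_norm ?invr_gt0// lef_pV2 ?posrE// sx.
have hD : `|dc x| <= (2 * N%:R)^-1 * sin phi ^- 2.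
  have k0 : 0 <= (2 * N%:R)^-1 :> R by rewrite invr_ge0 mulr_ge0// ltW.
  rewrite /dc normrM normrN (ger0_norm k0) ler_wpM2l//.
  rewrite !normrM -[leRHS]mul1r; apply: ler_pM => //.
    rewrite -[leRHS]mul1r; apply: ler_pM => //; exact: cos_max.
  have sy := lt_le_trans s0 (sx x xI').
  rewrite gtr0_norm ?invr_gt0 ?exprn_gt0// lef_pV2 ?posrE ?exprn_gt0//.
  by rewrite ler_pXn2r ?nnegrE ?(ltW s0) ?(ltW sy)// sx.
have h1 := hc phi; have h2 := hc (pi / 2).
have -> : sqwave N phi - sqwave N (pi / 2) =
  (sqwave N phi - corr N phi) - (sqwave N (pi / 2) - corr N (pi / 2)) - (corr N (pi / 2) - corr N phi).
  by ring.
rewrite e; apply: le_trans (ler_normB _ _) _.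
rewrite [leRHS]mulrDl [leRHS]addrC; apply: lerD; last first.
  rewrite normrM [ `|pi / 2 - phi|]ger0_norm ?subr_ge0//.
  have -> : 2^-1 * (sin phi ^- 2 * (pi / 2 - phi)) / N%:R =
     (2 * N%:R)^-1 * sin phi ^- 2 * (pi / 2 - phi).
    by field; rewrite !gt_eqF.
  by rewrite ler_wpM2r// subr_ge0.
apply: le_trans (ler_normB _ _) _.
have -> : (sin phi)^-1 / N%:R = (2 * N%:R)^-1 * (sin phi)^-1 + (2 * N%:R)^-1 * (sin phi)^-1.
  by field; rewrite !gt_eqF.
apply: lerD; [apply: h1|apply: h2]; rewrite ?lexx ?p1//.
Qed.

Lemma sin_odc n : sin (odc n * (pi / 2)) = (-1) ^+ n :> R.
Proof.
elim: n => [|n IH]; first by rewrite /odc mulr0 add0r mul1r sin_pihalf.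
have -> : odc n.+1 * (pi / 2) = odc n * (pi / 2) + pi :> R.
  by rewrite /odc -natr1; field.
by rewrite sinDpi IH exprS mulN1r.
Qed.

Lemma odc_inv_cvg0 : (fun n => 2 / odc n : R) @ \oo --> (0 : R).
Proof.
have h n : 0 <= 2 / odc n <= 2 / (n.+1%:R : R).
  rewrite divr_ge0 ?(ltW (odc_gt0 n))//= ler_wpM2l// lef_pV2 ?posrE ?odc_gt0//.
  by rewrite /odc -natr1 lerD2r mulr2n mulrDl mul1r lerDl.
apply: (@squeeze_cvgr _ _ _ _ (cst 0) (fun n => 2 / n.+1%:R)).
- by near=> n; exact: h.
- exact: cvg_cst.
- rewrite -[X in _ --> X](mulr0 2); apply: cvgM; first exact: cvg_cst.
  exact: (@cvg_harmonic R).
Unshelve. all: by end_near.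
Qed.

Lemma odc_inv_dec n : 2 / odc n.+1 <= 2 / odc n :> R.
Proof.
rewrite ler_wpM2l// lef_pV2 ?posrE ?odc_gt0// /odc lerD2r ler_wpM2l//.
by rewrite ler_nat.
Qed.

(** The alternating series is made absolutely convergent by averaging
    consecutive partial sums; those of even order increase from 4 / 3. *)
Lemma sqwave_pihalf_cvg : exists2 c : R, 0 < c &
  (fun N => sqwave N (pi / 2)) @ \oo --> c.
Proof.
pose B n : R := 2 / odc n; pose v n : R := (-1) ^+ n * ((B n - B n.+1) / 2).
have sgn n : `|(-1) ^+ n : R| = 1 by rewrite normrX normrN1 expr1n.
have Bd n : 0 <= (B n - B n.+1) / 2 by rewrite divr_ge0// subr_ge0 odc_inv_dec.
have vn n : `|v n| = (B n - B n.+1) / 2 by rewrite normrM sgn mul1r ger0_norm.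
have B0 n : 0 < B n by rewrite divr_gt0// odc_gt0.
have cv : cvgn (series v).
  apply: normed_cvg; apply: nondecreasing_is_cvgn.
    by apply: nondecreasing_series => n _ _ /=.
  exists (B 0%N / 2) => _ [N _ <-]; rewrite /series/=.
  have e : \sum_(0 <= k < N) `|v k| = (B 0%N - B N) / 2.
    elim: N => [|N IH]; first by rewrite big_geq// subrr mul0r.
    by rewrite big_nat_recr//= IH vn; lra.
  by rewrite -[leLHS]/(\sum_(0 <= k < N) `|v k|) e; have := B0 N; lra.
have sqE N : sqwave N (pi / 2) = B 0%N / 2 - (-1) ^+ N * (B N / 2) + series v N.
  rewrite /sqwave /series/=; elim: N => [|N IH].
    by rewrite big_ord0 big_geq// expr0; lra.
  rewrite big_ord_recr IH big_nat_recr//= sin_odc -/(B N) /v exprS.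
  by move: ((-1) ^+ N) (B N) (B N.+1) (\sum_(0 <= k < N) _) => e b b' S; field.
have lim : (fun N => sqwave N (pi / 2)) @ \oo --> B 0%N / 2 + limn (series v).
  have -> : (fun N => sqwave N (pi / 2)) =
      (fun N => B 0%N / 2 - (-1) ^+ N * (B N / 2) + series v N).
    by apply/funext => m; exact: sqE.
  apply: cvgD; last exact: cv.
  rewrite -[X in _ --> X]subr0; apply: cvgB; first exact: cvg_cst.
  apply/norm_cvg0P.
  have -> : (fun N => `|(-1) ^+ N * (B N / 2)|) = (fun N => B N / 2).
    by apply/funext => m /=; rewrite normrM sgn mul1r ger0_norm// divr_ge0// ltW.
  rewrite -[X in _ --> X](mul0r 2^-1); apply: cvgM; last exact: cvg_cst.
  exact: odc_inv_cvg0.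
exists (B 0%N / 2 + limn (series v)) => //.
have low N : 4 / 3 <= sqwave N.*2.+2 (pi / 2).
  elim: N => [|N IH].
    have o0 : odc 0 = 1 by rewrite /odc; ring.
    have o1 : odc 1 = 3 by rewrite /odc; ring.
    by rewrite /sqwave !big_ord_recr big_ord0/= !sin_odc o0 o1 expr0 expr1; lra.
  have ev : (-1) ^+ N.*2.+2 = 1 :> R.
    by rewrite -doubleS -mul2n exprM sqrrN expr1n expr1n.
  have -> : sqwave N.+1.*2.+2 (pi / 2) =
      sqwave N.*2.+2 (pi / 2) + B N.*2.+2 * 1 + B N.*2.+3 * -1.
    by rewrite doubleS {1}/sqwave 2!big_ord_recr !sin_odc /= [(-1) ^+ N.*2.+3]exprS ev !mulr1.
  have : B N.*2.+3 <= B N.*2.+2 := odc_inv_dec _.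
  by move: IH; lra.
apply: (@lt_le_trans _ _ (4 / 3)); first by lra.
have sub : (fun N => sqwave N.*2.+2 (pi / 2)) @ \oo --> B 0%N / 2 + limn (series v).
  apply: (cvg_comp (fun N => N.*2.+2) (fun N => sqwave N (pi / 2)) _ lim).
  apply/cvgnyPge => A; exists A => // n /= An; lia.
rewrite -(cvg_lim _ sub)//; apply: limr_ge; first by apply/cvg_ex; eexists; exact: sub.
by near=> N; exact: low.
Unshelve. all: by end_near.
Qed.

(** The Chebyshev expansion of t ^ (-1/2): it is the Fourier series of the
    square wave, divided by sin phi. *)
Lemma cheb_invsqrt_cvg : exists2 k : R, 0 < k & forall t, 0 < t <= 2 ->
  (fun N => k * \sum_(n < N) 2 / odc n * cheb n t) @ \oo --> (Num.sqrt t)^-1.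
Proof.
have [c c0 hc] := sqwave_pihalf_cvg.
have s2 : 0 < Num.sqrt 2 :> R by rewrite sqrtr_gt0.
exists (c * Num.sqrt 2)^-1; first by rewrite invr_gt0 mulr_gt0.
move=> t /andP[t0 t2]; set s := Num.sqrt (t / 2).
have s0 : 0 < s by rewrite sqrtr_gt0 divr_gt0.
have ss : s ^+ 2 = t / 2 by rewrite sqr_sqrtr// divr_ge0// ltW.
have s1 : s <= 1 by rewrite -[leRHS]sqrtr1 ler_sqrt// ler_pdivrMr// mul1r.
pose phi := asin s.
have sI : -1 <= s <= 1 by apply/andP; split; lra.
have sphi : sin phi = s by apply: asinK; rewrite in_itv.
have p1 : phi <= pi / 2 by exact: asin_lepi2.
have p0 : 0 < phi.
  rewrite ltNge; apply/negP => p0.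
  have : sin phi <= 0.
    rewrite -[leLHS]opprK oppr_le0 -sinN; apply: sin_ge0_pi.
    by rewrite oppr_ge0 p0/=; have := asin_geNpi2 sI; have := @pi_gt0 R; rewrite -/phi; lra.
  by rewrite sphi leNgt s0.
have pI : 0 < phi <= pi / 2 by rewrite p0.
have [C hC] := sqwave_dist pI.
have lim : (fun N => sqwave N phi) @ \oo --> c.
  have -> : (fun N => sqwave N phi) =
      (fun N => (sqwave N phi - sqwave N (pi / 2)) + sqwave N (pi / 2)).
    by apply/funext => m; rewrite subrK.
  rewrite -[c]add0r; apply: cvgD => //; apply/norm_cvg0P.
  apply: (@squeeze_cvgr _ _ _ _ (cst 0) (fun N => C / N%:R)).
  - by near=> N; rewrite /= normr_ge0/=; apply: hC; near: N; exists 1%N.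
  - exact: cvg_cst.
  - rewrite -[X in _ --> X](mulr0 C); apply: cvgM; first exact: cvg_cst.
    apply/cvgr0Pnorm_lt => e e0.
    near=> N; have N0 : (0 : R) < N%:R by rewrite ltr0n; near: N; exists 1%N.
    rewrite ger0_norm ?invr_ge0 ?ltW// invf_plt ?posrE//.
    near: N; exact: nbhs_infty_gtr.
have tE : t = 2 * sin phi ^+ 2 by rewrite sphi ss; field.
have -> : (fun N => (c * Num.sqrt 2)^-1 * \sum_(n < N) 2 / odc n * cheb n t) =
    (fun N => (c * Num.sqrt 2)^-1 * s^-1 * sqwave N phi).
  apply/funext => N; rewrite -mulrA; congr (_ * _); rewrite /sqwave mulr_sumr.
  apply: eq_bigr => n _; rewrite -cheb_sin -tE sphi; field.
  by rewrite (gt_eqF s0) (gt_eqF (odc_gt0 n)).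
have -> : (Num.sqrt t)^-1 = (c * Num.sqrt 2)^-1 * s^-1 * c.
  have -> : Num.sqrt t = Num.sqrt 2 * s.
    by rewrite /s -sqrtrM// mulrCA divff ?mulr1// pnatr_eq0.
  by field; rewrite !gt_eqF.
by apply: cvgM; first exact: cvg_cst.
Unshelve. all: by end_near.
Qed.

End chebyshev.

(** * Complex functions and the L^2 norm *)

Lemma ge0_cvg0P (R : realType) (u : nat -> \bar R) : (forall n, 0 <= u n)%E ->
  (u @ \oo --> 0%E) <->
  (forall e : R, 0 < e -> exists N, forall n, (N <= n)%N -> (u n <= e%:E)%E).
Proof.
move=> u0; split=> [/fine_cvgP[ufin /cvgr0Pnorm_le ule] e e0|H].
  have [A _ hA] := ufin; have [B _ hB] := ule _ e0.
  exists (maxn A B) => n; rewrite geq_max => /andP[An Bn].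
  have un : u n \is a fin_num by exact: hA.
  rewrite -(fineK un) lee_fin; apply: le_trans (ler_norm _) _; exact: hB.
have [N1 h1] := H 1 ltr01.
have ufin n : (N1 <= n)%N -> u n \is a fin_num.
  by move=> /h1 un; rewrite ge0_fin_numE// (le_lt_trans un)// ltry.
apply/fine_cvgP; split; first by exists N1.
apply/cvgr0Pnorm_le => e /H[N hN].
exists (maxn N1 N) => // n /=; rewrite geq_max => /andP[n1 n2].
by rewrite ger0_norm ?fine_ge0// -lee_fin fineK ?ufin// hN.
Qed.

Section complex_norms.
Variables (R : realType) (T : rayGraph) (q : nat).
Local Notation mu := (@flow_measure R q T).
Implicit Types (f g u : T -> R[i]) (z : R[i]).

Lemma sqr_modulus z : modulus z ^+ 2 = complex.Re z ^+ 2 + complex.Im z ^+ 2.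
Proof. by case: z => a b; rewrite /modulus /= sqr_sqrtr// addr_ge0 ?sqr_ge0. Qed.

Lemma ReD z w : complex.Re (z + w) = complex.Re z + complex.Re w.
Proof. by case: z w => [a b] [c d]. Qed.

Lemma ImD z w : complex.Im (z + w) = complex.Im z + complex.Im w.
Proof. by case: z w => [a b] [c d]. Qed.

Lemma ReN z : complex.Re (- z) = - complex.Re z.
Proof. by case: z => a b. Qed.

Lemma ImN z : complex.Im (- z) = - complex.Im z.
Proof. by case: z => a b. Qed.

Lemma ReM z w : complex.Re (z * w) =
  complex.Re z * complex.Re w - complex.Im z * complex.Im w.
Proof. by case: z w => [a b] [c d]. Qed.

Lemma ImM z w : complex.Im (z * w) =
  complex.Re z * complex.Im w + complex.Im z * complex.Re w.
Proof. by case: z w => [a b] [c d]. Qed.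

Lemma modulus_ge0 z : 0 <= modulus z.
Proof. by case: z => a b; rewrite /modulus /= sqrtr_ge0. Qed.

Lemma modulus_le z : modulus z <= `|complex.Re z| + `|complex.Im z|.
Proof.
rewrite -(@ler_pXn2r _ 2)// ?nnegrE ?modulus_ge0 ?addr_ge0// sqr_modulus.
rewrite -[complex.Re z ^+ 2]real_normK ?num_real//.
rewrite -[complex.Im z ^+ 2]real_normK ?num_real//.
have := normr_ge0 (complex.Re z); have := normr_ge0 (complex.Im z); nra.
Qed.

Lemma Re_le_modulus z : `|complex.Re z| <= modulus z.
Proof.
rewrite -(@ler_pXn2r _ 2)// ?nnegrE ?modulus_ge0// sqr_modulus.
by rewrite real_normK ?num_real// lerDl sqr_ge0.
Qed.

Lemma Im_le_modulus z : `|complex.Im z| <= modulus z.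
Proof.
rewrite -(@ler_pXn2r _ 2)// ?nnegrE ?modulus_ge0// sqr_modulus.
by rewrite real_normK ?num_real// lerDr sqr_ge0.
Qed.

Lemma LpNorm_fint p f :
  LpNorm q p f = (fint q (fun x => modulus (f x) `^ p)%R `^ p^-1)%E.
Proof.
rewrite /LpNorm Lnorm.unlock /fint; apply: (congr1 (fun t => t `^ p^-1)%E).
apply: eq_integral => x _.
by rewrite abse_EFin ger0_norm ?modulus_ge0// poweR_EFin.
Qed.

Lemma LpNorm_le p C f g : 0 < p -> 0 <= C ->
  (fint q (fun x => modulus (g x) `^ p)%R <=
    C%:E * fint q (fun x => modulus (f x) `^ p)%R)%E ->
  (LpNorm q p g <= (C `^ p^-1)%:E * LpNorm q p f)%E.
Proof.
move=> p0 C0 h; rewrite !LpNorm_fint.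
have fp0 h' : (0 <= fint q (fun x => modulus (h' x) `^ p)%R)%E.
  by apply: fint_ge0 => x; exact: powR_ge0.
have pi0 : 0 <= p^-1 by rewrite invr_ge0 ltW.
rewrite -poweR_EFin -poweRM ?lee_fin//.
by apply: gt0_ler_poweR; rewrite ?in_itv/= ?fp0 ?leey ?mule_ge0 ?lee_fin.
Qed.

Definition sqn f : \bar R := fint q (fun x => modulus (f x) ^+ 2).

Lemma sqn_ge0 f : (0 <= sqn f)%E.
Proof. by apply: fint_ge0 => x; exact: sqr_ge0. Qed.

Lemma LpNorm2_sqn f : LpNorm q 2 f = (sqn f `^ 2^-1)%E.
Proof.
rewrite LpNorm_fint; congr (_ `^ _)%E; apply: eq_fint => x.
by rewrite powR_mulrn// modulus_ge0.
Qed.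

Lemma sqn_LpNorm2 f : (LpNorm q 2 f ^+ 2)%E = sqn f.
Proof.
rewrite LpNorm2_sqn expe2; have := sqn_ge0 f; case: (sqn f) => [r r0||//].
  by rewrite poweR_EFin -EFinM -expr2 -powR_mulrn ?powR_ge0// -powRrM mulVf// powRr1.
by rewrite poweRyr// mulyy.
Qed.

Lemma inL2P f : inLp q 2 f <-> (sqn f < +oo)%E.
Proof.
rewrite /inLp LpNorm2_sqn; split; last exact: poweR_lty.
by apply: lty_poweRy; rewrite invr_eq0.
Qed.

Lemma L2_cvgP (f_ : nat -> T -> R[i]) f : L2_cvg q f_ f <->
  (forall e : R, 0 < e -> exists N, forall n, (N <= n)%N ->
     (sqn (fun x => (f_ n x - f x)%R) <= e%:E)%E).
Proof.
rewrite /L2_cvg ge0_cvg0P; last by move=> n; exact: Lnorm_ge0.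
split=> H e e0.
  have [N hN] := H (Num.sqrt e) (eq_ind_r is_true e0 (sqrtr_gt0 e)).
  exists N => n /hN h; rewrite -sqn_LpNorm2 -(sqr_sqrtr (ltW e0)) expe2 expr2 EFinM.
  by apply: lee_pmul => //; exact: Lnorm_ge0.
have [N hN] := H (e ^+ 2) (exprn_gt0 _ e0).
exists N => n /hN h; rewrite LpNorm2_sqn.
have -> : e%:E = (((e ^+ 2)%:E) `^ 2^-1)%E.
  by rewrite poweR_EFin -powR_mulrn ?(ltW e0)// -powRrM mulfV// powRr1// ltW.
apply: gt0_ler_poweR; rewrite ?invr_ge0// ?in_itv/= ?sqn_ge0 ?leey//.
by rewrite lee_fin sqr_ge0.
Qed.

Lemma sqn_re_im f : sqn f =
  (fint q (fun x => complex.Re (f x) ^+ 2)%R + fint q (fun x => complex.Im (f x) ^+ 2)%R)%E.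
Proof.
rewrite -fintD; [|by move=> x; exact: sqr_ge0..].
by apply: eq_fint => x; rewrite sqr_modulus.
Qed.

Lemma sqr_add_le (a b e : R) : 0 < e ->
  (a + b) ^+ 2 <= (1 + e) * a ^+ 2 + (1 + e^-1) * b ^+ 2.
Proof.
move=> e0; rewrite -subr_ge0.
have -> : (1 + e) * a ^+ 2 + (1 + e^-1) * b ^+ 2 - (a + b) ^+ 2 =
    e^-1 * (e * a - b) ^+ 2 by field; rewrite gt_eqF.
by rewrite mulr_ge0 ?sqr_ge0// invr_ge0 ltW.
Qed.

(** The weight e allows to approximate in norm without losing a factor in the
    main term. *)
Lemma sqn_addw f g (e : R) : 0 < e ->
  (sqn (fun x => (f x + g x)%R) <= (1 + e)%:E * sqn f + (1 + e^-1)%:E * sqn g)%E.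
Proof.
move=> e0; have e1 : 0 <= 1 + e by rewrite addr_ge0// ltW.
have e2 : 0 <= 1 + e^-1 by rewrite addr_ge0// invr_ge0 ltW.
have s0 (h : T -> R[i]) (x : T) : 0 <= modulus (h x) ^+ 2 by exact: sqr_ge0.
rewrite /sqn -(@fintZ _ _ _ _ _ e1 (s0 f)) -(@fintZ _ _ _ _ _ e2 (s0 g)).
have m1 (x : T) : 0 <= (1 + e) * modulus (f x) ^+ 2 by exact: mulr_ge0.
have m2 (x : T) : 0 <= (1 + e^-1) * modulus (g x) ^+ 2 by exact: mulr_ge0.
rewrite -(fintD q m1 m2).
apply: le_fint => x; first exact: sqr_ge0.
rewrite !sqr_modulus ReD ImD.
apply: le_trans (lerD (sqr_add_le (complex.Re (f x)) (complex.Re (g x)) e0)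
                      (sqr_add_le (complex.Im (f x)) (complex.Im (g x)) e0)) _.
by rewrite le_eqVlt; apply/orP; left; apply/eqP; ring.
Qed.

Lemma sqn_add2 f g :
  (sqn (fun x => (f x + g x)%R) <= 2%:E * sqn f + 2%:E * sqn g)%E.
Proof.
have := @sqn_addw f g 1 ltr01; rewrite invr1.
by have -> : 1 + 1 = 2 :> R by lra.
Qed.

Lemma sqnZ (a : R[i]) f : sqn (fun x => (a * f x)%R) = ((modulus a ^+ 2)%:E * sqn f)%E.
Proof.
rewrite /sqn -fintZ ?sqr_ge0//; last by move=> x; exact: sqr_ge0.
by apply: eq_fint => x; rewrite !sqr_modulus ReM ImM; ring.
Qed.

Lemma sqnZr (a : R) f : sqn (fun x => (a%:C * f x)%R) = ((a ^+ 2)%:E * sqn f)%E.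
Proof. by rewrite sqnZ sqr_modulus/= expr0n addr0. Qed.

Lemma sqnN f : sqn (fun x => - f x) = sqn f.
Proof. by apply: eq_fint => x; rewrite !sqr_modulus ReN ImN !sqrrN. Qed.

Lemma sqn_subC f g : sqn (fun x => f x - g x) = sqn (fun x => g x - f x).
Proof. by rewrite -sqnN; congr sqn; apply/funext => x; rewrite opprB. Qed.

Lemma sqn_sub_add2 h f g : (sqn (fun x => (f x - g x)%R) <=
  2%:E * sqn (fun x => (f x - h x)%R) + 2%:E * sqn (fun x => (h x - g x)%R))%E.
Proof.
have -> : (fun x => f x - g x) = (fun x => (f x - h x) + (h x - g x)).
  by apply/funext => x; rewrite addrA subrK.
exact: sqn_add2.
Qed.

Lemma inL2_lin (a : R[i]) f g : inLp q 2 f -> inLp q 2 g ->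
  inLp q 2 (fun x => a * f x + g x).
Proof.
move=> /inL2P hf /inL2P hg; apply/inL2P; apply: le_lt_trans (sqn_add2 _ _) _.
rewrite sqnZ; have := sqn_ge0 f; have := sqn_ge0 g.
by case: (sqn f) (sqn g) hf hg => [r||] [t||]// _ _ _ _; rewrite -!EFinM -EFinD ltry.
Qed.

Lemma inL2_0 : inLp q 2 (fun _ : T => 0 : R[i]).
Proof.
apply/inL2P; rewrite (_ : sqn _ = 0%E) ?ltry//.
by rewrite -[RHS](@fint0 R q T); apply: eq_fint => x; rewrite sqr_modulus/= expr0n addr0.
Qed.

Lemma inL2Z (a : R[i]) f : inLp q 2 f -> inLp q 2 (fun x => a * f x).
Proof.
move=> hf; rewrite (_ : (fun x => _) = (fun x => a * f x + 0)).
  exact: inL2_lin inL2_0.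
by apply/funext => x; rewrite addr0.
Qed.

Lemma inL2B f g : inLp q 2 f -> inLp q 2 g -> inLp q 2 (fun x => f x - g x).
Proof.
move=> hf hg; rewrite (_ : (fun x => _) = (fun x => -1 * g x + f x)).
  exact: inL2_lin.
by apply/funext => x; rewrite mulN1r addrC.
Qed.

Definition ip f g : R := Rintegral mu setT (fun x => complex.Re (f x * conjc (g x))).

(** Only the real part of the inner product enters the square of the norm. *)
Lemma sqn_pythagoras f g : inLp q 2 f -> inLp q 2 g -> ip f g = 0 ->
  sqn (fun x => f x + g x) = (sqn f + sqn g)%E.
Proof.
move=> hf hg fg0; pose c x := 2 * complex.Re (f x * conjc (g x)).
have sq_int h : inLp q 2 h -> mu.-integrable setT (EFin \o (fun x => modulus (h x) ^+ 2)).
  move=> /inL2P hh; apply/integrableP; split=> //.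
  rewrite (eq_integral (fun x => (modulus (h x) ^+ 2)%:E)) ?hh// => x _.
  by rewrite /= ger0_norm// sqr_ge0.
have fgint := integrableD measurableT (sq_int f hf) (sq_int g hg).
have cle x : `|c x| <= modulus (f x) ^+ 2 + modulus (g x) ^+ 2.
  rewrite /c !sqr_modulus ReM; case: (f x) (g x) => [a b] [a' b'] /=.
  have := sqr_ge0 (a - a'); have := sqr_ge0 (b - b').
  have := sqr_ge0 (a + a'); have := sqr_ge0 (b + b').
  by rewrite ler_norml => *; apply/andP; split; nra.
have cint : mu.-integrable setT (EFin \o c).
  apply: (le_integrable measurableT _ _ fgint) => // x _.
  rewrite /= lee_fin; apply: le_trans (cle x) _; exact: ler_norm.
have c0 : (\int[mu]_x (c x)%:E = 0)%E.
  have cfin := integrable_fin_num measurableT cint.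
  rewrite -(fineK cfin); congr EFin.
  rewrite -[LHS]/(Rintegral mu setT c) /c.
  have rint : mu.-integrable setT (EFin \o (fun x => complex.Re (f x * conjc (g x)))).
    have := integrableZl measurableT 2^-1 cint.
    apply: (eq_integrable measurableT) => x _ /=.
    by rewrite /c -EFinM; congr EFin; rewrite mulKf.
  by rewrite RintegralZl//= -/(ip f g) fg0 mulr0.
rewrite /sqn -fintD; [|by move=> x; exact: sqr_ge0..].
rewrite -[RHS]adde0 -c0 /fint.
rewrite -[X in (X + _)%E]/(\int[mu]_x ((EFin \o (fun x => modulus (f x) ^+ 2)%R) \+ (EFin \o (fun x => modulus (g x) ^+ 2)%R)) x)%E.
rewrite -integralD//; apply: eq_integral => x _; rewrite /= -!EFinD; congr EFin.
rewrite /c !sqr_modulus ReD ImD ReM; case: (f x) (g x) => [a b] [a' b'] /=; ring.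
Qed.

Hypothesis q0 : (0 < q)%N.

Lemma sqn_point f x : ((mass R q x * modulus (f x) ^+ 2)%:E <= sqn f)%E.
Proof. by apply: (fint_point q) => y; exact: sqr_ge0. Qed.

Lemma modulus_eq0 z : modulus z = 0 -> z = 0.
Proof.
move=> z0; have := sqr_modulus z; rewrite z0 expr0n/= => /esym/eqP.
rewrite paddr_eq0 ?sqr_ge0// !sqrf_eq0; case: z {z0} => a b /= /andP[/eqP -> /eqP ->].
by [].
Qed.

Lemma sqn_eq0 f : (sqn f <= 0)%E -> f = (fun=> 0).
Proof.
move=> f0; apply/funext => x; apply: modulus_eq0.
have := le_trans (sqn_point f x) f0; rewrite lee_fin pmulr_rle0 ?(mass_gt0 R q0)//.
move=> h; apply/eqP; rewrite -sqrf_eq0; apply/eqP/le_anti; rewrite h sqr_ge0//.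
Qed.

Lemma L2_cvg_uniq (f_ : nat -> T -> R[i]) f g : L2_cvg q f_ f -> L2_cvg q f_ g -> f = g.
Proof.
move=> /L2_cvgP hf /L2_cvgP hg.
suff /sqn_eq0 fg : (sqn (fun x => (f x - g x)%R) <= 0)%E.
  by apply/funext => x; apply/eqP; rewrite -subr_eq0; have /(congr1 (fun h => h x)) /= -> := fg.
apply/lee_addgt0Pr => e e0; rewrite add0e.
have e4 : 0 < e / 4 by rewrite divr_gt0.
have [N hN] := hf _ e4; have [M hM] := hg _ e4.
have h1 := hN _ (leq_maxl N M); have h2 := hM _ (leq_maxr N M).
apply: le_trans (sqn_sub_add2 (f_ (maxn N M)) f g) _; rewrite sqn_subC.
have -> : e%:E = (2%:E * (e / 4)%:E + 2%:E * (e / 4)%:E)%E.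
  by rewrite -EFinM -EFinD; congr EFin; field.
by apply: leeD; apply: lee_wpmul2l => //; rewrite lee_fin.
Qed.

End complex_norms.

(** * Calculus for a projection-valued measure *)

Lemma measurable_fun_fibers (d : measure_display) (U : measurableType d)
    (R : realType) (I : choiceType) (X : U -> I) (l : seq I) (g : I -> R) :
  (forall i, measurable (X @^-1` [set i])) -> (forall t, X t \in l) ->
  measurable_fun setT (fun t => g (X t)).
Proof.
move=> mX Xl _ Y mY; rewrite setTI.
have -> : (fun t => g (X t)) @^-1` Y =
    \big[setU/set0]_(i <- l) (if `[< Y (g i) >] then X @^-1` [set i] else set0).
  rewrite -bigcup_seq; apply/seteqP; split=> t /=.
    by move=> Yt; exists (X t) => /=; [exact: Xl|rewrite asboolT].
  by move=> [i _]; case: asboolP => // Yi /= ->.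
by apply: bigsetU_measurable => i _; case: ifP.
Qed.

Lemma sfun_fibers (R : realType) (I : choiceType) (X : R -> I) (l : seq I)
    (g : I -> R) : (forall i, measurable (X @^-1` [set i])) ->
  (forall t, X t \in l) -> exists s : {sfun R >-> R}, forall t, s t = g (X t).
Proof.
move=> mX Xl; pose h t := g (X t).
have mh : measurable_fun setT h by exact: measurable_fun_fibers Xl.
have fh : finite_set (range h).
  apply: (@sub_finite_set _ _ [set` [seq g i | i <- l]]); last exact: finite_seq.
  by move=> _ [t _ <-] /=; apply: map_f.
pose s : {sfun R >-> R} := HB.pack h
  (isMeasurableFun.Build _ _ _ _ h mh) (FiniteImage.Build _ _ h fh).
by exists s.
Qed.

Lemma integral_fibers (d : measure_display) (U : measurableType d) (R : realType)
    (m : {measure set U -> \bar R}) (I : choiceType) (X : U -> I) (l : seq I)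
    (g : I -> R) : (forall i, measurable (X @^-1` [set i])) -> uniq l ->
  (forall t, X t \in l) -> (forall i, 0 <= g i) ->
  (\int[m]_t (g (X t))%:E = \sum_(i <- l) (g i)%:E * m (X @^-1` [set i]))%E.
Proof.
move=> mX ul Xl g0; have mgX := measurable_fun_fibers g mX Xl.
transitivity (\int[m]_(t in \big[setU/set0]_(i <- l) X @^-1` [set i]) (g (X t))%:E)%E.
  congr (integral _ _ _); apply/esym; rewrite -bigcup_seq -subTset => t _.
  by exists (X t) => //=; exact: Xl.
rewrite ge0_integral_bigsetU//.
- apply: eq_bigr => i _; rewrite (eq_integral (cst (g i)%:E)) ?integral_cst//.
  by move=> t; rewrite inE /= => ->.
- by move=> i j _ _ [t [/= -> ->]].
- by apply/measurable_EFinP; exact: measurable_funTS mgX.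
- by move=> t _; rewrite lee_fin.
Qed.

Section pvm_theory.
Variables (R : realType) (T : rayGraph) (q : nat).
Implicit Types (f g v w : T -> R[i]) (A B : set R).
Hypothesis q0 : (0 < q)%N.
Variable E : set R -> (T -> R[i]) -> (T -> R[i]).
Hypothesis hE : projection_valued_measure q E.

Let L2 f := inLp q 2 f.

Lemma pvm_zero B : measurable B -> E B (fun=> 0) = (fun=> 0).
Proof.
move=> mB; have := pvm_linear hE mB 1 (inL2_0 R T q) (inL2_0 R T q).
have -> : (fun x : T => 1 * 0 + 0 : R[i]) = (fun=> 0) by apply/funext => x; rewrite mulr0 addr0.
move=> e; apply/funext => x; have /= := congr1 (fun h => h x) e.
by rewrite mul1r => /esym/eqP; rewrite -subr_eq0 addrK => /eqP.
Qed.

Lemma pvm_scale B (a : R[i]) f : measurable B -> L2 f ->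
  E B (fun x => a * f x) = (fun x => a * E B f x).
Proof.
move=> mB hf; have := pvm_linear hE mB a hf (inL2_0 R T q).
rewrite pvm_zero// => e; transitivity (E B (fun x => a * f x + 0)).
  by congr (E B _); apply/funext => x; rewrite addr0.
by rewrite e; apply/funext => x; rewrite addr0.
Qed.

Lemma sqn_nat n f : sqn q (fun x => n%:R * f x) = ((n%:R ^+ 2)%:E * sqn q f)%E.
Proof.
have -> : (fun x => n%:R * f x) = (fun x => (n%:R : R)%:C * f x).
  by apply/funext => x; rewrite rmorph_nat.
exact: sqnZr.
Qed.

(** Sigma-additivity for the constant sequence of empty sets would otherwise
    give multiples of E set0 f of unbounded norm. *)
Lemma pvm_set0 f : L2 f -> E set0 f = (fun=> 0).
Proof.
move=> hf; have hf0 := pvm_L2 hE measurable0 hf.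
have := @pvm_sigma_additive _ _ _ _ hE (fun=> set0) f (fun=> measurable0) _ hf.
rewrite bigcup0// => /(_ _)/L2_cvgP H.
have {}H := H (fun i j _ _ => _).
apply: (sqn_eq0 q0); apply/lee_addgt0Pr => e e0; rewrite add0e.
have [|N hN] := H _ e e0; first by move=> i j [t []].
have := hN N.+2 (leqW (leqnSn N)).
have -> : (fun x => \sum_(k < N.+2) E set0 f x - E set0 f x) =
          (fun x => N.+1%:R * E set0 f x).
  by apply/funext => x; rewrite sumr_const card_ord mulrSr addrK mulr_natl.
rewrite sqn_nat; apply: le_trans; rewrite -[leLHS]mul1e lee_wpmul2r ?sqn_ge0//.
by rewrite lee_fin exprn_ege1// ler1n.
Qed.

Lemma pvm_disj A B f : measurable A -> measurable B -> A `&` B = set0 -> L2 f ->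
  E A (E B f) = (fun=> 0).
Proof. by move=> mA mB AB hf; rewrite -(pvm_setI hE)// AB pvm_set0. Qed.

(** Additivity for the sequence A, B, set0, set0, and so on. *)
Lemma pvm_setU A B f : measurable A -> measurable B -> A `&` B = set0 -> L2 f ->
  E (A `|` B) f = (fun x => E A f x + E B f x).
Proof.
move=> mA mB AB hf; pose F := bigcup2 A B.
have mF k : measurable (F k) by rewrite /F /bigcup2; case: ifP => // _; case: ifP.
have tF : trivIset setT F.
  apply/trivIsetP => i j _ _ ij; rewrite /F /bigcup2.
  have E0 (C : set R) : C `&` set0 = set0 /\ set0 `&` C = set0 by rewrite setI0 set0I.
  move: i j ij => [|[|i]] [|[|j]]//= _; rewrite ?setI0 ?set0I//.
  by rewrite setIC.
have := pvm_sigma_additive hE mF tF hf; rewrite bigcup2E => H.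
apply: (L2_cvg_uniq q0 H); apply/L2_cvgP => e e0; exists 2 => n n2.
rewrite (_ : (fun x => _) = (fun=> 0)).
  have /inL2P := inL2_0 R T q; rewrite (_ : sqn q _ = 0%E) ?lee_fin ?ltW//.
  by rewrite -[RHS](@fint0 R q T); apply: eq_fint => x; rewrite sqr_modulus/= expr0n addr0.
apply/funext => x; case: n n2 => [|[|n]]// _.
rewrite 2!big_ord_recl big1 ?addr0/= ?subrr// => i _.
by rewrite /F /bigcup2/= pvm_set0.
Qed.

(** Self-adjointness moves E A to the other factor, where it meets E B. *)
Lemma ip_orth A B v w : measurable A -> measurable B -> A `&` B = set0 ->
  L2 v -> L2 w -> E A v = v -> E B w = w -> ip q v w = 0.
Proof.
move=> mA mB AB hv hw Av Bw.
have := pvm_selfadjoint hE mA hv hw; rewrite Av -{2}Bw pvm_disj//.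
move=> /(congr1 (@complex.Re R)) /= e; rewrite /ip e.
rewrite /Rintegral (eq_integral (cst 0%E)) ?integral0// => x _.
by congr EFin; rewrite ReM /= oppr0 !mulr0 subr0.
Qed.

Section fibers.
Variables (I : choiceType) (X : R -> I).
Hypothesis mX : forall i, measurable (X @^-1` [set i]).
Local Notation fib i := (X @^-1` [set i]).

Lemma measurable_fibers (l : seq I) : measurable [set t | X t \in l].
Proof.
rewrite (_ : [set t | _] = \big[setU/set0]_(i <- l) fib i).
  by apply: bigsetU_measurable => i _; exact: mX.
rewrite -bigcup_seq; apply/seteqP; split=> t /=; first by move=> tl; exists (X t).
by move=> [i il /= ->].
Qed.

Lemma fiber_consI i (l : seq I) : i \notin l -> fib i `&` [set t | X t \in l] = set0.
Proof. by move=> il; rewrite -subset0 => t [/= ti]; rewrite ti (negbTE il). Qed.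

Lemma pvm_fibers (l : seq I) f : uniq l -> L2 f ->
  E [set t | X t \in l] f = (fun x => \sum_(i <- l) E (fib i) f x).
Proof.
move=> + hf; elim: l => [_|i l IH /= /andP[il ul]].
  rewrite (_ : [set t | _] = set0) ?pvm_set0//; last by rewrite -subset0.
  by apply/funext => x; rewrite big_nil.
rewrite (_ : [set t | _] = fib i `|` [set t | X t \in l]).
  rewrite pvm_setU ?IH//; [|exact: measurable_fibers|exact: fiber_consI].
  by apply/funext => x; rewrite big_cons.
by apply/seteqP; split=> t /=; rewrite inE => /predU1P.
Qed.

(** The spectral integral of phi o X. *)
Definition fsum (l : seq I) (phi : I -> R) f : T -> R[i] :=
  fun x => \sum_(i <- l) (phi i)%:C * E (fib i) f x.

Lemma fsum_cons i l phi f : fsum (i :: l) phi f =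
  (fun x => (phi i)%:C * E (fib i) f x + fsum l phi f x).
Proof. by apply/funext => x; rewrite /fsum big_cons. Qed.

Lemma fsum_nil phi f : fsum [::] phi f = (fun=> 0).
Proof. by apply/funext => x; rewrite /fsum big_nil. Qed.

Lemma fsum_L2 l phi f : L2 f -> L2 (fsum l phi f).
Proof.
move=> hf; elim: l => [|i l IH]; first by rewrite fsum_nil; exact: inL2_0.
by rewrite fsum_cons; apply: inL2_lin => //; exact: (pvm_L2 hE).
Qed.

Lemma pvm_fsum B l phi f : measurable B -> L2 f ->
  E B (fsum l phi f) = (fun x => \sum_(i <- l) (phi i)%:C * E B (E (fib i) f) x).
Proof.
move=> mB hf; elim: l => [|i l IH].
  by rewrite fsum_nil pvm_zero//; apply/funext => x; rewrite big_nil.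
rewrite fsum_cons (pvm_linear hE mB) ?IH//; last 2 first.
- exact: (pvm_L2 hE).
- exact: fsum_L2.
by apply/funext => x; rewrite big_cons.
Qed.

Lemma pvm_fsum_fib j l phi f : uniq l -> j \in l -> L2 f ->
  E (fib j) (fsum l phi f) = (fun x => (phi j)%:C * E (fib j) f x).
Proof.
move=> ul jl hf; rewrite pvm_fsum//; apply/funext => x.
rewrite (bigD1_seq j)//= big1 ?addr0.
  by rewrite -(pvm_setI hE)// setIid.
move=> i ij; rewrite pvm_disj ?mulr0//.
by rewrite -subset0 => t [/= -> e]; rewrite e eqxx in ij.
Qed.

Lemma fsum_fsum l phi psi f : uniq l -> L2 f ->
  fsum l psi (fsum l phi f) = fsum l (fun i => psi i * phi i) f.
Proof.
move=> ul hf; apply/funext => x; apply: eq_big_seq => i il.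
by rewrite pvm_fsum_fib// mulrA -rmorphM.
Qed.

Lemma sqn_fsum l phi f : uniq l -> L2 f ->
  sqn q (fsum l phi f) = (\sum_(i <- l) (phi i ^+ 2)%:E * sqn q (E (fib i) f))%E.
Proof.
move=> + hf; elim: l => [_|i l IH /= /andP[il ul]].
  rewrite big_nil fsum_nil -[RHS](@fint0 R q T).
  by apply: eq_fint => x; rewrite sqr_modulus/= expr0n addr0.
have hi := pvm_L2 hE (mX i) hf.
rewrite fsum_cons big_cons sqn_pythagoras ?sqnZr ?IH//; [exact: inL2Z|exact: fsum_L2|].
apply: (ip_orth (mX i) (measurable_fibers l) (fiber_consI il)).
- exact: inL2Z.
- exact: fsum_L2.
- by rewrite pvm_scale// -(pvm_setI hE)// setIid.
- rewrite pvm_fsum//; last exact: measurable_fibers.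
  apply/funext => x; apply: eq_big_seq => j jl; congr (_ * _).
  rewrite -(pvm_setI hE)//; last exact: measurable_fibers.
  by congr (E _ f x); apply/seteqP; split=> t /=; [case|move=> ->].
Qed.

(** The value c of s is regrouped over the fibres of X on which s equals c. *)
Lemma spectral_sum_fsum (s : {sfun R >-> R}) (phi : I -> R) (l : seq I) f :
  uniq l -> (forall t, X t \in l) -> (forall t, s t = phi (X t)) -> L2 f ->
  spectral_sum E s f = fsum l phi f.
Proof.
move=> ul Xl sX hf; apply/funext => x; rewrite /spectral_sum fsbig_finite//.
set S := fset_set (range s).
transitivity (\sum_(c <- S) \sum_(i <- l | phi i == c) (phi i)%:C * E (fib i) f x).
  apply: eq_bigr => c _.
  have -> : s @^-1` [set c] = [set t | X t \in [seq i <- l | phi i == c]].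
    by apply/seteqP; split=> t /=; rewrite sX mem_filter Xl andbT => /eqP.
  rewrite pvm_fibers ?filter_uniq// mulr_sumr big_filter.
  by apply: eq_bigr => i /eqP ->.
rewrite (exchange_big_dep xpredT)//=; apply: eq_bigr => i _.
rewrite big_mkcond/=; have [iS|niS] := boolP (phi i \in S).
  rewrite (bigD1_seq (phi i) iS (fset_uniq _))/= eqxx big1 ?addr0// => c ci.
  by rewrite eq_sym (negbTE ci).
rewrite (_ : fib i = set0); last first.
  rewrite -subset0 => t /= ti; move: niS; rewrite /S in_fset_set// => /negP; apply.
  by apply/mem_set; exists t => //; rewrite sX ti.
by rewrite pvm_set0// mulr0 big1// => c _; case: ifP.
Qed.

End fibers.
End pvm_theory.

(** * Spectral measures *)

Section spectral_measure.
Variables (R : realType) (T : rayGraph) (q : nat).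
Implicit Types (A B : set R).
Hypothesis q0 : (0 < q)%N.
Variable E : set R -> (T -> R[i]) -> (T -> R[i]).
Hypothesis hE : projection_valued_measure q E.
Variable f : T -> R[i].
Hypothesis hf : inLp q 2 f.

Lemma spectral_massE B : spectral_mass q E f B = sqn q (E B f).
Proof. exact: sqn_LpNorm2. Qed.

Lemma spectral_mass_fin B : measurable B -> spectral_mass q E f B \is a fin_num.
Proof.
move=> mB; rewrite spectral_massE ge0_fin_numE ?sqn_ge0//.
by apply/inL2P; exact: (pvm_L2 hE).
Qed.

Lemma spectral_massU A B : measurable A -> measurable B -> A `&` B = set0 ->
  spectral_mass q E f (A `|` B) = (spectral_mass q E f A + spectral_mass q E f B)%E.
Proof.
move=> mA mB AB; rewrite !spectral_massE (pvm_setU q0 hE)//.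
have hA := pvm_L2 hE mA hf; have hB := pvm_L2 hE mB hf.
apply: sqn_pythagoras => //; apply: (ip_orth q0 hE mA mB) => //.
- by rewrite -(pvm_setI hE)// setIid.
- by rewrite -(pvm_setI hE)// setIid.
Qed.

Definition smeas of projection_valued_measure q E & inLp q 2 f : set R -> \bar R :=
  spectral_mass q E f.

Let smeas0 : smeas hE hf set0 = 0%E.
Proof.
rewrite /smeas spectral_massE (pvm_set0 q0 hE)// -[RHS](@fint0 R q T).
by apply: eq_fint => x; rewrite sqr_modulus/= expr0n addr0.
Qed.

Let smeas_ge0 B : (0 <= smeas hE hf B)%E.
Proof. by rewrite /smeas spectral_massE sqn_ge0. Qed.

Let smeas_sigma_additive : semi_sigma_additive (smeas hE hf).
Proof.
move=> F mF tF mU; rewrite /smeas; set U := \bigcup_n F n.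
pose V n := \big[setU/set0]_(i < n) F i.
have mV n : measurable (V n) by apply: bigsetU_measurable.
have VF n : V n `&` F n = set0.
  rewrite -subset0 => t [Vt Ft]; move: Vt; rewrite /V -bigcup_mkord => -[i /= ni Fi].
  by move/trivIsetP: tF => /(_ i n I I); rewrite neq_ltn ni => /(_ isT); rewrite -subset0; apply; split; [exact: Fi|].
have VE n : E (V n) f = (fun x => \sum_(k < n) E (F k) f x).
  elim: n => [|n IH].
    by rewrite /V big_ord0 (pvm_set0 q0 hE)//; apply/funext => x; rewrite big_ord0.
  rewrite /V big_ord_recr/= (pvm_setU q0 hE (mV n) (mF n) (VF n) hf).
  by rewrite IH; apply/funext => x; rewrite big_ord_recr.
have Vm m : (\sum_(0 <= i < m) spectral_mass q E f (F i) = spectral_mass q E f (V m))%E.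
  elim: m => [|m IH]; first by rewrite big_geq// /V big_ord0; exact/esym/smeas0.
  by rewrite big_nat_recr//= IH /V big_ord_recr/= (spectral_massU (mV m) (mF m) (VF m)).
have VU n : V n `<=` U.
  by rewrite /V -bigcup_mkord => t [i _ Fi]; exists i.
have UV n : U = V n `|` (U `\` V n).
  by rewrite setDE setUIr setUv setIT; apply/esym/setUidr/VU.
have mD n : measurable (U `\` V n) by exact: measurableD.
have d0 n : V n `&` (U `\` V n) = set0 by rewrite setDE setICA setICr setI0.
have lim0 : (fun n => spectral_mass q E f (U `\` V n)) @ \oo --> 0%E.
  apply/ge0_cvg0P => [n|e e0]; first exact: smeas_ge0.
  have /L2_cvgP/(_ e e0)[N hN] := pvm_sigma_additive hE mF tF hf.
  exists N => n /hN; rewrite spectral_massE sqn_subC.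
  have -> : (fun x => E (\bigcup_k F k) f x - \sum_(k < n) E (F k) f x) = E (U `\` V n) f.
    rewrite -/U {1}(UV n) (pvm_setU q0 hE)//; apply/funext => x.
    by rewrite VE addrC addKr.
  by [].
have -> : (fun n => \sum_(0 <= i < n) spectral_mass q E f (F i))%E =
    (fun n => spectral_mass q E f U - spectral_mass q E f (U `\` V n))%E.
  apply/funext => n; rewrite Vm.
  have -> : spectral_mass q E f U =
      (spectral_mass q E f (V n) + spectral_mass q E f (U `\` V n))%E.
    by rewrite {1}(UV n) (spectral_massU (mV n) (mD n) (d0 n)).
  by rewrite addeK// spectral_mass_fin.
rewrite -[X in _ --> X]sube0; apply: cvgeB => //; last exact: cvg_cst.
by apply: fin_num_adde_defl; rewrite oppe0.
Qed.

HB.instance Definition _ := isMeasure.Build _ R R (smeas hE hf)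
  smeas0 smeas_ge0 smeas_sigma_additive.

End spectral_measure.

(** * Location of the spectrum *)

Lemma integral_sq_addw (R : realType) (m : {measure set R -> \bar R})
    (a b c : R -> R) (e : R) : 0 < e ->
  measurable_fun setT a -> measurable_fun setT b -> measurable_fun setT c ->
  (\int[m]_t ((a t - c t) ^+ 2)%:E <=
   (1 + e)%:E * \int[m]_t ((a t - b t) ^+ 2)%:E +
   (1 + e^-1)%:E * \int[m]_t ((b t - c t) ^+ 2)%:E)%E.
Proof.
move=> e0 ma mb mc.
have msq (g h : R -> R) : measurable_fun setT g -> measurable_fun setT h ->
    measurable_fun setT (fun t => ((g t - h t) ^+ 2)%:E).
  by move=> mg mh; apply/measurable_EFinP; apply: measurable_funX; apply: measurable_funB.
have s0 (g h : R -> R) t : setT t -> (0 <= ((g t - h t) ^+ 2)%:E)%E by rewrite lee_fin sqr_ge0.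
have e1 : 0 <= 1 + e by rewrite addr_ge0// ltW.
have e2 : 0 <= 1 + e^-1 by rewrite addr_ge0// invr_ge0 ltW.
have m1 := msq _ _ ma mb; have m2 := msq _ _ mb mc; have m3 := msq _ _ ma mc.
rewrite -!ge0_integralZl_EFin//; [|exact: s0..].
have M1 : measurable_fun setT (fun t => ((1 + e) * (a t - b t) ^+ 2)%:E).
  by move/measurable_EFinP: m1 => m1; apply/measurable_EFinP; apply: measurable_funM.
have M2 : measurable_fun setT (fun t => ((1 + e^-1) * (b t - c t) ^+ 2)%:E).
  by move/measurable_EFinP: m2 => m2; apply/measurable_EFinP; apply: measurable_funM.
rewrite -ge0_integralD//; last 2 first.
- by move=> t _; rewrite -EFinM lee_fin mulr_ge0 ?sqr_ge0.
- by move=> t _; rewrite -EFinM lee_fin mulr_ge0 ?sqr_ge0.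
apply: ge0_le_integral => //.
- exact: s0.
- by apply: emeasurable_funD.
move=> t _; rewrite -!EFinM -EFinD lee_fin.
have -> : a t - c t = (a t - b t) + (b t - c t) by ring.
exact: sqr_add_le.
Qed.

Section spectral_calculus.
Variables (R : realType) (T : rayGraph) (q : nat).
Implicit Types (f g u : T -> R[i]) (t : R).
Hypothesis q0 : (0 < q)%N.
Variable E : set R -> (T -> R[i]) -> (T -> R[i]).
Variable L : (T -> R[i]) -> (T -> R[i]).
Hypothesis hE : spectral_resolution q L E.
Hypothesis L_L2 : forall f, inLp q 2 f -> inLp q 2 (L f).
Hypothesis L_contr : forall f, inLp q 2 f ->
  (sqn q (fun x => (f x - L f x)%R) <= sqn q f)%E.

Let hP : projection_valued_measure q E. Proof. by case: hE. Qed.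
Local Notation L2 := (inLp q 2).
Local Notation nu := (spectral_mass q E).
Local Notation Phi := (spectral_sum E).

Lemma spectral_mass_measure f : L2 f ->
  exists m : {measure set R -> \bar R}, (m : set R -> \bar R) = nu f.
Proof. by move=> hf; unshelve eexists (smeas hP hf). Qed.

(** Both sums are evaluated on the common refinement by the fibres of the pair
    (s, s'). *)
Lemma spectral_sum_iso (s s' : {sfun R >-> R}) f : L2 f ->
  sqn q (fun x => Phi s f x - Phi s' f x) =
  (\int[nu f]_t ((s t - s' t) ^+ 2)%:E)%E.
Proof.
move=> hf; pose X t := (s t, s' t).
pose l := [seq (a, b) | a <- fset_set (range s), b <- fset_set (range s')].
have ul : uniq l by apply: allpairs_uniq => // -[a b] [c d] _ _ [-> ->].
have Xl t : X t \in l.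
  by apply: allpairs_f; rewrite in_fset_set// inE; exists t.
have mX i : measurable (X @^-1` [set i]).
  case: i => a b; rewrite (_ : X @^-1` _ = (s @^-1` [set a]) `&` (s' @^-1` [set b])).
    exact: measurableI.
  by apply/seteqP; split=> t /=; rewrite /X => -[h1 h2]; [split|rewrite h1 h2].
rewrite (spectral_sum_fsum q0 hP mX (phi := fst) ul Xl)//.
rewrite (spectral_sum_fsum q0 hP mX (phi := snd) ul Xl)//.
have -> : (fun x => fsum E X l fst f x - fsum E X l snd f x) =
    fsum E X l (fun i => i.1 - i.2) f.
  apply/funext => x; rewrite /fsum -sumrB; apply: eq_bigr => i _.
  by rewrite rmorphB mulrBl.
rewrite (sqn_fsum q0 hP mX)//.
rewrite -[RHS]/(\int[smeas hP hf]_t (((X t).1 - (X t).2) ^+ 2)%:E)%E.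
rewrite (integral_fibers (smeas hP hf) (g := fun i => (i.1 - i.2) ^+ 2) mX ul Xl); last first.
  by move=> i; exact: sqr_ge0.
by apply: eq_bigr => i _; congr (_ * _)%E; apply/esym; exact: spectral_massE.
Qed.

Lemma integral_sq_addwl f (a b c : R -> R) (e : R) : L2 f -> 0 < e ->
  measurable_fun setT a -> measurable_fun setT b -> measurable_fun setT c ->
  (\int[nu f]_t ((a t - c t) ^+ 2)%:E <=
   (1 + e)%:E * \int[nu f]_t ((a t - b t) ^+ 2)%:E +
   (1 + e^-1)%:E * \int[nu f]_t ((b t - c t) ^+ 2)%:E)%E.
Proof. by move=> hf e0 ma mb mc; exact: (@integral_sq_addw _ (smeas hP hf)). Qed.

Lemma integral_sq_add2 f (a b c : R -> R) : L2 f ->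
  measurable_fun setT a -> measurable_fun setT b -> measurable_fun setT c ->
  (\int[nu f]_t ((a t - c t) ^+ 2)%:E <=
   2%:E * \int[nu f]_t ((a t - b t) ^+ 2)%:E + 2%:E * \int[nu f]_t ((b t - c t) ^+ 2)%:E)%E.
Proof.
move=> hf ma mb mc; have := integral_sq_addwl hf ltr01 ma mb mc.
by rewrite invr1; have -> : 1 + 1 = 2 :> R by lra.
Qed.

Lemma integral_sq_ge0 (a : R -> R) f : L2 f -> (0 <= \int[nu f]_t (a t ^+ 2)%:E)%E.
Proof.
move=> hf; have [m <-] := spectral_mass_measure hf.
by apply: integral_ge0 => t _; rewrite lee_fin sqr_ge0.
Qed.

(** The isometry of [spectral_sum_iso] in the limit of the simple functions that
    define L; the two triangle inequalities cost a factor 4. *)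
Lemma spectral_sum_err (s : {sfun R >-> R}) f : L2 f ->
  (sqn q (fun x => (Phi s f x - L f x)%R) <= 4%:E * \int[nu f]_t ((s t - t) ^+ 2)%:E)%E.
Proof.
move=> hf; have [sn [h1 /L2_cvgP h2]] := (proj2 hE) f hf.
have mid : measurable_fun setT (@id R) by exact: measurable_id.
have ms (s1 : {sfun R >-> R}) : measurable_fun setT s1 by exact: measurable_funPT.
have h1' : forall e : R, 0 < e -> exists N, forall n, (N <= n)%N ->
    (\int[nu f]_t ((sn n t - t) ^+ 2)%:E <= e%:E)%E.
  apply/ge0_cvg0P => // n; exact: integral_sq_ge0.
apply/lee_addgt0Pr => e e0; have e8 : 0 < e / 8 by rewrite divr_gt0.
have [N1 hN1] := h1' _ e8; have [N2 hN2] := h2 _ e8.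
set n := maxn N1 N2.
have b1 := hN1 n (leq_maxl _ _); have b2 := hN2 n (leq_maxr _ _).
apply: le_trans (sqn_sub_add2 q (Phi (sn n) f) _ _) _.
rewrite spectral_sum_iso//.
have b3 := integral_sq_add2 hf (ms s) mid (ms (sn n)).
have sw : (\int[nu f]_t ((t - sn n t) ^+ 2)%:E = \int[nu f]_t ((sn n t - t) ^+ 2)%:E)%E.
  by congr (integral _ _ _); apply/funext => t; rewrite -sqrrN opprB.
rewrite /= sw in b3.
have two0 : (0 <= 2%:E :> \bar R)%E by rewrite lee_fin.
apply: (le_trans (leeD (lee_wpmul2l two0 b3) (lee_wpmul2l two0 b2))).
set J := (\int[nu f]_t ((s t - t) ^+ 2)%:E)%E.
have J0 : (0 <= J)%E.
  exact: integral_sq_ge0.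
have i0 : (0 <= \int[nu f]_t ((sn n t - t) ^+ 2)%:E)%E.
  exact: integral_sq_ge0.
rewrite ge0_muleDr ?mule_ge0// muleA -EFinM -addeA.
have -> : 2 * 2 = 4 :> R by lra.
apply: leeD2l; rewrite muleA -EFinM.
have -> : e%:E = (4%:E * (e / 8)%:E + 2%:E * (e / 8)%:E + 2%:E * (e / 8)%:E)%E.
  by rewrite -!EFinM -!EFinD; congr EFin; field.
have -> : 2 * 2 = 4 :> R by lra.
apply: (@le_trans _ _ (4%:E * (e / 8)%:E + 2%:E * (e / 8)%:E)%E).
  by apply: leeD => //; apply: lee_wpmul2l => //; rewrite lee_fin.
rewrite leeDl// -EFinM lee_fin; lra.
Qed.

Lemma spectral_sum_cst1 f : L2 f -> Phi (cst_sfun 1) f = f.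
Proof.
move=> hf; have mX (i : unit) : measurable ((fun _ : R => tt) @^-1` [set i]).
  by rewrite (_ : _ @^-1` _ = setT)//; apply/seteqP; split=> // t _; case: i.
rewrite (spectral_sum_fsum q0 hP mX (phi := fun=> 1) (l := [:: tt]))//.
rewrite fsum_cons fsum_nil; apply/funext => x; rewrite addr0 mul1r.
by rewrite (_ : _ @^-1` _ = setT) ?(pvm_setT hP)//; apply/seteqP; split.
Qed.

(** Replacing t by the simple functions of the spectral resolution costs a
    factor 1 + e on either side. *)
Lemma integral_sub1_le f (e : R) : L2 f -> 0 < e ->
  (\int[nu f]_t ((1 - t) ^+ 2)%:E <= ((1 + e) ^+ 2)%:E * sqn q (fun x => (f x - L f x)%R))%E.
Proof.
move=> hf e0; have [sn [h1 /L2_cvgP h2]] := (proj2 hE) f hf.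
have h1' : forall e : R, 0 < e -> exists N, forall n, (N <= n)%N ->
    (\int[nu f]_t ((sn n t - t) ^+ 2)%:E <= e%:E)%E.
  by apply/ge0_cvg0P => // n; exact: integral_sq_ge0.
have ie0 : 0 < e^-1 by rewrite invr_gt0.
apply/lee_addgt0Pr => r r0.
pose r' := r / ((2 + e) * (1 + e^-1)).
have r'0 : 0 < r' by rewrite divr_gt0// mulr_gt0// addr_gt0.
have [N1 hN1] := h1' _ r'0; have [N2 hN2] := h2 _ r'0.
set n := maxn N1 N2.
have b1 := hN1 n (leq_maxl _ _); have b2 := hN2 n (leq_maxr _ _).
have mid : measurable_fun setT (@id R) by exact: measurable_id.
have ms (s1 : {sfun R >-> R}) : measurable_fun setT s1 by exact: measurable_funPT.
have b3 := integral_sq_addwl hf e0 (ms (cst_sfun 1)) (ms (sn n)) mid.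
have b4 := spectral_sum_iso (cst_sfun 1) (sn n) hf.
rewrite spectral_sum_cst1// in b4; rewrite -b4 in b3.
have b5 := sqn_addw q (fun x => f x - L f x) (fun x => L f x - Phi (sn n) f x) e0.
rewrite sqn_subC in b2.
have eq1 : (fun x => f x - L f x + (L f x - Phi (sn n) f x)) = (fun x => f x - Phi (sn n) f x).
  by apply/funext => x; rewrite addrA subrK.
rewrite eq1 in b5; apply: (le_trans b3).
set X := sqn q _ in b5 *; set Y := sqn q _ in b5 *.
set Z := sqn q _ in b2 b5; set W := integral _ _ _ in b1 *.
have e1 : 0 < 1 + e by rewrite addr_gt0.
have e2 : 0 < 1 + e^-1 by rewrite addr_gt0.
have e1' : (0 <= (1 + e)%:E)%E by rewrite lee_fin ltW.
have e2' : (0 <= (1 + e^-1)%:E)%E by rewrite lee_fin ltW.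
have {}b5 := le_trans b5 (leeD2l _ (lee_wpmul2l e2' b2)).
apply: (le_trans (leeD (lee_wpmul2l e1' b5) (lee_wpmul2l e2' b1))).
rewrite ge0_muleDr ?mule_ge0 ?sqn_ge0 ?lee_fin ?(ltW r'0)//.
rewrite !muleA -!EFinM -addeA -EFinD -[(1 + e) * (1 + e)]expr2 leeD2l// lee_fin /r'.
rewrite le_eqVlt; apply/orP; left; apply/eqP; field.
by rewrite !gt_eqF// addr_gt0.
Qed.

(** The spectrum of L lies in [0, 2] because 1 - L is a contraction. *)
Lemma spectral_mass_out f : L2 f -> nu f [set t | 1 < `|1 - t|] = 0%E.
Proof.
move=> hf; have [m mE] := spectral_mass_measure hf.
have mfun : measurable_fun setT (fun t : R => `|1 - t|).
  by apply: measurableT_comp => //; apply: measurable_funB.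
pose B (d : R) := [set t : R | 1 + d < `|1 - t|].
have mB d : measurable (B d).
  rewrite (_ : B d = (fun t : R => `|1 - t|) @^-1` `]1 + d, +oo[%classic); last first.
    by apply/seteqP; split=> t /=; rewrite in_itv/= andbT.
  by rewrite -[_ @^-1` _]setTI; apply: mfun.
suff B0 (d : R) : 0 < d -> nu f (B d) = 0%E.
  rewrite (_ : [set t | _] = \bigcup_n B n.+1%:R^-1); last first.
    apply/seteqP; split=> t /=; last first.
      by move=> [n _] /=; apply: lt_trans; rewrite ltrDl invr_gt0.
    rewrite -subr_gt0 => t0; exists (Num.truncn (`|1 - t| - 1)^-1) => //.
    rewrite /B /= -ltrBrDl invf_plt ?posrE//; exact: truncnS_gt.
  rewrite -mE; apply: measure_negligible.
    by apply: bigcupT_measurable => n.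
  apply: negligible_bigcup => n; exists (B n.+1%:R^-1); split=> //.
  by rewrite mE B0// invr_gt0.
(* On the range of E (B d) the operator 1 - L expands norms by at least 1 + d,
   whereas the previous lemma with e = d / 2 allows at most 1 + d / 2. *)
move=> d0; pose g := E (B d) f.
have hg : L2 g := pvm_L2 hP (mB d) hf.
have d2 : 0 < d / 2 by rewrite divr_gt0.
have h1 := le_trans (integral_sub1_le hg d2) _.
have {}h1 := h1 _ (lee_wpmul2l _ (L_contr hg)).
have {}h1 := h1 (eq_ind_r is_true (sqr_ge0 _) (lee_fin _ _)).
have [m' m'E] := spectral_mass_measure hg.
have mg : m' (B d) = sqn q g.
  by rewrite m'E spectral_massE /g -(pvm_setI hP)// setIid.
have h2 : (((1 + d) ^+ 2)%:E * sqn q g <= \int[m']_t ((1 - t) ^+ 2)%:E)%E.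
  rewrite -mg -(integral_cst m' (mB d)).
  have mi : measurable_fun setT (fun t : R => ((1 - t) ^+ 2)%:E).
    by apply/measurable_EFinP; apply: measurable_funX; apply: measurable_funB.
  apply: (@le_trans _ _ (\int[m']_(t in B d) ((1 - t) ^+ 2)%:E)%E).
    apply: ge0_le_integral => //.
    - by move=> t _; rewrite lee_fin sqr_ge0.
    - exact: measurable_funTS.
    move=> t /= dt; rewrite lee_fin -[(1 - t) ^+ 2]real_normK ?num_real//.
    by rewrite ler_pXn2r ?nnegrE// ?(ltW dt)// addr_ge0// ltW.
  by apply: ge0_subset_integral => // t _; rewrite lee_fin sqr_ge0.
rewrite m'E in h2; have := le_trans h2 h1.
rewrite spectral_massE -/g; have := sqn_ge0 q g.
have /inL2P := hg; case: (sqn q g) => [r _ r0||]//.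
rewrite -!EFinM !lee_fin => h; congr EFin; apply/eqP; rewrite eq_le; apply/andP; split=> //.
rewrite leNgt; apply/negP => r1; move: h; rewrite leNgt ltr_pM2r//.
rewrite ltr_pXn2r ?nnegrE//; [|by rewrite addr_ge0// ltW..].
by rewrite ltrD2l ltr_pdivrMr// ltr_pMr// ltr1n.
Qed.

Lemma integral_sq_le (a : R -> R) (c : R) f : L2 f -> measurable_fun setT a ->
  (forall t, 0 <= t <= 2 -> `|a t| <= c) ->
  (\int[nu f]_t (a t ^+ 2)%:E <= (c ^+ 2)%:E * sqn q f)%E.
Proof.
move=> hf ma ac; have out := spectral_mass_out hf.
have := spectral_massE q E f setT; rewrite (pvm_setT hP)// => <-.
have [m mE] := spectral_mass_measure hf; rewrite -mE in out *.
rewrite -(integral_cst m measurableT).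
apply: ae_ge0_le_integral => //.
- by move=> t _; rewrite lee_fin sqr_ge0.
- by apply/measurable_EFinP; apply: measurable_funX.
- by move=> t _; rewrite lee_fin sqr_ge0.
exists [set t | 1 < `|1 - t|]; split=> //.
  rewrite (_ : [set t | _] = (fun t : R => `|1 - t|) @^-1` `]1, +oo[%classic); last first.
    by apply/seteqP; split=> t /=; rewrite in_itv/= andbT.
  rewrite -[_ @^-1` _]setTI; apply: measurableT_comp => //.
  by apply: measurable_funB.
move=> t /= nt; rewrite ltNge; apply/negP => t1; apply: nt => _.
have t02 : 0 <= t <= 2 by move: t1; rewrite ler_norml => /andP[]; lra.
rewrite lee_fin -[a t ^+ 2]real_normK ?num_real//.
by rewrite ler_pXn2r ?nnegrE ?ac// (le_trans (normr_ge0 _) (ac _ t02)).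
Qed.

End spectral_calculus.

(** * The inverse square root as a Chebyshev series *)

Section inverse_square_root.
Variables (R : realType) (T : rayGraph) (q : nat).
Implicit Types (f g u v w : T -> R[i]) (t : R) (phi psi : R -> R).

(** The staircase counts the grid points j / (k + 1), with 1 <= j <= 2 (k + 1),
    that are at most t. *)
Lemma sfun_approx_id (k : nat) : exists s : {sfun R >-> R},
  [/\ s 0 = 0, forall t, 0 <= s t <= 2
    & forall t, 0 <= t <= 2 -> `|s t - t| <= k.+1%:R^-1].
Proof.
pose N := (2 * k.+1)%N; pose c : R := k.+1%:R^-1; have c0 : 0 < c by rewrite invr_gt0.
pose cnt n t := (\sum_(j < n) (j.+1%:R * c <= t)%R)%N.
pose h t := (cnt N t)%:R * c.
have hE t : h t = \sum_(j < N) \1_(`[j.+1%:R * c, +oo[%classic) t * c.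
  rewrite /h /cnt natr_sum mulr_suml; apply: eq_bigr => j _; rewrite indicE.
  by congr (_%:R * _); rewrite mem_setE in_itv/= andbT.
have mh : measurable_fun setT h.
  rewrite (_ : h = (fun t => \sum_(j < N) \1_(`[j.+1%:R * c, +oo[%classic) t * c)).
    by apply: measurable_sum => j; apply: measurable_funM.
  by apply/funext => t; exact: hE.
have cnt_le n t : (cnt n t <= n)%N.
  rewrite -[leqRHS]card_ord -sum1_card; apply: leq_sum => j _; exact: leq_b1.
have fh : finite_set (range h).
  pose vals := [seq n%:R * c | n <- iota 0 N.+1].
  apply: (@sub_finite_set _ _ [set` vals]); last exact: finite_seq.
  by move=> _ [t _ <-] /=; apply/mapP; exists (cnt N t); rewrite // mem_iota ltnS cnt_le.
pose s : {sfun R >-> R} := HB.pack h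
  (isMeasurableFun.Build _ _ _ _ h mh) (FiniteImage.Build _ _ h fh).
have cntS n t : cnt n.+1 t = (cnt n t + (n.+1%:R * c <= t)%R)%N by rewrite /cnt big_ord_recr.
have cnt_full n t : n%:R * c <= t -> cnt n t = n.
  elim: n => [|n IH] nt; first by rewrite /cnt big_ord0.
  by rewrite cntS nt IH ?addn1// (le_trans _ nt)// ler_wpM2r ?(ltW c0)// ler_nat.
have cnt_bd n t : 0 <= t <= n%:R * c -> (cnt n t)%:R * c <= t <= (cnt n t)%:R * c + c.
  move=> /andP[t0]; elim: n => [|n IH] nt.
    by rewrite /cnt big_ord0 mul0r in nt *; lra.
  rewrite cntS; have [tn|tn] := leP t (n%:R * c).
    have [e|_] := leP (n.+1%:R * c) t; last by rewrite addn0 IH.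
    have : n.+1%:R * c <= n%:R * c by exact: le_trans e tn.
    by rewrite -natr1 mulrDl mul1r; lra.
  rewrite (cnt_full _ _ (ltW tn)).
  have [e|e] := leP (n.+1%:R * c) t; rewrite ?addn1 ?addn0.
    by rewrite e; move: nt; lra.
  by rewrite (ltW tn) -[X in _ + X]mul1r -mulrDl natr1 ltW.
have Nc : N%:R * c = 2 by rewrite /N natrM /c mulfK.
exists s; split.
- rewrite -[LHS]/(h 0) /h; suff -> : cnt N 0 = 0%N by rewrite mul0r.
  rewrite /cnt big1// => j _; apply/eqP; rewrite eqb0 -ltNge.
  by rewrite mulr_gt0.
- move=> t; rewrite -[s t]/(h t) mulr_ge0 ?(ltW c0)//=.
  by rewrite -Nc ler_wpM2r ?(ltW c0)// ler_nat.
move=> t t2; have := @cnt_bd N t; rewrite Nc => /(_ t2); rewrite -/(h t) -/c.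
by rewrite -[s t]/(h t) ler_norml; lra.
Qed.

Lemma cheb_lip n : exists2 c : R, 0 <= c &
  forall s t : R, 0 <= s <= 2 -> 0 <= t <= 2 ->
    `|cheb n s| <= c /\ `|cheb n s - cheb n t| <= c * `|s - t|.
Proof.
pose P (n : nat) := exists2 c : R, 0 <= c &
  forall s t : R, 0 <= s <= 2 -> 0 <= t <= 2 ->
    `|cheb n s| <= c /\ `|cheb n s - cheb n t| <= c * `|s - t|.
suff : P n /\ P n.+1 by case.
elim: n => [|n [IH1 IH2]].
  split; [exists 1|exists 3] => // s t s2 t2 /=.
    by rewrite subrr normr0 normr1 mul1r normr_ge0.
  split; first by rewrite ler_norml; lra.
  have -> : 3 - 2 * s - (3 - 2 * t) = - 2 * (s - t) by ring.
  by rewrite normrM normrN normr_nat ler_wpM2r// ler_nat.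
split=> //; have [c1 c10 h1] := IH1; have [c2 c20 h2] := IH2.
exists (4 * c2 + c1); first by lra.
move=> s t hs ht; have [a1 b1] := h1 s t hs ht; have [a2 b2] := h2 s t hs ht.
have [_ ] := h2 t s ht hs => _; have [at2 _] := h2 t s ht hs.
have s1 : `|1 - s| <= 1 by rewrite ler_norml; lra.
rewrite !chebSS; split.
  apply: (le_trans (ler_normB _ _)); rewrite lerD// !normrM normr_nat.
  have : `|1 - s| * `|cheb n.+1 s| <= 1 * c2 by apply: ler_pM.
  by lra.
have -> : 2 * (1 - s) * cheb n.+1 s - cheb n s - (2 * (1 - t) * cheb n.+1 t - cheb n t) =
  2 * (1 - s) * (cheb n.+1 s - cheb n.+1 t) - 2 * (s - t) * cheb n.+1 t
   - (cheb n s - cheb n t) by ring.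
apply: (le_trans (ler_normB _ _)); rewrite [leRHS]mulrDl lerD//.
apply: (le_trans (ler_normB _ _)); rewrite !normrM normr_nat.
have : `|1 - s| * `|cheb n.+1 s - cheb n.+1 t| <= 1 * (c2 * `|s - t|) by apply: ler_pM.
have : `|s - t| * `|cheb n.+1 t| <= `|s - t| * c2 by apply: ler_wpM2l.
by lra.
Qed.

Hypothesis q0 : (0 < q)%N.
Variable E : set R -> (T -> R[i]) -> (T -> R[i]).
Variable L : (T -> R[i]) -> (T -> R[i]).
Hypothesis hE : spectral_resolution q L E.
Hypothesis L_L2 : forall f, inLp q 2 f -> inLp q 2 (L f).
Hypothesis L_contr : forall f, inLp q 2 f ->
  (sqn q (fun x => (f x - L f x)%R) <= sqn q f)%E.

Let hP : projection_valued_measure q E. Proof. by case: hE. Qed.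
Local Notation L2 := (inLp q 2).
Local Notation nu := (spectral_mass q E).

Section steps.
Variable r : nat -> {sfun R >-> R}.
Hypothesis r0 : forall k, r k 0 = 0.
Hypothesis r2 : forall k t, 0 <= r k t <= 2.
Hypothesis rt : forall k t, 0 <= t <= 2 -> `|r k t - t| <= k.+1%:R^-1.

Let l k : seq R := fset_set (range (r k)).
Let ul k : uniq (l k). Proof. exact: fset_uniq. Qed.
Let rl k t : r k t \in l k.
Proof. by rewrite in_fset_set// inE; exists t. Qed.
Let lr k i : i \in l k -> exists t, r k t = i.
Proof. by rewrite in_fset_set// inE => -[t _ <-]; exists t. Qed.
Let mr k i : measurable (r k @^-1` [set i]). Proof. by []. Qed.

(** The operator phi (r k), with r k in place of the spectral parameter. *)
Definition step_calc k phi f := fsum E (r k) (l k) phi f.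

Lemma step_calc_L2 k phi f : L2 f -> L2 (step_calc k phi f).
Proof. by move=> hf; apply: fsum_L2. Qed.

Lemma step_calc_one k f : L2 f -> step_calc k (fun=> 1) f = f.
Proof.
move=> hf; rewrite -[RHS](pvm_setT hP)//.
have -> : [set: R] = [set t | r k t \in l k] by apply/seteqP; split=> t //= _.
rewrite (pvm_fibers q0 hP)//; apply/funext => x.
by apply: eq_bigr => i _; rewrite mul1r.
Qed.

Lemma step_calc_bound k phi f (c : R) : L2 f ->
  (forall t, 0 <= t <= 2 -> `|phi t| <= c) ->
  (sqn q (step_calc k phi f) <= (c ^+ 2)%:E * sqn q f)%E.
Proof.
move=> hf hc; rewrite -[in leRHS](step_calc_one k hf) !(sqn_fsum q0 hP)//.
rewrite ge0_sume_distrr; last first.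
  by move=> i _; rewrite mule_ge0 ?sqn_ge0// lee_fin sqr_ge0.
rewrite big_seq [leRHS]big_seq; apply: lee_sum => i /lr[t ti].
rewrite muleA lee_wpmul2r ?sqn_ge0// -EFinM lee_fin expr1n mulr1.
have h := hc i; rewrite -ti r2 ti in h; have {}h := h isT.
rewrite -[phi i ^+ 2]real_normK ?num_real// ler_pXn2r ?nnegrE//.
exact: le_trans (normr_ge0 _) h.
Qed.

Lemma step_calcM k phi f : L2 f ->
  step_calc k id (step_calc k phi f) = step_calc k (fun t => t * phi t) f.
Proof.
move=> hf; rewrite /step_calc.
by rewrite (@fsum_fsum _ _ _ q0 _ hP _ (r k) (mr k) (l k) phi id f (ul k) hf).
Qed.

Lemma step_calcB k phi f g : L2 f -> L2 g ->
  step_calc k phi (fun x => f x - g x) =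
  (fun x => step_calc k phi f x - step_calc k phi g x).
Proof.
move=> hf hg; apply/funext => x; rewrite /step_calc /fsum -sumrB.
apply: eq_bigr => i _; rewrite -mulrBr; congr (_ * _).
have -> : (fun x => f x - g x) = (fun x => -1 * g x + f x).
  by apply/funext => y; rewrite mulN1r addrC.
by rewrite (pvm_linear hP (mr k i))//= mulN1r addrC.
Qed.

Lemma step_calc_err k f : L2 f ->
  (sqn q (fun x => (step_calc k id f x - L f x)%R) <=
   (4 * k.+1%:R^-1 ^+ 2)%:E * sqn q f)%E.
Proof.
move=> hf.
have e : spectral_sum E (r k) f = step_calc k id f.
  by rewrite (spectral_sum_fsum q0 hP (mr k) (ul k) (rl k) (s := r k) (phi := id)).
rewrite -e; apply: (le_trans (spectral_sum_err q0 hE (r k) hf)).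
rewrite EFinM -muleA; apply: lee_wpmul2l; first by rewrite lee_fin.
apply: (@integral_sq_le _ _ _ q0 _ _ hE L_contr (fun t => r k t - t)) => //.
  by apply: measurable_funB.
by move=> t t2; exact: rt.
Qed.

(** The vector v is phi (L) f, as a strong limit of step approximations. *)
Definition calc_cvg phi f v := forall e : R, 0 < e -> exists N, forall k, (N <= k)%N ->
  (sqn q (fun x => (step_calc k phi f x - v x)%R) <= e%:E)%E.

Lemma calc_cvg_one f : L2 f -> calc_cvg (fun=> 1) f f.
Proof.
move=> hf e e0; exists 0%N => k _; rewrite step_calc_one//.
have -> : (fun x => f x - f x) = (fun=> 0) by apply/funext => x; rewrite subrr.
rewrite -[leLHS](_ : 0%E = _) ?lee_fin ?ltW//.
rewrite -[LHS](@fint0 R q T).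
by apply: eq_fint => x; rewrite sqr_modulus/= expr0n addr0.
Qed.

Lemma calc_cvg_lin phi psi f v w (a b : R) : L2 f ->
  calc_cvg phi f v -> calc_cvg psi f w ->
  calc_cvg (fun t => a * phi t + b * psi t) f (fun x => a%:C * v x + b%:C * w x).
Proof.
move=> hf hv hw e e0.
pose c (d : R) := e / (4 * (d ^+ 2 + 1)).
have d0 (d : R) : 0 < d ^+ 2 + 1 by rewrite ltr_wpDl ?sqr_ge0.
have c0 d : 0 < c d by rewrite divr_gt0// mulr_gt0.
have [N hN] := hv _ (c0 a); have [M hM] := hw _ (c0 b).
exists (maxn N M) => k; rewrite geq_max => /andP[/hN h1 /hM h2].
have -> : (fun x => step_calc k (fun t => a * phi t + b * psi t) f x - (a%:C * v x + b%:C * w x)) =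
  (fun x => a%:C * (step_calc k phi f x - v x) + b%:C * (step_calc k psi f x - w x)).
  apply/funext => x; rewrite !mulrBr addrACA -opprD; congr (_ - _).
  rewrite /step_calc /fsum !mulr_sumr -big_split; apply: eq_bigr => i _ /=.
  by rewrite !mulrA -!rmorphM -mulrDl -rmorphD.
apply: (le_trans (sqn_add2 _ _ _)); rewrite !sqnZr.
have l0 (d : R) : (0 <= (d ^+ 2)%:E)%E by rewrite lee_fin sqr_ge0.
have l2 : (0 <= 2%:E :> \bar R)%E by rewrite lee_fin.
apply: (le_trans (leeD (lee_wpmul2l l2 (lee_wpmul2l (l0 a) h1))
                       (lee_wpmul2l l2 (lee_wpmul2l (l0 b) h2)))).
rewrite -!EFinM -EFinD lee_fin.
have hd (d : R) : d ^+ 2 * c d <= e / 4.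
  have -> : e / 4 = (d ^+ 2 + 1) * c d by rewrite /c; field; rewrite gt_eqF.
  by rewrite ler_wpM2r ?(ltW (c0 d))// lerDl.
by have := hd a; have := hd b; lra.
Qed.

(** Multiplication by t is the composition with the operator of r k, which
    converges strongly to L and has norm at most 2. *)
Lemma calc_cvg_mul phi f v : L2 f -> L2 v -> calc_cvg phi f v ->
  calc_cvg (fun t => t * phi t) f (L v).
Proof.
move=> hf hv hc e e0; have e16 : 0 < e / 16 by rewrite divr_gt0.
have [N hN] := hc _ e16.
have /inL2P vfin := hv; have v0 := sqn_ge0 q v.
have [s s0 sE] : exists2 s : R, 0 <= s & sqn q v = s%:E.
  by case: (sqn q v) vfin v0 => [s _ s0||]//; exists s.
pose M := Num.truncn (16 * s / e).
exists (maxn N M) => k; rewrite geq_max => /andP[Nk Mk].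
rewrite -step_calcM//.
apply: (le_trans (sqn_sub_add2 q (step_calc k id v) _ _)).
rewrite -step_calcB//; last exact: step_calc_L2.
have l2 : (0 <= 2%:E :> \bar R)%E by rewrite lee_fin.
have h1 : (sqn q (step_calc k id (fun x => (step_calc k phi f x - v x)%R)) <=
    (2 ^+ 2)%:E * (e / 16)%:E)%E.
  apply: le_trans (lee_wpmul2l _ (hN k Nk)); last by rewrite lee_fin sqr_ge0.
  apply: step_calc_bound; first by apply: inL2B => //; exact: step_calc_L2.
  by move=> t /andP[t0 t2]; rewrite ger0_norm.
have h2 := step_calc_err k hv; rewrite sE -EFinM in h2.
apply: (le_trans (leeD (lee_wpmul2l l2 h1) (lee_wpmul2l l2 h2))).
rewrite -!EFinM -EFinD lee_fin.
have -> : (2 : R) ^+ 2 = 4 by ring.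
set X := 4 * k.+1%:R^-1 ^+ 2 * s.
suff : X <= e / 4 by clearbody X; lra.
rewrite /X {X}.
have kM : 16 * s / e < k.+1%:R.
  by apply: lt_le_trans (truncnS_gt _) _; rewrite ler_nat ltnS.
have k0 : 0 < k.+1%:R :> R by [].
have ks : 16 * s <= k.+1%:R * e by rewrite -ler_pdivrMr// ltW.
have k1 : k.+1%:R^-1 <= 1 :> R by rewrite invf_le1// ler1n.
have ki : 0 < k.+1%:R^-1 :> R by rewrite invr_gt0.
have : s * k.+1%:R^-1 <= e / 16.
  by rewrite ler_pdivrMr//; move: (k.+1%:R) ks => K; lra.
have : (s * k.+1%:R^-1) * k.+1%:R^-1 <= (s * k.+1%:R^-1) * 1.
  by rewrite ler_wpM2l// mulr_ge0// ltW.
move: (k.+1%:R^-1) => I g1 g2; have -> : 4 * I ^+ 2 * s = 4 * (s * I * I) by ring.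
by lra.
Qed.

Fixpoint chebop (n : nat) f : T -> R[i] :=
  match n with
  | 0 => f
  | m.+1 => match m with
            | 0 => fun x => 3 * f x - 2 * L f x
            | k.+1 => fun x => 2 * (chebop m f x - L (chebop m f) x) - chebop k f x
            end
  end.

Lemma chebopSS n f : chebop n.+2 f =
  (fun x => 2 * (chebop n.+1 f x - L (chebop n.+1 f) x) - chebop n f x).
Proof. by []. Qed.

Definition cheb_sum (k0 : R) N t : R := k0 * \sum_(n < N) 2 / odc R n * cheb n t.

Definition chebop_sum (k0 : R) N f : T -> R[i] :=
  fun x => \sum_(n < N) (k0 * (2 / odc R n))%:C * chebop n f x.

Lemma chebop_L2 n f : L2 f -> L2 (chebop n f).
Proof.
move=> hf; suff [] : L2 (chebop n f) /\ L2 (chebop n.+1 f) by [].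
elim: n => [|n [h1 h2]].
  by split=> //=; apply: inL2B; apply: inL2Z => //; exact: L_L2.
split=> //; rewrite chebopSS; apply: inL2B => //; apply: inL2Z.
by apply: inL2B => //; exact: L_L2.
Qed.

Lemma calc_cvg_ext phi psi f v w : phi =1 psi -> v =1 w ->
  calc_cvg phi f v -> calc_cvg psi f w.
Proof. by move=> /funext -> /funext ->. Qed.

Lemma calc_cvg_cheb n f : L2 f -> calc_cvg (cheb n) f (chebop n f).
Proof.
move=> hf; suff [] : calc_cvg (cheb n) f (chebop n f) /\
  calc_cvg (cheb n.+1) f (chebop n.+1 f) by [].
have n2 : (2 : R)%:C = 2 by rewrite rmorph_nat.
have n3 : (3 : R)%:C = 3 by rewrite rmorph_nat.
elim: n => [|n [h1 h2]].
  have c1 := calc_cvg_one hf; split=> //.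
  have c2 := calc_cvg_mul hf hf c1.
  apply: calc_cvg_ext (calc_cvg_lin 3 (- 2) hf c1 c2) => [t|x] /=; first by ring.
  by rewrite rmorphN/= n2 n3 mulNr.
split=> //.
have c2 := calc_cvg_lin 1 (- 1) hf h2 (calc_cvg_mul hf (chebop_L2 n.+1 hf) h2).
apply: calc_cvg_ext (calc_cvg_lin 2 (- 1) hf c2 h1) => [t|x].
  by rewrite chebSS; ring.
by rewrite chebopSS rmorphN rmorph1 n2 !mulN1r mul1r.
Qed.

Lemma calc_cvg_sum k0 N f : L2 f -> calc_cvg (cheb_sum k0 N) f (chebop_sum k0 N f).
Proof.
move=> hf; elim: N => [|N IH].
  have c := calc_cvg_lin 0 0 hf (calc_cvg_one hf) (calc_cvg_one hf).
  apply: calc_cvg_ext c => [t|x]; first by rewrite /cheb_sum big_ord0 !mul0r mulr0 addr0.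
  by rewrite /chebop_sum big_ord0 rmorph0 !mul0r addr0.
have c := calc_cvg_lin 1 (k0 * (2 / odc R N)) hf IH (calc_cvg_cheb N hf).
apply: calc_cvg_ext c => [t|x]; first by rewrite /cheb_sum big_ord_recr/=; ring.
by rewrite /chebop_sum big_ord_recr/= rmorph1 mul1r.
Qed.

Lemma cheb_sum_lip k0 N : exists2 c : R, 0 <= c &
  forall s t : R, 0 <= s <= 2 -> 0 <= t <= 2 ->
    `|cheb_sum k0 N s - cheb_sum k0 N t| <= c * `|s - t|.
Proof.
elim: N => [|N [c c0 hc]].
  by exists 0 => // s t _ _; rewrite /cheb_sum !big_ord0 subrr normr0 mul0r.
have [d d0 hd] := cheb_lip N.
exists (c + `|k0 * (2 / odc R N)| * d); first by rewrite addr_ge0// mulr_ge0.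
move=> s t hs ht; rewrite /cheb_sum !big_ord_recr/= !mulrDr opprD addrACA.
apply: (le_trans (ler_normD _ _)); rewrite [leRHS]mulrDl.
apply: lerD; first exact: hc.
rewrite -!mulrBr mulrA normrM -mulrA.
by apply: ler_wpM2l => //; have [_] := hd s t hs ht.
Qed.

(** The polynomial [cheb_sum k0 N] is Lipschitz on [0, 2], so that a fine enough
    step is good both for the vector and, uniformly, for the function. *)
Lemma step_index k0 f : L2 f -> exists K : nat -> nat, forall N,
  (sqn q (fun x => (step_calc (K N) (cheb_sum k0 N) f x - chebop_sum k0 N f x)%R)
     <= (N.+1%:R^-1)%:E)%E /\
  forall t, 0 <= t <= 2 ->
    `|cheb_sum k0 N (r (K N) t) - cheb_sum k0 N t| <= N.+1%:R^-1.
Proof.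
move=> hf.
pose P N k := (sqn q (fun x => (step_calc k (cheb_sum k0 N) f x - chebop_sum k0 N f x)%R)
     <= (N.+1%:R^-1)%:E)%E /\
  forall t, 0 <= t <= 2 ->
    `|cheb_sum k0 N (r k t) - cheb_sum k0 N t| <= N.+1%:R^-1.
suff /choice[K hK] : forall N, exists k, P N k by exists K.
move=> N.
have n0 : 0 < N.+1%:R^-1 :> R by rewrite invr_gt0.
have [M hM] := calc_cvg_sum k0 N hf n0.
have [c c0 hc] := cheb_sum_lip k0 N.
pose J := Num.truncn (c * N.+1%:R).
exists (maxn M J); split; first by apply: hM; exact: leq_maxl.
move=> t t2; apply: (le_trans (hc _ _ (r2 _ _) t2)).
apply: (le_trans (ler_wpM2l c0 (rt _ t2))).
rewrite ler_pdivrMr// ler_pdivlMl// mulrC.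
apply: (le_trans (ltW (truncnS_gt _))); rewrite ler_nat ltnS; exact: leq_maxr.
Qed.

(** The functions s N are the Chebyshev sums evaluated on a fine enough step
    approximation. The corresponding vectors converge to u, so by isometry s N
    is a Cauchy sequence for the spectral measure; it converges pointwise to
    t ^ (-1/2) on ]0, 2], and Fatou's lemma identifies the limit. The point 0
    is negligible because s N takes the value 2 k0 N there. *)
Lemma chebop_sum_inv_sqrt_steps k0 f u : 0 < k0 ->
  (forall t, 0 < t <= 2 -> (fun N => cheb_sum k0 N t) @ \oo --> (Num.sqrt t)^-1) ->
  L2 f -> L2 u -> L2_cvg q (fun N => chebop_sum k0 N f) u -> inv_sqrt q E f u.
Proof.
move=> k00 hk hf hu /L2_cvgP hcv.
have [K hK] := step_index k0 hf.
have /choice[s hs] : forall N, exists s : {sfun R >-> R},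
    (forall t, s t = cheb_sum k0 N (r (K N) t)) /\
    spectral_sum E s f = step_calc (K N) (cheb_sum k0 N) f.
  move=> N; have [s sE] := sfun_fibers (cheb_sum k0 N) (mr (K N)) (@rl (K N)).
  exists s; split=> //.
  exact: (spectral_sum_fsum q0 hP (mr (K N)) (ul (K N)) (@rl (K N)) sE hf).
have cv : L2_cvg q (fun n => spectral_sum E (s n) f) u.
  apply/L2_cvgP => e e0; have e4 : 0 < e / 4 by rewrite divr_gt0.
  have [N hN] := hcv _ e4; exists (maxn N (Num.truncn (e / 4)^-1)) => n.
  rewrite geq_max => /andP[/hN h1 h2]; have [_ ->] := hs n.
  apply: (le_trans (sqn_sub_add2 q (chebop_sum k0 n f) _ _)).
  have -> : e%:E = (2%:E * (e / 4)%:E + 2%:E * (e / 4)%:E)%E.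
    by rewrite -!EFinM -EFinD; congr EFin; field.
  apply: leeD; apply: lee_wpmul2l; rewrite ?lee_fin//.
  apply: (le_trans (proj1 (hK n))); rewrite lee_fin.
  rewrite invf_ple ?posrE//; apply: (le_trans (ltW (truncnS_gt _))).
  by rewrite ler_nat ltnS.
exists s; split=> //.
have [m mE] := spectral_mass_measure q0 hE hf; rewrite -mE.
have ms n : measurable_fun setT (s n) by exact: measurable_funPT.
pose phi t : R := (Num.sqrt t)^-1.
have mphi : measurable_fun setT phi.
  rewrite (_ : phi = fun t => if 0 < t then t `^ (- 2^-1) else 0).
    apply: measurable_fun_ifT => //; first by apply: measurable_fun_ltr.
  apply/funext => t; rewrite /phi; case: ltP => t0; last by rewrite ler0_sqrtr// invr0.
  by rewrite powRN powR12_sqrt// ltW.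
have dist M N : (\int[m]_t ((s M t - s N t) ^+ 2)%:E)%E =
    sqn q (fun x => spectral_sum E (s M) f x - spectral_sum E (s N) f x).
  by rewrite mE -(spectral_sum_iso q0 hE).
(* Every s n takes the value 2 k0 n at 0. *)
have s0 n : s n 0 = 2 * k0 * n%:R.
  have [-> _] := hs n; rewrite r0 /cheb_sum (eq_bigr (fun=> 2)); last first.
    by move=> i _; rewrite cheb0 divfK// gt_eqF// odc_gt0.
  by rewrite sumr_const card_ord -mulr_natr; ring.
have cv' := proj1 (L2_cvgP q _ _) cv.
pose z0 : set R := [set 0].
have mz : measurable z0 by exact: measurable_set1.
have m0 : m z0 = 0%E.
  have [N hN] := cv' 1 ltr01.
  have hL n : L2 (spectral_sum E (s n) f).
    by have [_ ->] := hs n; exact: step_calc_L2.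
  have [B B0 hB] : exists2 B : R, 0 <= B & sqn q (fun x => u x - spectral_sum E (s 0%N) f x) = B%:E.
    have /inL2P := inL2B hu (hL 0%N); have := sqn_ge0 q (fun x => u x - spectral_sum E (s 0%N) f x).
    by case: (sqn q _) => [B B0 _||]//; exists B.
  have bd n : (N <= n)%N -> (((2 * k0 * n%:R) ^+ 2)%:E * m z0 <= (2 + 2 * B)%:E)%E.
    move=> Nn; rewrite -(integral_cst m mz).
    apply: (@le_trans _ _ (\int[m]_t ((s n t - s 0%N t) ^+ 2)%:E)%E).
      have mi : measurable_fun setT (fun t : R => ((s n t - s 0%N t) ^+ 2)%:E).
        by apply/measurable_EFinP; apply: measurable_funX; apply: measurable_funB.
      apply: (@le_trans _ _ (\int[m]_(t in z0) ((s n t - s 0%N t) ^+ 2)%:E)%E).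
        apply: ge0_le_integral => //.
        - by move=> t _; rewrite lee_fin sqr_ge0.
        - exact: measurable_funTS.
        by move=> t /= ->; rewrite !s0 mulr0 subr0.
      by apply: ge0_subset_integral => // t _; rewrite lee_fin sqr_ge0.
    rewrite dist; apply: (le_trans (sqn_sub_add2 q u _ _)); rewrite hB [leRHS]EFinD.
        apply: leeD; last by rewrite EFinM.
    by rewrite -[leRHS]mule1; apply: lee_wpmul2l; [rewrite lee_fin|exact: hN].
  have z0m : (0 <= m z0)%E by exact: measure_ge0.
  move: bd z0m; case: (m z0) => [x bd x0||]//.
    have x1 : 0 <= x by rewrite -lee_fin.
    congr EFin; apply/eqP; rewrite eq_le x1 andbT leNgt; apply/negP => xp.
    pose y := (2 * k0) ^+ 2 * x.
    have y0 : 0 < y by rewrite mulr_gt0// exprn_gt0// mulr_gt0.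
    pose n := maxn N (Num.truncn ((2 + 2 * B) / y)).+1.
    have n1 : (1 <= n)%N by rewrite /n leq_max orbT.
    have := bd n (leq_maxl _ _); rewrite -EFinM lee_fin leNgt => /negP; apply.
    have : (2 + 2 * B) / y < n%:R.
      by apply: lt_le_trans (truncnS_gt _) _; rewrite ler_nat leq_maxr.
    rewrite ltr_pdivrMr// => h; apply: (lt_le_trans h).
    have -> : (2 * k0 * n%:R) ^+ 2 * x = n%:R * n%:R * y by rewrite /y; ring.
    by rewrite ler_wpM2r ?(ltW y0)// ler_peMr// ler1n.
  move=> bd _; have := bd N.+1 (leqnSn N).
  by rewrite gt0_muley// lte_fin exprn_gt0// mulr_gt0// mulr_gt0.
have mout : m [set t | 1 < `|1 - t|] = 0%E by rewrite mE (spectral_mass_out q0 hE).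
pose O : set R := [set t | 1 < `|1 - t|] `|` z0.
have mOut : measurable [set t : R | 1 < `|1 - t|].
  rewrite (_ : [set t | _] = (fun t : R => `|1 - t|) @^-1` `]1, +oo[%classic); last first.
    by apply/seteqP; split=> t /=; rewrite in_itv/= andbT.
  rewrite -[_ @^-1` _]setTI; apply: measurableT_comp => //.
  by apply: measurable_funB.
have mO : measurable O by apply: measurableU.
have O0 : m O = 0%E.
  apply/eqP; rewrite eq_le measure_ge0 andbT.
  have h : (m O <= m [set t | (1 < `|1 - t|)%R] + m z0)%E by exact: measureU2.
  by rewrite mout m0 adde0 in h.
have lim t : (setT `\` O) t -> (fun M => s M t) @ \oo --> phi t.
  move=> [_ /not_orP[/negP t1 t0]].
  have t02 : 0 <= t <= 2 by move: t1; rewrite -leNgt ler_norml; lra.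
  have tp : 0 < t <= 2.
    move: t02 => /andP[t00 ->]; rewrite lt_neqAle t00 !andbT.
    by apply/eqP => e; apply: t0.
  rewrite -[phi t]addr0.
  have -> : (fun M => s M t) = (fun M => cheb_sum k0 M t + (s M t - cheb_sum k0 M t)).
    by apply/funext => M; rewrite addrC subrK.
  apply: cvgD; first exact: hk.
  have bd M : `|s M t - cheb_sum k0 M t| <= harmonic M.
    by have [-> _] := hs M; exact: (proj2 (hK M)).
  apply: (@squeeze_cvgr _ _ _ _ (fun M => - harmonic M) harmonic).
  - by near=> M; rewrite -ler_norml; exact: bd.
  - by rewrite -oppr0; apply: cvgN; exact: cvg_harmonic.
  - exact: cvg_harmonic.
apply/ge0_cvg0P => [n|e e0].
  by apply: integral_ge0 => t _; rewrite lee_fin sqr_ge0.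
have e4 : 0 < e / 4 by rewrite divr_gt0.
have [N hN] := cv' _ e4; exists N => n /hN hn.
have msq (g h : R -> R) : measurable_fun setT g -> measurable_fun setT h ->
    measurable_fun setT (fun t => ((g t - h t) ^+ 2)%:E).
  by move=> mg mh; apply/measurable_EFinP; apply: measurable_funX; apply: measurable_funB.
rewrite (ge0_negligible_integral mO measurableT (msq _ _ (ms n) mphi) _ O0); last first.
  by move=> t _; rewrite lee_fin sqr_ge0.
pose F M t := ((s n t - s (M + N)%N t) ^+ 2)%:E.
have -> : (\int[m]_(t in setT `\` O) ((s n t - phi t) ^+ 2)%:E =
    \int[m]_(t in setT `\` O) limn_einf (F ^~ t))%E.
  apply: eq_integral => t /set_mem tO; apply/esym.
  have lF : (F ^~ t) @ \oo --> ((s n t - phi t) ^+ 2)%:E.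
    apply: cvg_EFin; first by near=> M.
    have h : (fun M => s n t - s (M + N)%N t) @ \oo --> s n t - phi t.
      apply: cvgB; first exact: cvg_cst.
      by have := lim t tO; rewrite -(@cvg_shiftn N).
    rewrite expr2; apply: cvg_trans (cvgM h h); apply: near_eq_cvg; near=> M.
    by rewrite /= expr2.
  exact: (cvg_limn_einf_sup lF).1.
have mD : measurable (setT `\` O) by exact: measurableD.
apply: (le_trans (fatou m mD _ _)).
- by move=> M; apply: measurable_funTS; apply: msq.
- by move=> M t _; rewrite lee_fin sqr_ge0.
rewrite limn_einf_lim; apply: lime_le; first exact: is_cvg_einfs.
near=> M; apply: (@le_trans _ _ (\int[m]_(t in setT `\` O) F M t)%E).
  by apply: ereal_inf_lbound; exists M => //=.
apply: (@le_trans _ _ (\int[m]_t F M t)%E).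
  apply: ge0_subset_integral => //; first by apply: msq.
  by move=> t _; rewrite lee_fin sqr_ge0.
rewrite dist; apply: (le_trans (sqn_sub_add2 q u _ _)).
rewrite [X in (_ + 2%:E * X)%E]sqn_subC.
have -> : e%:E = (2%:E * (e / 4)%:E + 2%:E * (e / 4)%:E)%E.
  by rewrite -!EFinM -EFinD; congr EFin; field.
apply: leeD; apply: lee_wpmul2l; rewrite ?lee_fin//.
by apply: hN; rewrite leq_addl.
Unshelve. all: by end_near.
Qed.

End steps.

Lemma chebop_sum_inv_sqrt k0 f u : 0 < k0 ->
  (forall t, 0 < t <= 2 -> (fun N => cheb_sum k0 N t) @ \oo --> (Num.sqrt t)^-1) ->
  L2 f -> L2 u -> L2_cvg q (fun N => chebop_sum k0 N f) u -> inv_sqrt q E f u.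
Proof.
have /choice[r hr] := sfun_approx_id.
have [r0 r2 rt] : [/\ forall k, r k 0 = 0, forall k t, 0 <= r k t <= 2
    & forall k t, 0 <= t <= 2 -> `|r k t - t| <= k.+1%:R^-1].
  by split=> k; have [? ? ?] := hr k.
exact: (chebop_sum_inv_sqrt_steps r0 r2 rt).
Qed.

End inverse_square_root.

(** * Chebyshev polynomials of the flow Laplacian *)

Section laplacian.
Variables (R : realType) (T : rayGraph) (q : nat).
Implicit Types (f : T -> R[i]) (g h : T -> R) (x y z : T).
Hypothesis hT : homogeneous_tree T q.
Hypothesis hray : geodesic_ray T.
Hypothesis q0 : (0 < q)%N.

Local Notation par := (@predecessor T).
Local Notation smean := (@smean R T q).
Local Notation Lap := (@flow_laplacian R q T).

Lemma Re_sum (I : Type) (s : seq I) (F : I -> R[i]) :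
  complex.Re (\sum_(i <- s) F i) = \sum_(i <- s) complex.Re (F i).
Proof. exact: (big_morph _ (@ReD R) erefl). Qed.

Lemma Im_sum (I : Type) (s : seq I) (F : I -> R[i]) :
  complex.Im (\sum_(i <- s) F i) = \sum_(i <- s) complex.Im (F i).
Proof. exact: (big_morph _ (@ImD R) erefl). Qed.

Definition flap g x : R := g x - (g (par x) + smean g x) / 2.

Lemma complexE (z w : R[i]) : complex.Re z = complex.Re w ->
  complex.Im z = complex.Im w -> z = w.
Proof. by case: z w => [a b] [c d] /= -> ->. Qed.

Lemma flow_laplacian_par f x : Lap f x =
  f x - ((2^-1)%:C * f (par x) +
         \sum_(y <- children x) ((2 * q%:R)^-1)%:C * f y).
Proof.
have qr : 0 < q%:R :> R by rewrite ltr0n.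
have sq : 0 < Num.sqrt q%:R :> R by rewrite sqrtr_gt0.
have sx : 0 < Num.sqrt (mass R q x) by rewrite sqrtr_gt0 mass_gt0.
have sqq : Num.sqrt q%:R * Num.sqrt q%:R = q%:R :> R.
  by rewrite -expr2 sqr_sqrtr// ltW.
pose w y : R[i] := (Num.sqrt (mass R q y) / Num.sqrt (mass R q x))%:C * f y.
rewrite -[Lap f x]/(f x - _ * \sum_(y \in [set y | adj x y]) w y).
rewrite (sum_adj hT hray x w).
rewrite mulrDr mulr_sumr /w [X in _ - (X + _)]mulrA -rmorphM.
congr (_ - (_%:C * _ + _)).
  rewrite (mass_par R hT hray q0) sqrtrM ?ltW//.
  by field; rewrite !gt_eqF.
apply: eq_big_seq => y yx; rewrite mulrA -rmorphM; congr (_%:C * _).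
rewrite -(child_par hT hray yx) (mass_par R hT hray q0) sqrtrM ?(ltW qr)//.
have sy : 0 < Num.sqrt (mass R q y) by rewrite sqrtr_gt0 mass_gt0.
rewrite -{3}sqq; field; by rewrite !gt_eqF.
Qed.

Lemma Re_laplacian f x : complex.Re (Lap f x) = flap (fun y => complex.Re (f y)) x.
Proof.
rewrite flow_laplacian_par ReD ReN ReD ReM/= mul0r subr0 Re_sum /flap /smean.
rewrite (eq_bigr (fun y => (2 * q%:R)^-1 * complex.Re (f y))); last first.
  by move=> y _; rewrite ReM/= mul0r subr0.
by rewrite -mulr_sumr invfM; congr (_ - _); ring.
Qed.

Lemma Im_laplacian f x : complex.Im (Lap f x) = flap (fun y => complex.Im (f y)) x.
Proof.
rewrite flow_laplacian_par ImD ImN ImD ImM/= mul0r addr0 Im_sum /flap /smean.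
rewrite (eq_bigr (fun y => (2 * q%:R)^-1 * complex.Im (f y))); last first.
  by move=> y _; rewrite ImM/= mul0r addr0.
by rewrite -mulr_sumr invfM; congr (_ - _); ring.
Qed.

Lemma smean_sqr g x : smean g x ^+ 2 <= smean (fun y => g y ^+ 2) x.
Proof.
have := @smean_jensen R T q hT hray q0 2 (fun y => `|g y|) x (ler1n _ 2) (fun y => normr_ge0 _).
rewrite powR_mulrn ?smean_ge0// => h.
rewrite -[smean g x ^+ 2]real_normK ?num_real//.
apply: (le_trans _ (le_trans h _)).
  by rewrite ler_pXn2r ?nnegrE ?smean_ge0// norm_smean.
by apply: le_smean => y; rewrite powR_mulrn// real_normK ?num_real.
Qed.

(** V is an isometry of L^2 and A a contraction. *)
Lemma fint_half_sum_sqr g :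
  (fint q (fun x => ((g (par x) + smean g x) / 2) ^+ 2)%R <= fint q (fun x => g x ^+ 2)%R)%E.
Proof.
have s0 x : 0 <= g x ^+ 2 by exact: sqr_ge0.
have s1 x : 0 <= 2^-1 * (g (par x)) ^+ 2 by rewrite mulr_ge0// sqr_ge0.
have s2 x : 0 <= 2^-1 * smean (fun y => g y ^+ 2) x by rewrite mulr_ge0// smean_ge0.
apply: (@le_trans _ _ (fint q (fun x => 2^-1 * g (par x) ^+ 2 +
    2^-1 * smean (fun y => g y ^+ 2) x)%R)).
  apply: le_fint => x; first exact: sqr_ge0.
  have := smean_sqr g x; have := sqr_ge0 (g (par x) - smean g x).
  by rewrite !expr2; nra.
have h0 : 0 <= 2^-1 :> R by rewrite invr_ge0.
rewrite (fintD q s1 s2) (fintZ q h0 (fun x => s0 (par x))).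
rewrite (fintZ q h0 (fun x => smean_ge0 q x s0)).
have -> : fint q (fun x => smean (fun y => g y ^+ 2) x) = fint q (fun y => g y ^+ 2).
  exact: fint_smean.
have -> : fint q (fun x => g (par x) ^+ 2) = fint q (fun y => g y ^+ 2).
  exact: (fint_par hT hray q0 (F := fun x => g x ^+ 2)).
rewrite -ge0_muleDl ?lee_fin// -EFinD.
have -> : 2^-1 + 2^-1 = 1 :> R by field.
by rewrite mul1e.
Qed.

Lemma laplacian_contr f : (sqn q (fun x => (f x - Lap f x)%R) <= sqn q f)%E.
Proof.
rewrite !sqn_re_im; apply: leeD.
  apply: le_trans (fint_half_sum_sqr (fun y => complex.Re (f y))).
  rewrite le_eqVlt; apply/orP; left; apply/eqP; apply: eq_fint => x.
  by rewrite ReD ReN Re_laplacian /flap opprB addrC subrK.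
apply: le_trans (fint_half_sum_sqr (fun y => complex.Im (f y))).
rewrite le_eqVlt; apply/orP; left; apply/eqP; apply: eq_fint => x.
by rewrite ImD ImN Im_laplacian /flap opprB addrC subrK.
Qed.

Lemma laplacian_L2 f : inLp q 2 f -> inLp q 2 (Lap f).
Proof.
move=> hf; have -> : Lap f = (fun x => f x - (f x - Lap f x)).
  by apply/funext => x; rewrite opprB addrC subrK.
apply: inL2B => //; apply/inL2P; apply: (le_lt_trans (laplacian_contr f)).
exact/inL2P.
Qed.

(** The Chebyshev polynomial U_n of 1 - L: with V the composition with par and
    A the mean over the successors, so that A V = 1, it is the sum of all
    V^k A^(n-k). *)
Fixpoint updown (n : nat) g : T -> R :=
  match n with
  | 0 => g
  | m.+1 => fun x => updown m g (par x) + iter m.+1 smean g x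
  end.

Lemma updownS n g x : updown n.+1 g x = updown n g (par x) + iter n.+1 smean g x.
Proof. by []. Qed.

Lemma smean_updown n g x :
  smean (updown n.+1 g) x = updown n g x + iter n.+2 smean g x.
Proof. by rewrite -[updown n.+1 g]/(fun y => _ + _) smeanD smean_parK. Qed.

(** The sum U_n + U_(n-1) applied to g, with U_(-1) = 0. *)
Definition chebmean (n : nat) g x : R :=
  updown n g x + (if n is m.+1 then updown m g x else 0).

(** The three-term recursion, as V + A maps U_n to U_(n+1) + U_(n-1). *)
Lemma chebmeanSS n g x : chebmean n.+2 g x =
  chebmean n.+1 g (par x) + smean (chebmean n.+1 g) x - chebmean n g x.
Proof.
rewrite /chebmean smeanD smean_updown; case: n => [|n]; last first.
  by rewrite smean_updown !updownS; ring.
by rewrite !updownS /=; ring.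
Qed.

Lemma chebop_laplacian n f :
  (forall x, complex.Re (chebop Lap n f x) = chebmean n (fun y => complex.Re (f y)) x) /\
  (forall x, complex.Im (chebop Lap n f x) = chebmean n (fun y => complex.Im (f y)) x).
Proof.
pose P n := (forall x, complex.Re (chebop Lap n f x) = chebmean n (fun y => complex.Re (f y)) x) /\
  (forall x, complex.Im (chebop Lap n f x) = chebmean n (fun y => complex.Im (f y)) x).
suff : P n /\ P n.+1 by case.
have n2 (z : R[i]) : 2 * z = z + z by rewrite mulr2n mulrDl mul1r.
elim: n => [|n [IH1 [IH2 IH3]]].
  split; split=> x; rewrite /chebmean /= ?addr0//.
    have -> : 3 * f x - 2 * Lap f x = f x + (f x - Lap f x) + (f x - Lap f x) by ring.
    by rewrite !ReD !ReN Re_laplacian /flap; field.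
  have -> : 3 * f x - 2 * Lap f x = f x + (f x - Lap f x) + (f x - Lap f x) by ring.
  by rewrite !ImD !ImN Im_laplacian /flap; field.
split=> //; split=> x; rewrite chebopSS n2 chebmeanSS.
  rewrite !ReD !ReN Re_laplacian /flap.
  have -> : (fun y => complex.Re (chebop Lap n.+1 f y)) = chebmean n.+1 (fun y => complex.Re (f y)).
    by apply/funext.
  by rewrite !IH2 IH1.1; field.
rewrite !ImD !ImN Im_laplacian /flap.
have -> : (fun y => complex.Im (chebop Lap n.+1 f y)) = chebmean n.+1 (fun y => complex.Im (f y)).
  by apply/funext.
by rewrite !IH3 IH1.2; field.
Qed.

(** All terms of [updown n] other than A^n g are functions of the predecessor. *)
Lemma smean_eps_updown (eps : T -> R) n g x : (forall x, smean eps x = 0) ->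
  smean (fun y => eps y * updown n g y) x = branch q eps n g x.
Proof.
move=> e0; case: n => [//|n].
rewrite /branch -[RHS]add0r -[X in X + _](mulr0 (updown n g x)) -(e0 x).
rewrite -(smean_par hT hray) -smeanD; apply: eq_smean => y _.
by rewrite updownS; ring.
Qed.

End laplacian.

(** * L^2 convergence of the Chebyshev series *)

Section square_function.
Variables (R : realType) (T : rayGraph) (q : nat).
Implicit Types (f g h : T -> R) (x y z : T).

Lemma cvg_sum_seq (I : Type) (s : seq I) (u : I -> nat -> R) (l : I -> R) :
  (forall i, u i @ \oo --> l i) ->
  (fun n => \sum_(i <- s) u i n) @ \oo --> \sum_(i <- s) l i.
Proof.
move=> ul; elim: s => [|i s IH].
  rewrite big_nil (_ : (fun n => _) = cst 0); first exact: cvg_cst.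
  by apply/funext => n; rewrite big_nil.
rewrite big_cons (_ : (fun n => _) = (fun n => u i n + \sum_(j <- s) u j n)).
  exact: cvgD.
by apply/funext => n; rewrite big_cons.
Qed.

Lemma near_seq (I : eqType) (s : seq I) (P : I -> nat -> Prop) :
  (forall i, \forall n \near \oo, P i n) ->
  \forall n \near \oo, forall i, i \in s -> P i n.
Proof.
move=> hP; elim: s => [|i s IH]; first by near=> n.
near=> n => j; rewrite inE => /predU1P[->|]; first by near: n; exact: hP.
by move: j; near: n.
Unshelve. all: by end_near.
Qed.

(** Fatou's lemma under lower semicontinuity, which suits indicator functions
    of level sets. *)
Lemma fint_lim_inf (F : nat -> T -> R) (G : T -> R) (c : R) (N : nat) :
  (forall n x, 0 <= F n x) -> (forall x, 0 <= G x) ->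
  (forall x e, 0 < e -> \forall n \near \oo, G x <= F n x + e) ->
  (forall n, (N <= n)%N -> (fint q (F n) <= c%:E)%E) -> (fint q G <= c%:E)%E.
Proof.
move=> F0 G0 FG Fc; apply: fint_le => // s us; rewrite lee_fin.
apply/ler_addgt0Pr => e e0; pose W := \sum_(x <- s) mass R q x.
have W0 : 0 <= W by apply: sumr_ge0 => x _; exact: massr_ge0.
have W1 : 0 < W + 1 by rewrite ltr_wpDl.
have e1 : 0 < e / (W + 1) by rewrite divr_gt0.
have [M _ hM] := near_seq s (fun x => FG x _ e1).
have {}hM := hM (maxn M N) (leq_maxl _ _).
have : (fint q (F (maxn M N)) <= c%:E)%E by apply: Fc; exact: leq_maxr.
move/(le_trans (fint_fin q (F0 _) us)); rewrite lee_fin => h.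
apply: (@le_trans _ _ (\sum_(x <- s) mass R q x * F (maxn M N) x + W * (e / (W + 1)))).
  rewrite mulr_suml -big_split big_seq [leRHS]big_seq; apply: ler_sum => x xs /=.
  by rewrite -mulrDr; apply: ler_wpM2l; [exact: massr_ge0|exact: hM].
apply: lerD => //; rewrite mulrCA ler_piMr ?(ltW e0)// ler_pdivrMr// mul1r.
by rewrite lerDl.
Qed.

Lemma fint_lim (F : nat -> T -> R) (G : T -> R) (c : R) (N : nat) :
  (forall n x, 0 <= F n x) -> (forall x, (fun n => F n x) @ \oo --> G x) ->
  (forall n, (N <= n)%N -> (fint q (F n) <= c%:E)%E) -> (fint q G <= c%:E)%E.
Proof.
move=> F0 FG; apply: fint_lim_inf => // [x|x e e0].
  by apply: cvgr_to_ge (FG x) _; near=> n; exact: F0.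
near=> n; rewrite -lerBlDr; near: n; apply: (cvgr_ge (G x) (FG x)).
by rewrite ltrBlDr ltrDl.
Unshelve. all: by end_near.
Qed.

(** Pointwise limits exist for Cauchy sequences of L^2, since every vertex
    has positive mass. *)
Lemma fint_cauchy_lim (H : nat -> T -> R) (b : nat -> R) : (0 < q)%N ->
  b @ \oo --> (0 : R) ->
  (forall M N, (M <= N)%N -> (fint q (fun x => (H N x - H M x) ^+ 2)%R <= (b M)%:E)%E) ->
  exists h, (forall x, (fun N => H N x) @ \oo --> h x) /\
    forall M, (fint q (fun x => (H M x - h x) ^+ 2)%R <= (b M)%:E)%E.
Proof.
move=> q0 b0 hb.
have cv x : cvgn (fun N => H N x).
  have mx := mass_gt0 R q0 x.
  apply: cauchy_cvg; apply: cauchy_exP => e e0.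
  have me : 0 < mass R q x * e ^+ 2 by rewrite mulr_gt0// exprn_gt0.
  have [M _ hM] := cvgr_lt (0 : R) b0 _ me.
  exists (H M x); exists M => // N /= MN.
  rewrite /ball/= distrC -(@ltr_pXn2r _ 2)// ?nnegrE ?(ltW e0)// real_normK ?num_real//.
  rewrite -(ltr_pM2l mx); apply: le_lt_trans (hM M (leqnn M)).
  rewrite -lee_fin; apply: le_trans (hb M N MN).
  by apply: (fint_point q (F := fun x => (H N x - H M x) ^+ 2)) => y; exact: sqr_ge0.
exists (fun x => limn (fun N => H N x)); split=> // M.
apply: (@fint_lim (fun N x => (H M x - H N x) ^+ 2) _ _ M).
- by move=> n x; exact: sqr_ge0.
- move=> x; have h : (fun N => H M x - H N x) @ \oo --> H M x - limn (fun N => H N x).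
    by apply: cvgB; [exact: cvg_cst|exact: cv].
  rewrite expr2; apply: cvg_trans (cvgM h h); apply: near_eq_cvg; near=> n.
  by rewrite /= expr2.
move=> N MN; rewrite (@eq_fint _ q _ _ (fun x => (H N x - H M x) ^+ 2)); first exact: hb.
by move=> x; rewrite -sqrrN opprB.
Unshelve. all: by end_near.
Qed.

(** Cauchy-Schwarz against the geometric weights (3/4)^j. *)
Lemma sqr_sum_geo (J : nat) (F : nat -> R) :
  (\sum_(j < J) F j) ^+ 2 <= 4 * \sum_(j < J) (4 / 3) ^+ j * F j ^+ 2.
Proof.
elim: J F => [|J IH] F; first by rewrite !big_ord0 expr0n/= mulr0.
rewrite !big_ord_recl/= expr0 mul1r mulrDr.
have three : 0 < (3 : R) by [].
apply: (le_trans (sqr_add_le (F 0%N) (\sum_(i < J) F (bump 0 i)) three)).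
have -> : 1 + 3 = 4 :> R by ring.
rewrite lerD2l; have {}IH := IH (fun j => F j.+1).
have -> : \sum_(i < J) (4 / 3) ^+ bump 0 i * F (bump 0 i) ^+ 2 =
    4 / 3 * \sum_(i < J) (4 / 3) ^+ i * F i.+1 ^+ 2.
  by rewrite mulr_sumr; apply: eq_bigr => i _; rewrite /bump /= add1n exprS mulrA.
have -> : \sum_(i < J) F (bump 0 i) = \sum_(i < J) F i.+1 by apply: eq_bigr.
by lra.
Qed.

Lemma sqr_sum_single (I : eqType) (s : seq I) (F : I -> R) : uniq s ->
  (forall i j, i \in s -> j \in s -> F i != 0 -> F j != 0 -> i = j) ->
  (\sum_(i <- s) F i) ^+ 2 = \sum_(i <- s) F i ^+ 2.
Proof.
elim: s => [|i s IH] /=; first by rewrite !big_nil expr0n.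
move=> /andP[iNs us] h; rewrite !big_cons.
have [Fi|Fi] := eqVneq (F i) 0.
  rewrite Fi add0r expr0n add0r IH// => j k js ks; apply: h; by rewrite inE ?js ?ks orbT.
have F0 j : j \in s -> F j = 0.
  move=> js; have [//|Fj] := eqVneq (F j) 0.
  by move: iNs; rewrite (h i j _ _ Fi Fj) ?inE ?eqxx ?js ?orbT.
have -> : \sum_(j <- s) F j = 0 by rewrite big_seq big1.
have -> : \sum_(j <- s) F j ^+ 2 = 0.
  by rewrite big_seq big1// => j /F0 ->; rewrite expr0n.
by rewrite !addr0.
Qed.

Hypothesis hT : homogeneous_tree T q.
Hypothesis hray : geodesic_ray T.
Hypothesis q2 : (2 <= q)%N.
Let q0 : (0 < q)%N. Proof. exact: ltnW. Qed.

Local Notation par := (@predecessor T).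
Local Notation smean := (@smean R T q).
Local Notation updown := (@updown R T q).

(** The part of the Chebyshev series made of the U_n with coefficients c. *)
Definition udsum (c : nat -> R) N g x : R := \sum_(n < N) c n * updown n g x.

Lemma updownE n g x : updown n g x =
  \sum_(j < n.+1) iter j smean g (iter (n - j) par x).
Proof.
elim: n g x => [|n IH] g x; first by rewrite big_ord_recl big_ord0 addr0.
rewrite updownS {}IH.
have -> : \sum_(j < n.+1) iter j smean g (iter (n - j) par (par x)) =
    \sum_(j < n.+1) iter j smean g (iter (n.+1 - j) par x).
  by apply: eq_bigr => j _; rewrite -iterSr subSn// -ltnS.
by rewrite [RHS](big_ord_recr n.+1) subnn.
Qed.

Definition delta z : T -> R := fun x => (x == z)%:R.

(** Among the q ^ j descendants of w at distance j, only z contributes. *)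
Lemma iter_smean_delta j z w :
  iter j smean (delta z) w = (q%:R ^+ j)^-1 * (w == iter j par z)%:R.
Proof.
have qr : (q%:R : R) != 0 by rewrite pnatr_eq0 -lt0n.
elim: j w => [|j IH] w; first by rewrite expr0 invr1 mul1r.
rewrite iterS /smean (eq_bigr (fun y => (q%:R ^+ j)^-1 * (y == iter j par z)%:R)); last by move=> y _; exact: IH.
rewrite -mulr_sumr mulrA -invfM -exprS; congr (_ * _).
have [pw|pw] := eqVneq w (iter j.+1 par z).
  have vw : iter j par z \in children w by rewrite (mem_children hT hray) pw.
  rewrite (bigD1_seq _ vw (children_uniq w))/=.
  by rewrite eqxx big1 ?addr0// => y /negbTE ->.
rewrite big_seq big1// => y; rewrite (mem_children hT hray) => /eqP yw.
by case: eqP => // e; rewrite -yw e /= eqxx in pw.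
Qed.

Lemma fint_iter_par k (F : T -> R) : (forall x, 0 <= F x) ->
  fint q (fun x => F (iter k par x)) = fint q F.
Proof.
move=> F0; elim: k => [//|k IH]; rewrite -{}IH.
rewrite -(fint_par hT hray q0 (F := fun x => F (iter k par x)))//.
by apply: eq_fint => x; rewrite /= -iterSr.
Qed.

(** Different powers of par move x to different levels, so that at most one
    of them reaches the j-th ancestor of z. *)
Lemma fint_udsum_delta (c : nat -> R) N z :
  (fint q (fun x => udsum c N (delta z) x ^+ 2)%R <=
   (12 * mass R q z * \sum_(n < N) c n ^+ 2)%:E)%E.
Proof.
pose G j n x := c n * iter j smean (delta z) (iter (n - j) par x).
pose F j x := \sum_(n < N | (j <= n)%N) G j n x.
have udE x : udsum c N (delta z) x = \sum_(j < N) F j x.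
  rewrite /udsum /F (eq_bigr (fun n : 'I_N => \sum_(j < N | (j <= n)%N) G j n x)).
    exact: exchange_big_dep.
  move=> n _; rewrite updownE mulr_sumr.
  rewrite (big_ord_widen_cond N xpredT (fun j => c n * iter j smean (delta z) (iter (n - j) par x)))//.
have F2 j x : F j x ^+ 2 = \sum_(n < N | (j <= n)%N) G j n x ^+ 2.
  rewrite /F -!(big_filter _ (fun n : 'I_N => (j <= n)%N)).
  apply: sqr_sum_single; first by rewrite filter_uniq// index_enum_uniq.
  move=> n m; rewrite !mem_filter => /andP[jn _] /andP[jm _].
  have lev k : (j <= k)%N -> G j k x != 0 -> (k - j)%N%:Z = level z + j%:Z - level x.
    move=> jk; rewrite /G iter_smean_delta !mulf_eq0 !negb_or pnatr_eq0 eqb0 negbK.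
    move=> /andP[_ /andP[_ /eqP e]].
    have := level_iter hT hray q0 (k - j) x; rewrite e (level_iter hT hray q0) => ->.
    by rewrite addrAC subrr add0r.
  move=> /(lev n jn) e1 /(lev m jm) e2; apply/val_inj => /=.
  by move: jn jm e1 e2; clear; lia.
have qi0 j : 0 <= (q%:R ^+ j : R)^-1 by rewrite invr_ge0 exprn_ge0.
have mz := massr_ge0 R q z.
pose S := \sum_(n < N) c n ^+ 2.
have S0 : 0 <= S by apply: sumr_ge0 => n _; exact: sqr_ge0.
have F2i j : (fint q (fun x => F j x ^+ 2)%R <= ((q%:R ^+ j)^-1 * mass R q z * S)%:E)%E.
  rewrite (@eq_fint _ q _ _ (fun x => \sum_(n <- [seq n <- index_enum 'I_N | (j <= nat_of_ord n)%N]) G j (nat_of_ord n) x ^+ 2)); last first.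
    by move=> x; rewrite F2 big_filter.
  rewrite fint_sum; last by move=> n x; exact: sqr_ge0.
  rewrite big_filter mulr_sumr -sumEFin big_mkcond/=; apply: lee_sum => n _.
  case: ifP => _; last by rewrite lee_fin mulr_ge0 ?sqr_ge0// mulr_ge0.
  rewrite (fint_iter_par (n - j) (F := fun y => (c n * iter j smean (delta z) y) ^+ 2)); last first.
    by move=> x; exact: sqr_ge0.
  rewrite (fint1 q (x := iter j par z)); last 2 first.
  - by move=> y; exact: sqr_ge0.
  - by move=> y yz; rewrite iter_smean_delta (negbTE yz) !mulr0 expr0n.
  rewrite lee_fin iter_smean_delta eqxx mulr1 (mass_iter R hT hray q0).
  rewrite le_eqVlt; apply/orP; left; apply/eqP; field.
  by rewrite expf_neq0// pnatr_eq0 -lt0n.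
apply: (@le_trans _ _ (fint q (fun x => \sum_(j < N) 4 * (4 / 3) ^+ j * F j x ^+ 2)%R)).
  apply: le_fint => x; first exact: sqr_ge0.
  rewrite udE; apply: (le_trans (sqr_sum_geo N (F^~ x))).
  by rewrite mulr_sumr; apply: ler_sum => j _; rewrite mulrA.
have p0 j : 0 <= 4 * (4 / 3) ^+ j :> R by rewrite mulr_ge0// exprn_ge0// divr_ge0.
rewrite fint_sum; last by move=> j x; rewrite mulr_ge0// sqr_ge0.
(* The j-th term is at most 4 (4/3)^j q^(-j), hence 4 (2/3)^j, and the sum of
   the latter is 12. *)
apply: (@le_trans _ _ (\sum_(j < N) ((4 * (2 / 3) ^+ j) * (mass R q z * S))%:E)%E).
  apply: lee_sum => j _; rewrite fintZ//; last by move=> x; exact: sqr_ge0.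
  apply: (le_trans (lee_wpmul2l _ (F2i j))); first by rewrite lee_fin.
  rewrite -EFinM lee_fin -!mulrA ler_wpM2l// !mulrA -[leLHS]mulrA -[leRHS]mulrA.
  apply: ler_wpM2r; first exact: mulr_ge0.
  rewrite -exprVn -exprMn.
  have qi : (q%:R : R)^-1 <= 2^-1 by rewrite lef_pV2 ?posrE// ?ltr0n// ler_nat.
  have qi1 : 0 <= (q%:R : R)^-1 by rewrite invr_ge0.
  by apply: lerXn2r; rewrite ?nnegrE; lra.
rewrite sumEFin lee_fin -mulr_suml -!mulrA [12 * _](_ : _ = 12 * (mass R q z * S))//.
apply: ler_wpM2r; first exact: mulr_ge0.
have geo M : \sum_(j < M) 4 * (2 / 3) ^+ j = 12 - 12 * (2 / 3) ^+ M :> R.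
  elim: M => [|M IH]; first by rewrite big_ord0 expr0; ring.
  by rewrite big_ord_recr/= IH exprS; field.
by rewrite geo lerBlDr lerDl mulr_ge0// exprn_ge0// divr_ge0.
Qed.

Lemma iter_smean_lin n (a : R) f g x :
  iter n smean (fun y => a * f y + g y) x = a * iter n smean f x + iter n smean g x.
Proof.
elim: n x => [//|n IH] x; rewrite !iterS -smeanZ -smeanD.
by apply: eq_smean => y _; exact: IH.
Qed.

Lemma udsum_lin c N (a : R) f g x :
  udsum c N (fun y => a * f y + g y) x = a * udsum c N f x + udsum c N g x.
Proof.
rewrite /udsum mulr_sumr -big_split; apply: eq_bigr => n _ /=.
rewrite mulrCA -mulrDr; congr (_ * _); rewrite !updownE mulr_sumr -big_split.
by apply: eq_bigr => j _; exact: iter_smean_lin.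
Qed.

(** By induction on the support, from the case of a single vertex. *)
Lemma fint_udsum (s : seq T) g : (forall x, x \notin s -> g x = 0) ->
  exists2 C : R, 0 <= C & forall c N,
    (fint q (fun x => udsum c N g x ^+ 2)%R <= (C * \sum_(n < N) c n ^+ 2)%:E)%E.
Proof.
elim: s g => [|z s IH] g gs.
  exists 0 => // c N; rewrite mul0r.
  rewrite (@eq_fint _ q _ _ (fun=> 0)) ?fint0// => x; rewrite /udsum big1 ?expr0n// => n _.
  rewrite updownE big1 ?mulr0// => j _.
  rewrite -[RHS](iter_smean0 R q j (iter (n - j) par x)).
  by congr (iter j smean _ _); apply/funext => y; rewrite gs.
pose h x := if x == z then 0 else g x.
have hs x : x \notin s -> h x = 0.
  by move=> xs; rewrite /h; case: ifPn => // xz; rewrite gs// inE negb_or xz.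
have [C C0 hC] := IH h hs.
have mz := massr_ge0 R q z.
have gE : g = (fun y => g z * delta z y + h y).
  apply/funext => y; rewrite /h /delta; have [->|_] := eqVneq y z.
    by rewrite mulr1 addr0.
  by rewrite mulr0 add0r.
exists (2 * g z ^+ 2 * (12 * mass R q z) + 2 * C).
  apply: addr_ge0; last exact: mulr_ge0.
  by apply: mulr_ge0; apply: mulr_ge0 => //; exact: sqr_ge0.
move=> c N; set S := \sum_(n < N) c n ^+ 2.
pose A x := udsum c N (delta z) x ^+ 2; pose B x := udsum c N h x ^+ 2.
have A0 x : 0 <= A x by exact: sqr_ge0.
have B0 x : 0 <= B x by exact: sqr_ge0.
have k0 : 0 <= 2 * g z ^+ 2 by rewrite mulr_ge0// sqr_ge0.
apply: (@le_trans _ _ (fint q (fun x => 2 * g z ^+ 2 * A x + 2 * B x)%R)).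
  apply: le_fint => x; first exact: sqr_ge0.
  rewrite {1}gE udsum_lin /A /B.
  by have := sqr_ge0 (g z * udsum c N (delta z) x - udsum c N h x); nra.
rewrite fintD; [|by move=> x; exact: mulr_ge0..].
rewrite !fintZ// [X in (_ <= X%:E)%E]mulrDl [leRHS]EFinD; apply: leeD.
  rewrite -mulrA [leRHS]EFinM; apply: lee_wpmul2l; first by rewrite lee_fin.
  exact: fint_udsum_delta.
by rewrite -mulrA [leRHS]EFinM; apply: lee_wpmul2l; [rewrite lee_fin|exact: hC].
Qed.

(** Comparison with the telescoping sum of the 2 / (n + 1) - 2 / (n + 2). *)
Lemma sum_sqr_tail (c : nat -> R) K M N : (M <= N)%N ->
  (forall n, 0 <= c n <= K / n.+1%:R) ->
  \sum_(n < N) (if (M <= n)%N then c n else 0) ^+ 2 <= K ^+ 2 * (2 / M.+1%:R).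
Proof.
move=> /subnKC <- cK; pose d n := 2 / (n.+1%:R : R).
suff : forall k, \sum_(n < M + k) (if (M <= n)%N then c n else 0) ^+ 2 <=
    K ^+ 2 * (d M - d (M + k)%N).
  move=> /(_ (N - M)%N) h; apply: (le_trans h); apply: ler_wpM2l; first exact: sqr_ge0.
  by rewrite lerBlDr lerDl divr_ge0.
elim=> [|k IH].
  rewrite addn0 subrr mulr0 big1// => n _.
  by rewrite leqNgt ltn_ord expr0n.
rewrite addnS big_ord_recr/= leq_addr.
have /andP[c0 ck] := cK (M + k)%N.
set n := (M + k)%N in IH c0 ck *.
have n1 : 0 < n.+1%:R :> R by [].
have n2 : 0 < n.+2%:R :> R by [].
have h1 : c n ^+ 2 <= K ^+ 2 * (n.+1%:R^-1) ^+ 2.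
  by rewrite -exprMn ler_pXn2r ?nnegrE// (le_trans c0 ck).
have h2 : (n.+1%:R^-1) ^+ 2 <= d n - d n.+1.
  have x1 : 1 <= n.+1%:R :> R by rewrite ler1n.
  rewrite /d -[n.+2%:R]natr1; move: (n.+1%:R) n1 x1 => X X0 X1.
  have -> : 2 / X - 2 / (X + 1) = X^-1 * (2 / (X + 1)).
    by field; rewrite !gt_eqF// addr_gt0.
  rewrite expr2; apply: ler_wpM2l; first by rewrite invr_ge0 ltW.
  rewrite ler_pdivlMr ?addr_gt0// mulrC ler_pdivrMr//; lra.
have h3 := ler_wpM2l (sqr_ge0 K) h2.
have -> : d M - d n.+1 = (d M - d n) + (d n - d n.+1) by rewrite addrA subrK.
by rewrite mulrDr; apply: lerD => //; exact: le_trans h1 h3.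
Qed.

Lemma udsum_cvg (s : seq T) g (c : nat -> R) (K : R) : (forall x, x \notin s -> g x = 0) ->
  (forall n, 0 <= c n <= K / n.+1%:R) ->
  exists h, (forall x, (fun N => udsum c N g x) @ \oo --> h x) /\
    exists2 b : nat -> R, b @ \oo --> (0 : R) &
      forall N, (fint q (fun x => (udsum c N g x - h x) ^+ 2)%R <= (b N)%:E)%E.
Proof.
move=> gs cK; have [C C0 hC] := fint_udsum gs.
pose b M := C * (K ^+ 2 * (2 / M.+1%:R)).
have b0 : b @ \oo --> (0 : R).
  have h : (fun n => C * K ^+ 2 * 2 * harmonic n) @ \oo --> C * K ^+ 2 * 2 * (0 : R).
    by apply: cvgMl_tmp; exact: cvg_harmonic.
  rewrite mulr0 in h.
  by apply: cvg_trans h; apply: near_eq_cvg; near=> n; rewrite /b /=; ring.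
have [|h [h1 h2]] := @fint_cauchy_lim (fun N => udsum c N g) b q0 b0.
  move=> M N MN; pose c' n := if (M <= n)%N then c n else 0.
  rewrite (@eq_fint _ q _ _ (fun x => udsum c' N g x ^+ 2)).
    apply: (le_trans (hC c' N)); rewrite lee_fin ler_wpM2l//.
    exact: sum_sqr_tail.
  move=> x; congr (_ ^+ 2); rewrite /udsum /c'.
  have -> : \sum_(n < M) c n * updown n g x =
      \sum_(n < N) (if (n < M)%N then c n * updown n g x else 0).
    by rewrite (big_ord_widen N (fun n => c n * updown n g x) MN) big_mkcond.
  rewrite -sumrB.
  by apply: eq_bigr => n _; case: ltnP => _; rewrite ?subrr ?subr0 ?mul0r.
by exists h; split=> //; exists b.
Unshelve. all: by end_near.
Qed.

End square_function.

(** * The limit operator on real functions *)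

Section riesz_real.
Variables (R : realType) (T : rayGraph) (q : nat).
Implicit Types (f g h F : T -> R) (x y z : T).
Hypothesis hT : homogeneous_tree T q.
Hypothesis hray : geodesic_ray T.
Hypothesis q2 : (2 <= q)%N.
Let q0 : (0 < q)%N. Proof. exact: ltnW. Qed.

Local Notation par := (@predecessor T).
Local Notation smean := (@smean R T q).

Definition square_fint f : Prop := (fint q (fun x => f x ^+ 2)%R < +oo)%E.

Lemma square_fint_lin (c : R) f g : square_fint f -> square_fint g ->
  square_fint (fun x => c * f x + g x).
Proof.
rewrite /square_fint => hf hg.
have s0 h x : 0 <= h x ^+ 2 by exact: sqr_ge0.
have c0 : 0 <= 2 * c ^+ 2 by rewrite mulr_ge0// sqr_ge0.
have s1 x : 0 <= 2 * c ^+ 2 * f x ^+ 2 by exact: mulr_ge0.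
have s2 x : 0 <= 2 * g x ^+ 2 by exact: mulr_ge0.
apply: (@le_lt_trans _ _ (fint q (fun x => 2 * c ^+ 2 * f x ^+ 2 + 2 * g x ^+ 2)%R)).
  apply: le_fint => x; first exact: sqr_ge0.
  by have := sqr_ge0 (c * f x - g x); nra.
rewrite (fintD q s1 s2) (fintZ q c0 (s0 f)) (fintZ q _ (s0 g))//.
have := fint_ge0 q (s0 f); have := fint_ge0 q (s0 g).
by case: (fint q _) hf => [r||]//; case: (fint q _) hg => [r'||]// *; rewrite -!EFinM -EFinD ltry.
Qed.

Lemma iter_smean_sqr n f x : iter n smean f x ^+ 2 <= iter n smean (fun y => f y ^+ 2) x.
Proof.
elim: n x => [//|n IH] x; rewrite !iterS.
by apply: (le_trans (smean_sqr hT hray q0 _ x)); apply: le_smean => y; exact: IH.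
Qed.

(** The left-hand side is the integral of F over the first N generations of
    descendants of x. *)
Lemma sum_iter_smean_le F N x : (forall y, 0 <= F y) ->
  ((mass R q x * \sum_(n < N) iter n smean F x)%:E <= fint q F)%E.
Proof.
move=> F0; pose G y : R := F y * \1_(trapezoid x 0 N) y.
have G0 y : 0 <= G y by rewrite mulr_ge0// indicE.
have Gs : supported (trapezoid x 0 N) G.
  by move=> y ny; rewrite /G indicE memNset// mulr0.
apply: (@le_trans _ _ (fint q G)); last first.
  by apply: le_fint => // y; rewrite /G ler_piMr// indicE lern1 leq_b1.
rewrite (fint_trapezoid hT hray q0 G0 Gs) lee_fin ler_wpM2l ?massr_ge0//.
apply: ler_sum => n _; rewrite add0n (iter_smean_local hT hray (g := G))// => z zx.
by rewrite /G indicE mem_set ?mulr1//; exists (nat_of_ord n) => //=.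
Qed.

Section riesz.
Variables (e : T -> R) (M : R).
Hypothesis eM : forall x, `|e x| <= M.
Hypothesis e0 : forall x, smean e x = 0.
Variables (a : nat -> R) (K : R).
Hypothesis K0 : 0 < K.
Hypothesis a0 : forall n, 0 < a n.
Hypothesis a_dec : forall m n, (m <= n)%N -> a n <= a m.
Hypothesis aK : forall n, a n <= K / n.+1%:R.

Local Notation psum := (@psum R T q e a).
Local Notation branch := (@branch R T q e).

Lemma branch_sqr n f x :
  branch n f x ^+ 2 <= M ^+ 2 * iter n.+1 smean (fun y => f y ^+ 2) x.
Proof.
apply: (le_trans (smean_sqr hT hray q0 _ x)); rewrite iterS -smeanZ.
apply: le_smean => y; rewrite exprMn; apply: ler_pM; rewrite ?sqr_ge0//.
  rewrite -[e y ^+ 2]real_normK ?num_real// ler_pXn2r ?nnegrE//.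
  exact: le_trans (normr_ge0 _) (eM y).
exact: iter_smean_sqr.
Qed.

(** The squares of the [branch n f x] are summable by [sum_iter_smean_le], and so
    are those of the coefficients. *)
Lemma psum_cvg f x : square_fint f -> cvgn (fun N => psum N f x).
Proof.
rewrite /square_fint => hf; have s0 y : 0 <= f y ^+ 2 by exact: sqr_ge0.
have [I I0 IE] : exists2 I : R, 0 <= I & fint q (fun y => f y ^+ 2) = I%:E.
  have := fint_ge0 q s0; case: (fint q _) hf => [I _ I0||]//; by exists I.
have mx := mass_gt0 R q0 x.
pose u n := a n * branch n f x.
have -> : (fun N => psum N f x) = series u.
  by apply/funext => N; rewrite /psum /series/= big_mkord.
apply: normed_cvg; apply: nondecreasing_is_cvgn.
  by apply: (@nondecreasing_series R (fun n => `|u n|) xpredT) => n _ _; exact: normr_ge0.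
exists (K ^+ 2 * 2 + M ^+ 2 * (I / mass R q x)) => _ [N _ <-].
rewrite -[leLHS]/(\sum_(0 <= n < N) `|u n|) big_mkord.
apply: (@le_trans _ _ (\sum_(n < N) a n ^+ 2 + \sum_(n < N) branch n f x ^+ 2)).
  rewrite -big_split; apply: ler_sum => n _ /=; rewrite /u normrM.
  rewrite -[a n ^+ 2]real_normK ?num_real// -[branch n f x ^+ 2]real_normK ?num_real//.
  by have := sqr_ge0 (`|a n| - `|branch n f x|); have := normr_ge0 (a n);
     have := normr_ge0 (branch n f x); nra.
apply: lerD.
  have := @sum_sqr_tail R a K 0 N (leq0n _); rewrite divr1; apply => n.
  by rewrite (ltW (a0 n)) aK.
apply: (@le_trans _ _ (\sum_(n < N) M ^+ 2 * iter n.+1 smean (fun y => f y ^+ 2) x)).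
  by apply: ler_sum => n _; exact: branch_sqr.
rewrite -mulr_sumr ler_wpM2l ?sqr_ge0// ler_pdivlMr// mulrC.
have := sum_iter_smean_le N.+1 x s0; rewrite IE lee_fin; apply: le_trans.
by rewrite ler_wpM2l ?(ltW mx)// big_ord_recl/= lerDr.
Qed.

Definition riesz f x : R := limn (fun N => psum N f x).

Lemma riesz_cvg f x : square_fint f -> (fun N => psum N f x) @ \oo --> riesz f x.
Proof. by move=> hf; exact: psum_cvg. Qed.

Lemma psum_lin N (c : R) f g x :
  psum N (fun y => c * f y + g y) x = c * psum N f x + psum N g x.
Proof.
rewrite /psum mulr_sumr -big_split; apply: eq_bigr => n _ /=.
rewrite [X in _ = X + _]mulrCA -mulrDr; congr (_ * _).
rewrite /branch -smeanZ -smeanD.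
by apply: eq_smean => y _; rewrite iter_smean_lin; ring.
Qed.

Lemma riesz_lin (c : R) f g : square_fint f -> square_fint g ->
  riesz (fun x => c * f x + g x) = (fun x => c * riesz f x + riesz g x).
Proof.
move=> hf hg; apply/funext => x; apply/cvg_lim => //.
rewrite (_ : (fun N => _) = (fun N => c * psum N f x + psum N g x)).
  by apply: cvgD; [apply: cvgMl_tmp|]; exact: riesz_cvg.
by apply/funext => N; rewrite psum_lin.
Qed.

(** The tangent line inequality provides the lower semicontinuity of the p-th
    power along the partial sums. *)
Lemma riesz_Lp p : 1 < p -> exists2 C, 0 < C & forall f, square_fint f ->
  (fint q (fun x => `|riesz f x| `^ p)%R <= C%:E * fint q (fun x => `|f x| `^ p)%R)%E.
Proof.
move=> p1; have aK' n : 0 < a n <= K / n.+1%:R by rewrite a0 aK.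
have [C C0 hC] := psum_Lp hT hray q0 eM e0 p1 K0 aK'.
exists (C + 1); first by rewrite ltr_wpDl.
move=> f hf; have f0 x : 0 <= `|f x| `^ p by exact: powR_ge0.
have := fint_ge0 q f0; case fE : (fint q _) => [I||]// I0; last first.
  by rewrite gt0_muley ?leey// lte_fin ltr_wpDl.
rewrite -EFinM; apply: (@fint_lim_inf _ _ _ (fun N x => `|psum N f x| `^ p) _ _ 0).
- by move=> N x; exact: powR_ge0.
- by move=> x; exact: powR_ge0.
- move=> x d d0; have cv : (fun N => `|psum N f x|) @ \oo --> `|riesz f x|.
    by apply: cvg_norm; exact: riesz_cvg.
  set l := `|riesz f x| in cv *; pose k := p * l `^ (p - 1).
  have k0 : 0 <= k by rewrite mulr_ge0 ?powR_ge0//; lra.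
  have k1 : 0 < k + 1 by rewrite ltr_wpDl.
  have dk : 0 < d / (k + 1) by rewrite divr_gt0.
  have lz : l - d / (k + 1) < l by rewrite ltrBlDr ltrDl.
  have ev := cvgr_ge l cv (l - d / (k + 1)) lz.
  near=> N; have l1 : l - d / (k + 1) <= `|psum N f x| by near: N; exact: ev.
  have := powR_tangent (normr_ge0 (psum N f x)) (normr_ge0 (riesz f x)) (ltW p1).
  rewrite -/l -/k => h.
  have : k * (l - `|psum N f x|) <= k * (d / (k + 1)) by apply: ler_wpM2l => //; lra.
  have : k * (d / (k + 1)) <= d.
    by rewrite mulrCA ler_piMr ?(ltW d0)// ler_pdivrMr// mul1r lerDl.
  lra.
move=> N _; apply: (le_trans (hC N f)); rewrite fE -EFinM lee_fin ler_wpM2r//.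
by rewrite lerDl.
Unshelve. all: by end_near.
Qed.

(** Strict inequalities persist along the partial sums, so that the indicator
    of the level set is lower semicontinuous. *)
Lemma riesz_weak : exists2 C, 0 < C & forall lam f, 0 < lam -> square_fint f ->
  (fint q (\1_[set x | (lam < `|riesz f x|)%R] : T -> R) <=
    (C / lam)%:E * fint q (fun x => `|f x|)%R)%E.
Proof.
have [C C0 hC] := weak_psum hT hray q2 eM e0 K0 a0 a_dec aK.
exists C => // lam f l0 hf.
have Cl : 0 < C / lam by rewrite divr_gt0.
have := fint_ge0 q (fun x => normr_ge0 (f x)); case fE : (fint q _) => [I||]// I0; last first.
  by rewrite gt0_muley ?leey.
rewrite -EFinM.
apply: (@fint_lim_inf _ _ _ (fun N => \1_[set x | (lam < `|psum N f x|)%R]) _ _ 0).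
- by move=> N x; rewrite indicE.
- by move=> x; rewrite indicE.
- move=> x d d0; rewrite !indicE; have [lx|lx] := ltP lam `|riesz f x|; last first.
    near=> N; rewrite memNset /= ?addr_ge0 ?(ltW d0)//.
    by apply/negP; rewrite -leNgt.
  have cv : (fun N => `|psum N f x|) @ \oo --> `|riesz f x|.
    by apply: cvg_norm; exact: riesz_cvg.
  have ev := cvgr_gt `|riesz f x| cv lam lx.
  near=> N; have lN : lam < `|psum N f x| by near: N; exact: ev.
  by rewrite mem_set// indicE mem_set// lerDl ltW.
by move=> N _; rewrite EFinM -fE; exact: hC.
Unshelve. all: by end_near.
Qed.

End riesz.
End riesz_real.

(** * The Riesz transform *)

Section riesz_transform_tree.
Variables (R : realType) (T : rayGraph) (q : nat).
Implicit Types (f u : T -> R[i]) (g h : T -> R) (x y z : T).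
Hypothesis hT : homogeneous_tree T q.
Hypothesis hray : geodesic_ray T.
Hypothesis q2 : (2 <= q)%N.
Let q0 : (0 < q)%N. Proof. exact: ltnW. Qed.

Local Notation smean := (@smean R T q).
Local Notation re f := (fun x => complex.Re (f x)).
Local Notation im f := (fun x => complex.Im (f x)).

Section coefficients.
Variable k0 : R.
Hypothesis k0_gt0 : 0 < k0.

Definition chebc n : R := k0 * (2 / odc R n).
Definition rieszc n : R := chebc n + chebc n.+1.

Lemma chebc_dec m n : (m <= n)%N -> chebc n <= chebc m.
Proof.
move=> mn; rewrite ler_wpM2l ?(ltW k0_gt0)// ler_wpM2l//.
by rewrite lef_pV2 ?posrE ?odc_gt0// /odc lerD2r ler_wpM2l// ler_nat.
Qed.

Lemma chebc_gt0 n : 0 < chebc n.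
Proof. by rewrite mulr_gt0// divr_gt0// odc_gt0. Qed.

Lemma chebc_le n : chebc n <= 2 * k0 / n.+1%:R.
Proof.
rewrite /chebc [2 * k0]mulrC -mulrA ler_wpM2l ?(ltW k0_gt0)// ler_wpM2l//.
rewrite lef_pV2 ?posrE ?odc_gt0// /odc -natr1 lerD2r.
by rewrite mulr2n mulrDl mul1r lerDl.
Qed.

Lemma rieszc_gt0 n : 0 < rieszc n.
Proof. by rewrite addr_gt0 ?chebc_gt0. Qed.

Lemma rieszc_dec m n : (m <= n)%N -> rieszc n <= rieszc m.
Proof. by move=> mn; apply: lerD; apply: chebc_dec. Qed.

Lemma rieszc_le n : rieszc n <= 4 * k0 / n.+1%:R.
Proof.
have h := chebc_le n.
have -> : 4 * k0 / n.+1%:R = 2 * k0 / n.+1%:R + 2 * k0 / n.+1%:R by ring.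
by apply: lerD => //; exact: le_trans (chebc_dec (leqnSn n)) h.
Qed.

Definition cheb_mean_sum N g x : R := \sum_(n < N) chebc n * chebmean q n g x.

(** The shift by one index between the two sums is why the coefficients of the
    Riesz transform are sums of two consecutive ones. *)
Lemma cheb_mean_sumS N g x : cheb_mean_sum N.+1 g x =
  udsum q chebc N.+1 g x + udsum q (fun n => chebc n.+1) N g x.
Proof.
rewrite /cheb_mean_sum /udsum /chebmean.
under eq_bigr do rewrite mulrDr.
rewrite big_split; congr (_ + _).
by rewrite big_ord_recl/= mulr0 add0r.
Qed.

Lemma cvg_smean (F : nat -> T -> R) g x :
  (forall y, (fun N => F N y) @ \oo --> g y) ->
  (fun N => smean (F N) x) @ \oo --> smean g x.
Proof.
move=> Fg; have h : (fun N => \sum_(y <- children x) F N y) @ \oo -->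
    \sum_(y <- children x) g y.
  exact: (@cvg_sum_seq R _ (children x) (fun y N => F N y)).
by apply: cvgMl_tmp; exact: h.
Qed.

Lemma smean_udsum (e : T -> R) c N g x : (forall x, smean e x = 0) ->
  smean (fun y => e y * udsum q c N g y) x = psum q e c N g x.
Proof.
move=> e0; rewrite /psum.
rewrite (@eq_smean R T q _ (fun y => \sum_(n < N) c n * (e y * updown q n g y)) x).
  rewrite smean_sum; apply: eq_bigr => n _.
  by rewrite smeanZ (smean_eps_updown hT hray).
by move=> y _; rewrite mulr_sumr; apply: eq_bigr => n _; rewrite mulrCA.
Qed.

(** The two halves of the Chebyshev series converge separately by [udsum_cvg],
    and taking the weighted gradient commutes with their pointwise limits. *)
Lemma cheb_mean_sum_lim (s : seq T) g : (forall x, x \notin s -> g x = 0) ->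
  exists h, (forall e x, (forall x, smean e x = 0) ->
      riesz q e rieszc g x = smean (fun y => e y * h y) x) /\
    (forall d : R, 0 < d -> exists N, forall n, (N <= n)%N ->
      (fint q (fun x => (cheb_mean_sum n g x - h x) ^+ 2)%R <= d%:E)%E).
Proof.
move=> gs.
have c1 n : 0 <= chebc n <= 2 * k0 / n.+1%:R by rewrite (ltW (chebc_gt0 n)) chebc_le.
have c2 n : 0 <= chebc n.+1 <= 2 * k0 / n.+1%:R.
  by rewrite (ltW (chebc_gt0 _)) (le_trans (chebc_dec (leqnSn n)))// chebc_le.
have [h1 [cv1 [b1 b10 hb1]]] := udsum_cvg hT hray q2 gs c1.
have [h2 [cv2 [b2 b20 hb2]]] := udsum_cvg hT hray q2 gs c2.
exists (fun x => h1 x + h2 x); split=> [e x e0|d d0].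
  apply/cvg_lim => //.
  have -> : (fun N => psum q e rieszc N g x) = (fun N => smean (fun y =>
      e y * (udsum q chebc N g y + udsum q (fun n => chebc n.+1) N g y)) x).
    apply/funext => N; rewrite -smean_udsum//; apply: eq_smean => y _.
    rewrite -[in RHS]big_split; congr (_ * _); apply: eq_bigr => n _.
    by rewrite /= -mulrDl.
  by apply: cvg_smean => y; apply: cvgMl_tmp; apply: cvgD.
have d4 : 0 < d / 4 by rewrite divr_gt0.
have [N1 _ hN1] := cvgr_lt (0 : R) b10 _ d4.
have [N2 _ hN2] := cvgr_lt (0 : R) b20 _ d4.
exists (maxn N1 N2).+1 => -[//|n]; rewrite ltnS geq_max => /andP[n1 n2].
pose A x := (udsum q chebc n.+1 g x - h1 x) ^+ 2.
pose B x := (udsum q (fun n => chebc n.+1) n g x - h2 x) ^+ 2.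
have A0 x : 0 <= 2 * A x by rewrite mulr_ge0// sqr_ge0.
have B0 x : 0 <= 2 * B x by rewrite mulr_ge0// sqr_ge0.
apply: (@le_trans _ _ (fint q (fun x => 2 * A x + 2 * B x)%R)).
  apply: le_fint => x; first exact: sqr_ge0.
  rewrite cheb_mean_sumS /A /B.
  set a := udsum _ _ _ _ _; set b := udsum _ _ _ _ _.
  by have := sqr_ge0 ((a - h1 x) - (b - h2 x)); nra.
rewrite (fintD q A0 B0) !fintZ//; [|by move=> x; exact: sqr_ge0..].
have -> : d%:E = (2%:E * (d / 4)%:E + 2%:E * (d / 4)%:E)%E.
  by rewrite -!EFinM -EFinD; congr EFin; field.
apply: leeD; apply: lee_wpmul2l; rewrite ?lee_fin//.
  by apply: (le_trans (hb1 n.+1)); rewrite lee_fin ltW//; apply: hN1; exact: leqW.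
by apply: (le_trans (hb2 n)); rewrite lee_fin ltW//; exact: hN2.
Qed.

Lemma Re_chebop_sum N f x : complex.Re (chebop_sum (@flow_laplacian R q T) k0 N f x) =
  cheb_mean_sum N (re f) x.
Proof.
rewrite Re_sum; apply: eq_bigr => n _.
by rewrite ReM/= mul0r subr0 (chebop_laplacian hT hray q0 n f).1.
Qed.

Lemma Im_chebop_sum N f x : complex.Im (chebop_sum (@flow_laplacian R q T) k0 N f x) =
  cheb_mean_sum N (im f) x.
Proof.
rewrite Im_sum; apply: eq_bigr => n _.
by rewrite ImM/= mul0r addr0 (chebop_laplacian hT hray q0 n f).2.
Qed.

End coefficients.

Lemma inL2_re f : inLp q 2 f -> square_fint q (re f).
Proof.
move=> /inL2P; apply: le_lt_trans; apply: le_fint => x; first exact: sqr_ge0.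
by rewrite sqr_modulus lerDl sqr_ge0.
Qed.

Lemma inL2_im f : inLp q 2 f -> square_fint q (im f).
Proof.
move=> /inL2P; apply: le_lt_trans; apply: le_fint => x; first exact: sqr_ge0.
by rewrite sqr_modulus lerDr sqr_ge0.
Qed.

Lemma finitely_supported_seq f : finitely_supported f ->
  exists2 s : seq T, uniq s & forall x, x \notin s -> f x = 0.
Proof.
move=> ff; exists (fset_set [set x | f x != 0]); first exact: fset_uniq.
by move=> x; rewrite in_fset_set// notin_setE/= => /negP; rewrite negbK => /eqP.
Qed.

Lemma finitely_supported_L2 f : finitely_supported f -> inLp q 2 f.
Proof.
move=> /finitely_supported_seq[s us fs]; apply/inL2P.
rewrite /sqn (fint_seq q _ us) ?ltry//; first by move=> x; exact: sqr_ge0.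
by move=> x /fs ->; rewrite sqr_modulus /= expr0n addr0.
Qed.

Lemma powR_sum4 (a b c d p : R) : 0 <= a -> 0 <= b -> 0 <= c -> 0 <= d -> 0 < p ->
  (a + b + c + d) `^ p <= 4 `^ p * (a `^ p + b `^ p + c `^ p + d `^ p).
Proof.
move=> a0 b0 c0 d0 p0; pose m := Num.max (Num.max a b) (Num.max c d).
have [am bm cm dm] : [/\ a <= m, b <= m, c <= m & d <= m].
  by rewrite /m !le_max !lexx ?orbT.
have m0 : 0 <= m by exact: le_trans am.
have ap := powR_ge0 a p; have bp := powR_ge0 b p.
have cp := powR_ge0 c p; have dp := powR_ge0 d p.
apply: (@le_trans _ _ ((4 * m) `^ p)).
  apply: ge0_ler_powR; rewrite ?nnegrE ?(ltW p0)//; [|by rewrite mulr_ge0|lra].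
  by rewrite !addr_ge0.
rewrite powRM//; apply: ler_wpM2l; first exact: powR_ge0.
by rewrite /m; case: (leP (Num.max a b)) => _; [case: (leP c)|case: (leP a)] => _; lra.
Qed.

Section transform.
Variables (eps : T -> R[i]) (M : R).
Hypothesis epsM : forall x, modulus (eps x) <= M.
Hypothesis eps_sum0 : forall x, \sum_(y \in successors x) eps y = 0.
Variable k0 : R.
Hypothesis k0_gt0 : 0 < k0.

Local Notation eR := (re eps).
Local Notation eI := (im eps).
Local Notation rz e g := (riesz q e (rieszc k0) g).

Let eRM x : `|eR x| <= M. Proof. exact: le_trans (Re_le_modulus _) (epsM x). Qed.
Let eIM x : `|eI x| <= M. Proof. exact: le_trans (Im_le_modulus _) (epsM x). Qed.

Let eR0 x : smean eR x = 0.
Proof.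
have := eps_sum0 x; rewrite (sum_successors hT) => /(congr1 (@complex.Re R)).
by rewrite Re_sum /smean => ->; rewrite mulr0.
Qed.

Let eI0 x : smean eI x = 0.
Proof.
have := eps_sum0 x; rewrite (sum_successors hT) => /(congr1 (@complex.Im R)).
by rewrite Im_sum /smean => ->; rewrite mulr0.
Qed.

Let K0 : 0 < 4 * k0. Proof. exact: mulr_gt0. Qed.

(** The complex bilinear expression in eps and f, in real and imaginary parts. *)
Definition riesz_op f : T -> R[i] := fun x =>
  (rz eR (re f) x - rz eI (im f) x) +i* (rz eR (im f) x + rz eI (re f) x).

Lemma riesz_op_linear : linear_on_L2 q riesz_op.
Proof.
move=> c f g hf hg; apply/funext => x.
have lin e : (forall x, `|e x| <= M) -> forall (b d : R) (g1 g2 g3 : T -> R),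
    square_fint q g1 -> square_fint q g2 -> square_fint q g3 ->
    rz e (fun x => b * g1 x + (d * g2 x + g3 x)) x =
    b * rz e g1 x + (d * rz e g2 x + rz e g3 x).
  move=> eM b d g1 g2 g3 h1 h2 h3.
  have rl := @riesz_lin R T q hT hray q2 e M eM (rieszc k0) (4 * k0)
    (rieszc_gt0 k0_gt0) (rieszc_le k0_gt0).
  by rewrite rl// ?rl//; exact: square_fint_lin.
have reE : re (fun x => c * f x + g x) = (fun x => complex.Re c * re f x +
    (- complex.Im c * im f x + re g x)).
  by apply/funext => y; rewrite ReD ReM; ring.
have imE : im (fun x => c * f x + g x) = (fun x => complex.Re c * im f x +
    (complex.Im c * re f x + im g x)).
  by apply/funext => y; rewrite ImD ImM; ring.
have [fr fi] := (inL2_re hf, inL2_im hf); have [gr gi] := (inL2_re hg, inL2_im hg).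
rewrite /riesz_op reE imE; apply: complexE; rewrite ?ReD ?ImD ?ReM ?ImM /= !lin//; ring.
Qed.

Lemma modulus_riesz_op f x : modulus (riesz_op f x) <=
  `|rz eR (re f) x| + `|rz eI (im f) x| + `|rz eR (im f) x| + `|rz eI (re f) x|.
Proof.
apply: (le_trans (modulus_le _)); rewrite /= -addrA.
by apply: lerD; [exact: ler_normB|exact: ler_normD].
Qed.

Lemma riesz_op_Lp p : 1 < p -> exists2 C, 0 <= C & forall f, inLp q 2 f ->
  (fint q (fun x => modulus (riesz_op f x) `^ p)%R <=
    C%:E * fint q (fun x => modulus (f x) `^ p)%R)%E.
Proof.
move=> p1; have p0 : 0 < p by lra.
have [C C0 hC] := riesz_Lp hT hray q2 eRM eR0 K0 (rieszc_gt0 k0_gt0) (rieszc_le k0_gt0) p1.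
have [D D0 hD] := riesz_Lp hT hray q2 eIM eI0 K0 (rieszc_gt0 k0_gt0) (rieszc_le k0_gt0) p1.
exists (4 `^ p * (C + D + C + D)).
  by rewrite mulr_ge0 ?powR_ge0// !addr_ge0// ltW.
move=> f hf; have [fr fi] := (inL2_re hf, inL2_im hf).
set I := fint q (fun x => modulus (f x) `^ p).
have mono (g : T -> R) : (forall x, `|g x| <= modulus (f x)) ->
    (fint q (fun x => `|g x| `^ p)%R <= I)%E.
  move=> gf; apply: le_fint => x; first exact: powR_ge0.
  by apply: ge0_ler_powR; rewrite ?nnegrE ?modulus_ge0// ltW.
have rI := mono (re f) (fun x => Re_le_modulus (f x)).
have iI := mono (im f) (fun x => Im_le_modulus (f x)).
have I0 : (0 <= I)%E by apply: fint_ge0 => x; exact: powR_ge0.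
have P0 (g : T -> R) x : 0 <= `|g x| `^ p by exact: powR_ge0.
have b0 : 0 <= 4 `^ p by exact: powR_ge0.
pose A := rz eR (re f); pose B := rz eI (im f).
pose A' := rz eR (im f); pose B' := rz eI (re f).
have s0 x : 0 <= `|A x| `^ p + `|B x| `^ p + `|A' x| `^ p + `|B' x| `^ p.
  by rewrite !addr_ge0.
apply: (@le_trans _ _ (fint q (fun x => 4 `^ p *
    (`|A x| `^ p + `|B x| `^ p + `|A' x| `^ p + `|B' x| `^ p))%R)).
  apply: le_fint => x; first exact: powR_ge0.
  apply: le_trans (powR_sum4 (normr_ge0 _) (normr_ge0 _) (normr_ge0 _) (normr_ge0 _) p0).
  apply: ge0_ler_powR; rewrite ?nnegrE ?modulus_ge0 ?(ltW p0)//.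
  exact: modulus_riesz_op.
rewrite (fintZ q b0 s0) EFinM -muleA; apply: lee_wpmul2l; first by rewrite lee_fin.
rewrite !fintD; [|by move=> x; rewrite ?addr_ge0..].
have [C1 D1] := (ltW C0, ltW D0).
rewrite !EFinD !ge0_muleDl ?lee_fin ?addr_ge0//.
have C2 : (0 <= C%:E)%E by rewrite lee_fin.
have D2 : (0 <= D%:E)%E by rewrite lee_fin.
apply: leeD; last exact: (le_trans (hD _ fr) (lee_wpmul2l D2 rI)).
apply: leeD; last exact: (le_trans (hC _ fi) (lee_wpmul2l C2 iI)).
apply: leeD; last exact: (le_trans (hD _ fi) (lee_wpmul2l D2 iI)).
exact: (le_trans (hC _ fr) (lee_wpmul2l C2 rI)).
Qed.

(** If the modulus exceeds lam, one of the four real terms exceeds lam / 4. *)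
Lemma riesz_op_weak : exists C : R, forall lam f, 0 < lam -> inLp q 2 f ->
  (flow_measure R q [set x : T | (lam < modulus (riesz_op f x))%R]
     <= (C * lam^-1)%:E * fint q (fun x => modulus (f x))%R)%E.
Proof.
have [C C0 hC] := riesz_weak hT hray q2 eRM eR0 K0 (rieszc_gt0 k0_gt0)
  (rieszc_dec k0_gt0) (rieszc_le k0_gt0).
have [D D0 hD] := riesz_weak hT hray q2 eIM eI0 K0 (rieszc_gt0 k0_gt0)
  (rieszc_dec k0_gt0) (rieszc_le k0_gt0).
exists (4 * (C + D + C + D)) => lam f l0 hf.
have [fr fi] := (inL2_re hf, inL2_im hf).
set I := fint q (fun x => modulus (f x)).
have rI : (fint q (fun x => `|re f x|)%R <= I)%E.
  by apply: le_fint => x //; exact: Re_le_modulus.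
have iI : (fint q (fun x => `|im f x|)%R <= I)%E.
  by apply: le_fint => x //; exact: Im_le_modulus.
have I0 : (0 <= I)%E by apply: fint_ge0 => x; exact: modulus_ge0.
have l4 : 0 < lam / 4 by rewrite divr_gt0.
pose V (g : T -> R) : T -> R := \1_[set x | lam / 4 < `|g x|].
have V0 g x : 0 <= V g x by rewrite /V indicE.
pose A := rz eR (re f); pose B := rz eI (im f).
pose A' := rz eR (im f); pose B' := rz eI (re f).
rewrite flow_measure_fint.
apply: (@le_trans _ _ (fint q (fun x => V A x + V B x + V A' x + V B' x)%R)).
  apply: le_fint => x; first by rewrite indicE.
  rewrite indicE; case: (boolP (x \in _)) => [/set_mem/= h|_]; last by rewrite !addr_ge0.
  have {}h := lt_le_trans h (modulus_riesz_op f x).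
  have v1 (g : T -> R) : lam / 4 < `|g x| -> V g x = 1 by move=> gx; rewrite /V indicE mem_set.
  have [a0 b0 c0 d0] := And4 (V0 A x) (V0 B x) (V0 A' x) (V0 B' x).
  have [a|a] := ltP (lam / 4) `|A x|; first by rewrite (v1 A a) /=; lra.
  have [b|b] := ltP (lam / 4) `|B x|; first by rewrite (v1 B b) /=; lra.
  have [c|c] := ltP (lam / 4) `|A' x|; first by rewrite (v1 A' c) /=; lra.
  have [d|d] := ltP (lam / 4) `|B' x|; first by rewrite (v1 B' d) /=; lra.
  by move: h; rewrite -/A -/B -/A' -/B'; lra.
rewrite !fintD; [|by move=> x; rewrite ?addr_ge0..].
have -> : (4 * (C + D + C + D)) * lam^-1 =
    C / (lam / 4) + D / (lam / 4) + C / (lam / 4) + D / (lam / 4).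
  by field; rewrite gt_eqF.
have C2 : (0 <= (C / (lam / 4))%:E)%E by rewrite lee_fin ltW// divr_gt0.
have D2 : (0 <= (D / (lam / 4))%:E)%E by rewrite lee_fin ltW// divr_gt0.
rewrite !EFinD !ge0_muleDl ?adde_ge0//.
apply: leeD; last exact: (le_trans (hD _ _ l4 fr) (lee_wpmul2l D2 rI)).
apply: leeD; last exact: (le_trans (hC _ _ l4 fi) (lee_wpmul2l C2 iI)).
apply: leeD; last exact: (le_trans (hD _ _ l4 fi) (lee_wpmul2l D2 iI)).
exact: (le_trans (hC _ _ l4 fr) (lee_wpmul2l C2 rI)).
Qed.

Lemma grad_eps_smean u x :
  grad_eps q eps u x =
  (smean (fun y => eR y * re u y) x - smean (fun y => eI y * im u y) x) +i*
  (smean (fun y => eR y * im u y) x + smean (fun y => eI y * re u y) x).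
Proof.
have qE : (q%:R : R[i])^-1 = ((q%:R : R)^-1)%:C by rewrite fmorphV rmorph_nat.
rewrite /grad_eps (sum_successors hT x (fun y => eps y * u y)) qE.
apply: complexE; rewrite ?ReM ?ImM /= mul0r ?subr0 ?addr0 ?Re_sum ?Im_sum /smean.
  rewrite -mulrBr -sumrB; congr (_ * _); apply: eq_bigr => y _; exact: ReM.
rewrite -mulrDr -big_split; congr (_ * _); apply: eq_bigr => y _; exact: ImM.
Qed.

Variable E : set R -> (T -> R[i]) -> (T -> R[i]).
Hypothesis hE : spectral_resolution q (@flow_laplacian R q T) E.
Hypothesis hk : forall t : R, 0 < t <= 2 ->
  (fun N => cheb_sum k0 N t) @ \oo --> (Num.sqrt t)^-1.

Lemma riesz_op_finitely_supported f : finitely_supported f ->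
  exists u, inv_sqrt q E f u /\ riesz_op f = grad_eps q eps u.
Proof.
move=> ff; have [s us fs] := finitely_supported_seq ff.
have hf := finitely_supported_L2 ff.
have [|hr [er cr]] := @cheb_mean_sum_lim k0 k0_gt0 s (re f); first by move=> x /fs ->.
have [|hi [ei ci]] := @cheb_mean_sum_lim k0 k0_gt0 s (im f); first by move=> x /fs ->.
pose u x : R[i] := hr x +i* hi x.
have cv : L2_cvg q (fun N => chebop_sum (@flow_laplacian R q T) k0 N f) u.
  apply/L2_cvgP => d d0; have d2 : 0 < d / 2 by rewrite divr_gt0.
  have [N1 h1] := cr _ d2; have [N2 h2] := ci _ d2.
  exists (maxn N1 N2) => n; rewrite geq_max => /andP[/h1 n1 /h2 n2].
  rewrite sqn_re_im [d]splitr EFinD; apply: leeD.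
    rewrite (@eq_fint _ q _ _ (fun x => (cheb_mean_sum k0 n (re f) x - hr x) ^+ 2))//.
    by move=> x; rewrite ReD ReN Re_chebop_sum.
  rewrite (@eq_fint _ q _ _ (fun x => (cheb_mean_sum k0 n (im f) x - hi x) ^+ 2))//.
  by move=> x; rewrite ImD ImN Im_chebop_sum.
have hS N : inLp q 2 (chebop_sum (@flow_laplacian R q T) k0 N f).
  elim: N => [|N IH].
    rewrite (_ : chebop_sum _ _ _ _ = (fun=> 0)); first exact: inL2_0.
    by apply/funext => x; rewrite /chebop_sum big_ord0.
  rewrite (_ : chebop_sum _ _ _ _ = (fun x => (k0 * (2 / odc R N))%:C *
      chebop (@flow_laplacian R q T) N f x + chebop_sum (@flow_laplacian R q T) k0 N f x)).
    apply: inL2_lin => //; apply: chebop_L2 => // g; exact: laplacian_L2.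
  by apply/funext => x; rewrite /chebop_sum big_ord_recr addrC.
have hu : inLp q 2 u.
  have [N hN] := proj1 (L2_cvgP q _ _) cv 1 ltr01.
  have h1 : inLp q 2 (fun x => chebop_sum (@flow_laplacian R q T) k0 N f x - u x).
    by apply/inL2P; apply: (le_lt_trans (hN N (leqnn N))); exact: ltry.
  rewrite (_ : u = (fun x => chebop_sum (@flow_laplacian R q T) k0 N f x -
    (chebop_sum (@flow_laplacian R q T) k0 N f x - u x))); first exact: inL2B.
  by apply/funext => x; rewrite opprB addrC subrK.
exists u; split.
  apply: (chebop_sum_inv_sqrt q0 hE _ _ k0_gt0) => //.
  - by move=> g; exact: laplacian_L2.
  - by move=> g _; exact: laplacian_contr.
apply/funext => x; rewrite grad_eps_smean /riesz_op.
by rewrite (er _ _ eR0) (er _ _ eI0) (ei _ _ eR0) (ei _ _ eI0).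
Qed.

End transform.
End riesz_transform_tree.

Theorem mainTheorem4 (R : realType) (q : nat) (hq : (2 <= q)%N)
    (T : rayGraph) (hT : homogeneous_tree T q) (hray : geodesic_ray T)
    (eps : T -> R[i])
    (eps_bounded : exists M : R, forall x, modulus (eps x) <= M)
    (eps_sum0 : forall x : T, \sum_(y \in successors x) eps y = 0)
    (E : set R -> (T -> R[i]) -> (T -> R[i]))
    (hE : spectral_resolution q (@flow_laplacian R q T) E) :
  exists S : (T -> R[i]) -> (T -> R[i]),
    [/\ riesz_transform q E eps S,
        forall p : R, 1 < p -> exists Cp : R,
          forall f : T -> R[i], finitely_supported f ->
            (LpNorm q p (S f) <= Cp%:E * LpNorm q p f)%E
      & exists C : R, forall (lambda : R) (f : T -> R[i]), 0 < lambda ->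
          inLp q 1 f -> inLp q 2 f ->
          (flow_measure R q [set x : T | (lambda < modulus (S f x))%R]
             <= (C * lambda^-1)%:E * LpNorm q 1 f)%E].
Proof.
have [M epsM] := eps_bounded.
have [k0 k0_gt0 hk] := cheb_invsqrt_cvg R.
exists (riesz_op q eps k0); split.
- split.
  + exact: (riesz_op_linear hT hray hq epsM).
  + have lt12 : 1 < 2 :> R by rewrite ltr1n.
    have [C C0 hC] := riesz_op_Lp hT hray hq epsM eps_sum0 k0_gt0 lt12.
    by exists (C `^ 2^-1) => f hf; apply: LpNorm_le => //; exact: hC.
  + exact: (riesz_op_finitely_supported hT hray hq eps_sum0 k0_gt0 hE hk).
- move=> p p1; have [C C0 hC] := riesz_op_Lp hT hray hq epsM eps_sum0 k0_gt0 p1.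
  exists (C `^ p^-1) => f ff; apply: LpNorm_le => //; first exact: lt_trans p1.
  exact/hC/finitely_supported_L2.
have [C hC] := riesz_op_weak hT hray hq epsM eps_sum0 k0_gt0.
exists C => lam f l0 _ hf; rewrite (_ : LpNorm q 1 f = fint q (fun x => modulus (f x))).
  exact: hC.
rewrite LpNorm_fint invr1 poweRe1; last by apply: fint_ge0 => x; exact: powR_ge0.
by apply: eq_fint => x; rewrite powRr1// modulus_ge0.
Qed.
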